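(* Let $p_1\ge p_2\ge\cdots>0$ with $\sum_{j\ge1}p_j=1$, and let $n_0$ be as defined in the context. Let $K_n$ be the number of occupied boxes when $n$ balls are thrown independently into boxes $1,2,\ldots$, each ball hitting box $j$ with probability $p_j$. Set $\mu_n:=\mathbb E K_n$ and $\sigma_n^2:=\mathrm{Var}\,K_n$. Then $$d_{\rm TV}\bigl(\mathcal L(K_n),\mathrm{TP}(\mu_n,\sigma_n^2)\bigr)=O(\sigma_n^{-1}),\qquad d_{\rm loc}\bigl(\mathcal L(K_n),\mathrm{TP}(\mu_n,\sigma_n^2)\bigr)=O(\sigma_n^{-2}),$$ uniformly in $n\ge n_0$; that is, there is a constant $C<\infty$, not depending on $n$, such that for all integers $n\ge n_0$ the first distance is at most $C\sigma_n^{-1}$ and the second is at most $C\sigma_n^{-2}$.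
   Context: Occupancy scheme: $n$ balls are thrown independently into boxes $1,2,\ldots$ with probabilities $p_j$; $N_j$ is the number of balls in box $j$, and $K_n=\#\{j\ge1: N_j\ge1\}$. $\mathcal L(X)$ denotes the distribution of $X$. Distances: for probability distributions $P,Q$ on the integers, $d_{\rm TV}(P,Q):=\sup_A|P(A)-Q(A)|$ and $d_{\rm loc}(P,Q):=\sup_{j\in\mathbb Z}|P\{j\}-Q\{j\}|$. Translated Poisson distribution: $\mathrm{TP}(\mu,\sigma^2)$ is the distribution of $a+Z$, where $a$ is an integer and $Z$ has the Poisson distribution with mean $\lambda$, with $a$ and $\lambda$ chosen so that $a+\lambda=\mu$ and $\sigma^2\le\lambda<\sigma^2+1$. Definition of $j_0$, $P_0$, $j_n$, $n_0$: $j_0$ is defined by $\sum_{j\ge j_0-1}p_j\ge 1/2>\sum_{j\ge j_0}p_j=:P_0$. For each $n$, $j_n\ge1$ is defined by $p_{j_n-1}\ge 4n^{-1}\log n>p_{j_n}$ (the first inequality being vacuous if $j_n=1$). The integer $n_0\ge3$ is such that $j_n\ge j_0$ for all $n\ge n_0$, and also $n_0/\log^2 n_0\ge 16/P_0$. *)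

(* Defs.v *)
From HB Require Import structures.
From mathcomp Require Import all_boot all_order all_algebra archimedean finmap.
From mathcomp Require Import all_classical all_reals all_analysis.
From mathcomp Require Import lra.

Set Implicit Arguments.
Unset Strict Implicit.
Unset Printing Implicit Defensive.

Import Order.TTheory GRing.Theory Num.Theory.
Import numFieldNormedType.Exports.

Local Open Scope classical_set_scope.
Local Open Scope ring_scope.

HB.instance Definition _ := isPointed.Build int 0.

(* Every set of integers is measurable. *)
HB.instance Definition _ := @isMeasurable.Build default_measure_display
  int discrete_measurable discrete_measurable0
  discrete_measurableC discrete_measurableU.

Section distances.
Context {R : realType}.
Local Open Scope ereal_scope.

Definition dTV (P Q : probability int R) : \bar R :=
  ereal_sup [set `|P A - Q A| | A in [set: set int]].

Definition dloc (P Q : probability int R) : \bar R :=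
  ereal_sup [set `|P [set j] - Q [set j]| | j in [set: int]].

End distances.

Section translated_poisson.
Context {R : realType}.

Definition shift_int (a : int) (z : nat) : int := a + z%:Z.

Lemma measurable_shift_int a : measurable_fun [set: nat] (shift_int a).
Proof. by []. Qed.

HB.instance Definition _ a :=
  isMeasurableFun.Build _ _ _ _ (shift_int a) (measurable_shift_int a).

(* The only a : int and lam : R with a + lam = mu and s2 <= lam < s2 + 1;
   see tp_shift_meanP. *)
Definition tp_shift (mu s2 : R) : int := Num.floor (mu - s2).
Definition tp_mean (mu s2 : R) : R := mu - (tp_shift mu s2)%:~R.

Lemma tp_shift_meanP (mu s2 : R) (a : int) (lam : R) :
  (a%:~R + lam = mu /\ s2 <= lam < s2 + 1) <->
  (a = tp_shift mu s2 /\ lam = tp_mean mu s2).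
Proof.
rewrite /tp_mean /tp_shift; split=> [[<- /andP[l1 l2]]|[-> ->]].
  have -> : Num.floor (a%:~R + lam - s2) = a.
    by apply: Num.Theory.floor_def; rewrite intrD1; apply/andP; split; lra.
  by split=> //; lra.
split; first by lra.
have /andP[] := Num.Theory.floor_itv (mu - s2).
by rewrite intrD1 => h1 h2; apply/andP; split; lra.
Qed.

(* The second argument of poisson_prob is a dummy; when its first argument is 0
   poisson_prob is the Dirac mass at 0. *)
Definition TP (mu s2 : R) : probability int R :=
  distribution (poisson_prob (tp_mean mu s2) 0) (shift_int (tp_shift mu s2)).

End translated_poisson.

Section occupancy.
Context d (T : measurableType d) (R : realType) (P : probability T R).

(* Taking A i = setT for the indices outside a subfamily gives the product rule
   for that subfamily. *)
Definition mutually_independent d' (U : measurableType d') (I : finType)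
    (X : I -> {RV P >-> U}) : Prop :=
  forall A : I -> set U, (forall i, measurable (A i)) ->
    P (\bigcap_(i in [set: I]) (X i @^-1` A i)) =
    (\prod_(i : I) P (X i @^-1` A i))%E.

(* Boxes are numbered from 1, so the value p 0 is irrelevant; X i is the box hit
   by ball i. *)
Definition occupancy_scheme (p : nat -> R) n (X : 'I_n -> {RV P >-> nat}) : Prop :=
  mutually_independent X /\
  forall (i : 'I_n) (j : nat), (1 <= j)%N -> P (X i @^-1` [set j]) = (p j)%:E.

Definition box_count n (X : 'I_n -> {RV P >-> nat}) (j : nat) (w : T) : nat :=
  #|[pred i : 'I_n | X i w == j]|.

Definition occupied n (X : 'I_n -> {RV P >-> nat}) (w : T) : nat :=
  #|` fset_set [set j : nat | (1 <= j)%N /\ (1 <= box_count X j w)%N] |%fset.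

(* fset_set is set0 on infinite sets *)
Lemma finite_occupied n (X : 'I_n -> {RV P >-> nat}) (w : T) :
  finite_set [set j : nat | (1 <= j)%N /\ (1 <= box_count X j w)%N].
Proof.
apply: (@sub_finite_set _ _ [set X i w | i in [set: 'I_n]]); last first.
  exact/finite_image/finite_finset.
by move=> j /= [_ /card_gt0P[i]]; rewrite inE => /eqP <-; exists i.
Qed.

Definition occupied_int n (X : 'I_n -> {RV P >-> nat}) (w : T) : int :=
  (occupied X w)%:Z.

Lemma measurable_occupied_int n (X : 'I_n -> {RV P >-> nat}) :
  measurable_fun [set: T] (occupied_int X).
Proof.
move=> _ A _; rewrite setTI.
pose Y (w : T) : {ffun 'I_n -> nat} := [ffun i => X i w].
pose F (x : {ffun 'I_n -> nat}) := \bigcap_(i in [set: 'I_n]) (X i @^-1` [set x i]).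
have -> : occupied_int X @^-1` A = \bigcup_(x in Y @` (occupied_int X @^-1` A)) F x.
  apply/seteqP; split=> [w Aw|w [_ [v Av <-]] Fw] /=.
    by exists (Y w); [exists w | move=> i _ /=; rewrite ffunE].
  have XE i : X i w = X i v by have /= -> := Fw i I; rewrite ffunE.
  suff -> : occupied_int X w = occupied_int X v by [].
  rewrite /occupied_int /occupied; congr (#|` fset_set _|%fset)%:Z.
  have bE j : box_count X j w = box_count X j v.
    by apply: eq_card => i; rewrite !inE XE.
  by apply/seteqP; split=> j /=; rewrite bE.
rewrite bigcup_mkcond; apply: countable_bigcupT_measurable => // x.
case: ifP => // _; apply: fin_bigcap_measurable => [|i _]; first exact: finite_finset.
by rewrite -[_ @^-1` _]setTI; exact: measurable_funPT.
Qed.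

HB.instance Definition _ n (X : 'I_n -> {RV P >-> nat}) :=
  isMeasurableFun.Build _ _ _ _ (occupied_int X) (measurable_occupied_int X).

Definition occupied_law n (X : 'I_n -> {RV P >-> nat}) : probability int R :=
  distribution P (occupied_int X).

Definition occupied_mean n (X : 'I_n -> {RV P >-> nat}) : R :=
  fine 'E_P[fun w => (occupied X w)%:R].

Definition occupied_var n (X : 'I_n -> {RV P >-> nat}) : R :=
  fine 'V_P[fun w => (occupied X w)%:R].

End occupancy.

Section thresholds.
Context {R : realType}.
Variable p : nat -> R.

Definition tail (m : nat) : \bar R := (\sum_(m <= j <oo) (p j)%:E)%E.

Definition is_j0 (j0 : nat) : Prop :=
  [/\ (1 <= j0)%N, ((2^-1)%:E <= tail j0.-1)%E & (tail j0 < (2^-1)%:E)%E].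

Definition is_jn (n j : nat) : Prop :=
  [/\ (1 <= j)%N,
      (j != 1)%N -> 4 * n%:R^-1 * ln n%:R <= p j.-1 &
      p j < 4 * n%:R^-1 * ln n%:R].

Definition is_n0 (j0 n0 : nat) : Prop :=
  [/\ (3 <= n0)%N,
      forall n j, (n0 <= n)%N -> is_jn n j -> (j0 <= j)%N &
      16 / fine (tail j0) <= n0%:R / ln n0%:R ^+ 2].

End thresholds.

(* Main.v *)
Require Import Defs.
From mathcomp Require Import all_boot all_order all_algebra.
From mathcomp Require Import all_classical all_reals all_analysis.
From mathcomp Require Import measurable_realfun finmap zify ring lra.

Set Implicit Arguments.
Unset Strict Implicit.
Unset Printing Implicit Defensive.

Import Order.TTheory GRing.Theory Num.Theory.
Import numFieldNormedType.Exports.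

Local Open Scope classical_set_scope.
Local Open Scope ring_scope.

(** Notation: [w] is the law of one ball on a finite set [J] of boxes, [s : seq J]
    lists the boxes hit by the successive balls, [occ s] is the number of occupied
    boxes, and [fdiff f] is the first difference of [f]. The number of occupied
    boxes is also written [K], and [mu] and [s2] are its mean and variance.

    The proof is an instance of Stein's method for the Poisson law. Let [f] solve
    [lam * f v.+1 - v * f v = h v - E h(Z)] with [Z] Poisson of mean [lam], and let
    [F] be [f] moved by the integer [a], where [a + lam = mu] and
    [s2 <= lam < s2 + 1]. Taking expectations at [K] shows that
    [E h(K - a) - E h(Z)] equals the Stein defect
    [E (s2 * fdiff F K - (K - mu) * F K)], up to the two errors that come from
    [lam - s2] and from the event [K < a] ([stein_compare]). Both are at most
    [1 / lam]: the first because the increments of [f] are, the second by Chebyshev's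
    inequality, since [a] lies [lam >= s2] below the mean. For the indicator [h] of
    a set the increments of [f] are at most [1 / lam] ([set_sol_fdiff]), and for a
    single point their absolute values add up to at most [2 / lam]
    ([point_sol_variation]). So both claims follow from the bounds
    [C * sup |fdiff F| * sqrt s2] and [C * sum |fdiff F|] for the defect, and only
    for large [s2], because the distances are at most 1.

    The number of occupied boxes satisfies a Stein identity,
    [Cov (K, f K) = E (T * fdiff f (occ s))], where [s] has one ball fewer and [T],
    called [kernel] below, is an explicit function of [s] ([kernel_identity]). It is
    obtained box by box, by telescoping over the number of balls that are required
    to miss the box. Taking [f] to be the identity shows that [E T = s2]. Hence the
    defect is [- E ((T - s2) * fdiff f (occ s))] plus [s2] times the expectation of
    a second difference weighted by the chance that the missing ball enters an
    empty box ([stein_defectE]).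

    [T - s2] is small on average. Up to a product of two centred variables, which is
    bounded in mean by the Cauchy-Schwarz inequality, [T] is a sum over boxes of
    combinations of indicators that initial segments of the throws miss the box,
    and such indicators are negatively correlated for different boxes. So the mean
    of [|T - s2|] is at most of order [sqrt V], where [V] is the sum over the boxes
    of the variances of the emptiness indicators ([var_kernel_lin]). That [V] and [s2] have the same order
    ([kernel_mean_ge], [kernel_mean_le]) uses a set [D] of light boxes with total
    weight at most [1 / 8] and finite complement.

    The second differences, and the conditioning on [K = m] in the local bound, need
    smoothness of the law of [K]. A ball is thrown in two stages. It first receives
    a mark, a light box having twice its weight; a ball marked with a light box then
    tosses a fair coin to decide between that box and a fixed heavy box [o]. Given
    the marks, the light boxes are occupied independently, so the count is a sum of
    independent Bernoulli variables, each a mixture of a fair coin and a constant.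
    For sums of [b] fair coins the integration by parts [fair_by_parts] bounds
    differences by [1 / sqrt b], and second differences of a point mass by [1 / b];
    [mixops_bound] carries these bounds over to mixtures. In the local bound the
    light boxes are divided in two halves of nearly equal variance, and the
    contribution of one half to [T - s2] is smoothed by the coins of the other half,
    on which it does not depend ([split_point]).

    Finally, for a fixed number of balls the law of [K] is the limit of the laws for
    finitely many boxes, in which all boxes beyond the [m]-th are lumped together
    ([trunc_law_close]). The constants depend on [p] only through [p 1] and the
    number [L] of boxes outside [D], so the bound passes to the limit
    ([law_defect_bound]). *)

(** * Sums of fair coins and of Bernoulli variables *)

Section Smoothing.
Context {R : realType}.
Implicit Types (g h : nat -> R) (q : R) (qs : seq R).

Definition fdiff g : nat -> R := fun k => g k.+1 - g k.

(** The averaging operator of a Bernoulli variable with failure probability [q].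
    Compositions of such operators describe sums of independent Bernoulli
    variables; [fair b] is the case of [b] fair coins. *)
Definition mixop q g : nat -> R := fun k => q * g k + (1 - q) * g k.+1.

Definition fair b g : nat -> R := iter b (mixop 2^-1) g.

Definition mixops qs g : nat -> R := foldl (fun h q => mixop q h) g qs.

Lemma fairS b g : fair b.+1 g = fair b (mixop 2^-1 g).
Proof. exact: iterSr. Qed.

Lemma fair_lin b c g h k :
  fair b (fun j => c * g j + h j) k = c * fair b g k + fair b h k.
Proof.
elim: b k => [//|b IHb] k; rewrite /fair !iterS -!/(fair b _) /mixop !IHb; ring.
Qed.

Lemma fair_le b g h k : (forall j, g j <= h j) -> fair b g k <= fair b h k.
Proof.
move=> gh; elim: b k => [//|b IHb] k.
rewrite /fair !iterS -!/(fair b _) /mixop.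
by have := IHb k; have := IHb k.+1; lra.
Qed.

Lemma fair_cst b (c : R) k : fair b (fun=> c) k = c.
Proof.
elim: b k => [//|b IHb] k.
by rewrite /fair iterS -/(fair b _) /mixop !IHb; field.
Qed.

Lemma fair_fdiff b g k : fair b (fdiff g) k = fdiff (fair b g) k.
Proof.
elim: b k => [//|b IHb] k.
rewrite /fair !iterS -!/(fair b _) /mixop /fdiff !IHb /fdiff; ring.
Qed.

(** [(2 X - m)] for [X] the displacement after [m] fair steps: its product with
   [g] telescopes, which is the discrete integration by parts of a symmetric
   random walk. *)
Lemma fair_by_parts m g k :
  fair m.+1 (fun j => (2 * (j%:R - k%:R) - m.+1%:R) * g j) k =
  m.+1%:R / 2 * fair m (fdiff g) k.
Proof.
elim: m g => [|m IHm] g.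
  by rewrite /fair /= /mixop /fdiff -(natr1 k); field.
rewrite fairS.
have -> : mixop 2^-1 (fun j => (2 * (j%:R - k%:R) - m.+2%:R) * g j) =
    (fun j => 2^-1 * fdiff g j +
      (2 * (j%:R - k%:R) - m.+1%:R) * mixop 2^-1 g j).
  by apply/funext => j; rewrite /mixop /fdiff -(natr1 j) -(natr1 m.+1); field.
rewrite (fair_lin _ 2^-1 (fdiff g)) IHm.
have -> : fdiff (mixop 2^-1 g) = mixop 2^-1 (fdiff g).
  by apply/funext => j; rewrite /mixop /fdiff; ring.
rewrite -fairS -(natr1 m.+1); ring.
Qed.

Lemma fair_second_moment m k :
  fair m (fun j => (2 * (j%:R - k%:R) - m%:R) ^+ 2) k = m%:R.
Proof.
elim: m => [|m IHm]; first by rewrite /fair /=; ring.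
rewrite fairS.
have -> : mixop 2^-1 (fun j => (2 * (j%:R - k%:R) - m.+1%:R) ^+ 2) =
    (fun j => 1 * (2 * (j%:R - k%:R) - m%:R) ^+ 2 + 1).
  by apply/funext => j; rewrite /mixop -(natr1 j) -(natr1 m); field.
by rewrite (fair_lin _ 1 _ (fun=> 1)) IHm fair_cst mul1r natr1.
Qed.

(** After the integration by parts what remains is the mean absolute value of a
    fair walk of [b + 1] steps, at most [sqrt (b + 1)]. *)
Lemma fair_fdiff_bounded b g (c : R) k : (forall j, `|g j| <= c) ->
  `|fair b (fdiff g) k| <= 2 * c / Num.sqrt b.+1%:R.
Proof.
move=> gc; set t := Num.sqrt _.
have t0 : 0 < t by rewrite sqrtr_gt0 ltr0n.
have t2 : t ^+ 2 = b.+1%:R by rewrite sqr_sqrtr ?ler0n.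
have c0 : 0 <= c := le_trans (normr_ge0 _) (gc 0%N).
(* twice the displacement after [b + 1] steps, centred *)
pose h (j : nat) := 2 * (j%:R - k%:R) - b.+1%:R : R.
pose h2 (j : nat) := c / (2 * t) * h j ^+ 2 + c * t / 2.
(* the arithmetic-geometric mean inequality with weight t, the root mean square
   of h *)
have h2E : fair b.+1 h2 k = c * t.
  rewrite /h2 (fair_lin _ _ _ (fun=> c * t / 2)) fair_second_moment fair_cst -t2.
  by field; lra.
have hg j : `|h j * g j| <= h2 j.
  rewrite normrM (le_trans (ler_wpM2l (normr_ge0 _) (gc j))) // /h2.
  rewrite -[h j ^+ 2]real_normK ?num_real //.
  rewrite -subr_ge0 (_ : _ - _ = c / (2 * t) * (`|h j| - t) ^+ 2); last by field; lra.
  by rewrite mulr_ge0 ?sqr_ge0 // divr_ge0 //; lra.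
have : `|fair b.+1 (fun j => h j * g j) k| <= c * t.
  rewrite -h2E ler_norml; apply/andP; split; last first.
    by apply: fair_le => j; apply: le_trans (hg j); exact: ler_norm.
  rewrite (_ : - _ = fair b.+1 (fun j => - 1 * h2 j + 0) k); last first.
    by rewrite (fair_lin _ (- 1) h2 (fun=> 0)) fair_cst addr0 mulN1r.
  apply: fair_le => j; rewrite addr0 mulN1r.
  by have := hg j; rewrite ler_norml => /andP[].
rewrite fair_by_parts normrM ger0_norm ?divr_ge0 ?ler0n // -t2 => H.
rewrite ler_pdivlMr // -(ler_pM2r t0) -(ler_pM2r (_ : 0 < 2^-1 :> R)); last lra.
by move: H; rewrite expr2; lra.
Qed.

(** A point mass is the difference of a step function with values [1 / 2] and
    [- 1 / 2]. *)
Lemma fair_point b (w k : nat) :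
  `|fair b (fun j => (j == w)%:R) k| <= (Num.sqrt b.+1%:R)^-1.
Proof.
pose g (j : nat) : R := (w < j)%N%:R - 2^-1.
have -> : (fun j : nat => (j == w)%:R) = fdiff g.
  apply/funext => j; rewrite /fdiff /g ltnS leq_eqVlt eq_sym.
  by case: eqVneq => [->|]; rewrite ?ltnn /=; lra.
apply: le_trans (fair_fdiff_bounded b k (_ : forall j, `|g j| <= 2^-1)) _.
  by move=> j; rewrite /g; case: ltnP => _ /=; rewrite ler_norml; apply/andP; split; lra.
by rewrite divff ?mul1r // pnatr_eq0.
Qed.

(** Two halves of the [b] steps are used in turn: one to make the point mass
   small, the other to gain from the difference. *)
Lemma fair_fdiff_point b (w k : nat) :
  `|fair b (fdiff (fun j => (j == w)%:R)) k| <= 4 / b.+1%:R.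
Proof.
have -> : fair b (fdiff (fun j => (j == w)%:R)) =
    fair b./2 (fdiff (fair (b - b./2) (fun j => (j == w)%:R))).
  have {1}-> : b = (b./2 + (b - b./2))%N by lia.
  rewrite /fair iterD -!/(fair _ _); congr fair.
  by apply/funext => j; rewrite fair_fdiff.
apply: le_trans (fair_fdiff_bounded _ _ (fair_point _ w)) _.
set b1 := b./2; set b2 := (b - b1)%N.
have b12 : (b1 <= b2)%N && (b2 <= b1.+1)%N.
  by rewrite /b2 /b1; lia.
have b12e : (b1 + b2 = b)%N.
  by rewrite /b2 /b1; lia.
rewrite -[leLHS]mulrA -invfM -sqrtrM ?ler0n //.
have : (b.+1%:R / 2) ^+ 2 <= b2.+1%:R * b1.+1%:R :> R.
  rewrite -b12e.
  have H : (b1 == b2) || (b2 == b1.+1).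
    by lia.
  have b20 : 0 <= b2%:R :> R by [].
  have b10 : 0 <= b1%:R :> R by [].
  have e1 : (b1 + b2).+1%:R = b1%:R + b2%:R + 1 :> R by rewrite -natr1 natrD.
  rewrite e1 -(natr1 b1) -(natr1 b2).
  case/orP: H => /eqP e.
    by rewrite e; nra.
  by rewrite e -(natr1 b1); nra.
move=> H.
have {}H : b.+1%:R / 2 <= Num.sqrt (b2.+1%:R * b1.+1%:R) :> R.
  by rewrite -(@ler_pXn2r _ 2) ?nnegrE ?sqrtr_ge0 ?divr_ge0 // sqr_sqrtr // mulr_ge0.
have b0 : 0 < b.+1%:R :> R by rewrite ltr0n.
have -> : 4 / b.+1%:R = 2 / (b.+1%:R / 2) :> R.
  by clear -b0; field; lra.
by rewrite ler_pM2l // lef_pV2 ?posrE ?divr_gt0 // (lt_le_trans _ H) ?divr_gt0.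
Qed.

(** Half the weight of the fair coin when [mixop q] is written as a mixture of
    [mixop 2^-1] and a shift. The operator [mixop 1] is the identity and brings no
    fair coin at all. *)
Definition coin_weight q : R := if q == 1 then 0 else q.

Lemma mixop_split q g k :
  mixop q g k = (1 - 2 * q) * g k.+1 + 2 * q * mixop 2^-1 g k.
Proof. by rewrite /mixop; field. Qed.

Lemma mixopsS qs g k : mixops qs (g \o succn) k = mixops qs g k.+1.
Proof. by elim: qs g => [//|q qs IHqs] g; rewrite /= -IHqs. Qed.

Lemma mixops_lin qs c g h k :
  mixops qs (fun j => c * g j + h j) k = c * mixops qs g k + mixops qs h k.
Proof.
elim: qs g h => [//|q qs IHqs] g h /=; rewrite -IHqs; congr mixops.
by apply/funext => j; rewrite /mixop; ring.
Qed.

Lemma mixops_mixture q qs b g k : mixops (q :: qs) (fair b g) k =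
  (1 - 2 * q) * mixops qs (fair b g) k.+1 + 2 * q * mixops qs (fair b.+1 g) k.
Proof.
rewrite /= (_ : mixop q _ = fun j => (1 - 2 * q) * (fair b g \o succn) j +
  (2 * q * fair b.+1 g j + 0)); last first.
  by apply/funext => j; rewrite mixop_split /= addr0.
rewrite mixops_lin mixopsS; congr (_ + _).
rewrite mixops_lin (_ : mixops qs (fun=> 0) k = 0) ?addr0 //.
elim: qs => [//|a qs IHqs] /=; rewrite (_ : mixop a _ = fun=> 0) //.
by apply/funext => j; rewrite /mixop !mulr0 addr0.
Qed.

(** Jensen's inequality goes the other way for a convex function; replacing [r] by
    [r / 2] on the right makes up for the difference as long as [1 <= z]. *)
Lemma mean_inv (r z : R) : 0 <= r <= 1 -> 1 <= z ->
  (1 - r) * z^-1 + r * (z + 1)^-1 <= (z + r / 2)^-1.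
Proof.
move=> /andP[r0 r1] z1.
rewrite -[leRHS]mul1r ler_pdivlMr; last lra.
rewrite (_ : _ * (z + r / 2) = 1 - (r * z + r * (r - 1)) / (2 * z * (z + 1))); last first.
  by field; rewrite !gt_eqF //; lra.
rewrite gerBl divr_ge0 //; nra.
Qed.

(** The square of a mean is at most the mean of the squares, which [mean_inv]
    bounds. *)
Lemma mean_sqrt_inv (r z : R) : 0 <= r <= 1 -> 1 <= z ->
  (1 - r) * (Num.sqrt z)^-1 + r * (Num.sqrt (z + 1))^-1 <=
    (Num.sqrt (z + r / 2))^-1.
Proof.
move=> r01 z1; have /andP[r0 r1] := r01; have := mean_inv r01 z1.
set a := z^-1; set b := (z + 1)^-1; set c := (_ + r / 2)^-1.
have -> : (Num.sqrt z)^-1 = Num.sqrt a by rewrite sqrtrV //; lra.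
have -> : (Num.sqrt (z + 1))^-1 = Num.sqrt b by rewrite sqrtrV //; lra.
have -> : (Num.sqrt (z + r / 2))^-1 = Num.sqrt c by rewrite sqrtrV //; lra.
have a0 : 0 <= a by rewrite invr_ge0; lra.
have b0 : 0 <= b by rewrite invr_ge0; lra.
have c0 : 0 <= c by rewrite invr_ge0; lra.
move=> H.
rewrite -(@ler_pXn2r _ 2) ?nnegrE ?sqrtr_ge0 ?addr_ge0 ?mulr_ge0 ?sqrtr_ge0 ?subr_ge0 //.
rewrite (sqr_sqrtr c0); apply: le_trans H.
rewrite -{2}(sqr_sqrtr a0) -{2}(sqr_sqrtr b0).
set x := Num.sqrt a; set y := Num.sqrt b.
rewrite -subr_ge0 (_ : _ - _ = r * (1 - r) * (x - y) ^+ 2); last by ring.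
by rewrite mulr_ge0 ?sqr_ge0 // mulr_ge0 ?subr_ge0.
Qed.

(** A Bernoulli variable with failure probability [q <= 1/2] is, with probability
   [2 q], a fair coin and otherwise the constant 1. The number [b] of fair steps
   thus grows with the total weight, and the convexity of the bound as a function
   of [b] turns the random number of fair coins into its mean. *)
Lemma mixops_bound (bnd : R -> R) (c : R) g qs :
  0 <= c ->
  (forall r z : R, 0 <= r <= 1 -> 1 <= z ->
     (1 - r) * bnd z + r * bnd (z + 1) <= bnd (z + r / 2)) ->
  (forall b k, `|fair b g k| <= c * bnd b.+1%:R) ->
  all (fun q => (q == 1) || (0 <= q <= 2^-1)) qs ->
  forall k, `|mixops qs g k| <= c * bnd (1 + \sum_(q <- qs) coin_weight q).
Proof.
move=> c0 bndP gP qsP k.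
suff H b : `|mixops qs (fair b g) k| <=
    c * bnd (b.+1%:R + \sum_(q <- qs) coin_weight q) by exact: (H 0%N).
have Hgen (s : seq R) : all (fun q => (q == 1) || (0 <= q <= 2^-1)) s ->
    forall z b k, z = b.+1%:R + \sum_(q <- s) coin_weight q ->
    `|mixops s (fair b g) k| <= c * bnd z; last by apply: Hgen.
elim: s => [|q s IHs] /=.
  by move=> _ _ {}b {}k ->; rewrite big_nil addr0.
move=> /andP[qP sP] _ {}b {}k ->; rewrite big_cons.
case/orP: qP => [/eqP ->|qP].
  rewrite /coin_weight eqxx add0r.
  rewrite (_ : mixop 1 (fair b g) = fair b g); last first.
    by apply/funext => j; rewrite /mixop subrr mul0r addr0 mul1r.
  exact: IHs.
have /andP[q0 q2] := qP.
rewrite /coin_weight -/coin_weight ifN; last by apply/eqP; lra.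
rewrite -[mixops s _ k]/(mixops (q :: s) (fair b g) k) mixops_mixture.
set S := \sum_(_ <- _) _.
have S0 : 0 <= S.
  rewrite /S; elim: (s) sP => [|a l IHl] /=; rewrite ?big_nil // big_cons.
  move=> /andP[aP lP]; rewrite addr_ge0 ?IHl // /coin_weight.
  by case: eqP => //; case/orP: aP => [/eqP //|/andP[]].
set z := b.+1%:R + S.
have z1 : 1 <= z by rewrite /z -[b.+1%:R]natr1; have : 0 <= b%:R :> R by []; lra.
rewrite (_ : b.+1%:R + (q + S) = z + (2 * q) / 2); last by rewrite /z; field.
have r01 : 0 <= 2 * q <= 1 by lra.
apply: le_trans (ler_wpM2l c0 (bndP _ _ r01 z1)).
apply: le_trans (ler_normD _ _) _.
have q12 : 0 <= 1 - 2 * q by rewrite subr_ge0; case/andP: r01.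
rewrite !normrM (ger0_norm q12) ?(@ger0_norm _ 2) ?(ger0_norm q0) //.
have e2 : z + 1 = b.+2%:R + S by rewrite /z -(natr1 b.+1); ring.
rewrite mulrDr !(mulrCA c) lerD //.
  by rewrite ler_wpM2l // IHs.
rewrite ler_wpM2l ?mulr_ge0 //.
exact: IHs sP _ _ _ e2.
Qed.

End Smoothing.

(** * Independent throws *)

Lemma sum_indicator (R : realType) (g : nat -> R) n k : (k < n)%N ->
  \sum_(m < n) g m * (k == m)%:R = g k.
Proof.
move=> kn; rewrite (bigD1 (Ordinal kn)) //= eqxx mulr1 big1 ?addr0 // => i ni.
rewrite (_ : (k == i) = false) ?mulr0 //.
by apply: contraNF ni => /eqP e; apply/eqP/val_inj; rewrite /= e.
Qed.

Section Sampling.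
Context {R : realType} {J : finType}.
Implicit Types (F G : seq J -> R) (s : seq J) (w : J -> R).

(** Expectation of a function of [n] independent draws from [w]. The recursion
    exposes the first draw; [Ex_rcons] exposes the last one. *)
Fixpoint Ex w (n : nat) F : R :=
  if n is m.+1 then \sum_x w x * Ex w m (fun s => F (x :: s)) else F [::].

Lemma eq_Ex w n F G : (forall s, size s = n -> F s = G s) -> Ex w n F = Ex w n G.
Proof.
elim: n F G => [|n IHn] F G FG /=; first exact: FG.
by apply: eq_bigr => x _; congr (_ * _); apply: IHn => s sn; apply: FG; rewrite /= sn.
Qed.

Lemma Ex_lin w n (a : R) F G :
  Ex w n (fun s => a * F s + G s) = a * Ex w n F + Ex w n G.
Proof.
elim: n F G => [//|n IHn] F G /=; rewrite mulr_sumr -big_split /=.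
by apply: eq_bigr => x _; rewrite IHn; ring.
Qed.

Lemma Ex0 w n : Ex w n (fun=> 0) = 0.
Proof. by elim: n => //= n IHn; rewrite big1 // => x _; rewrite IHn mulr0. Qed.

Lemma ExZ w n (a : R) F : Ex w n (fun s => a * F s) = a * Ex w n F.
Proof.
by have := Ex_lin w n a F (fun=> 0); rewrite Ex0 addr0 => <-; apply: eq_Ex => s _; rewrite addr0.
Qed.

Lemma ExZr w n (a : R) F : Ex w n (fun s => F s * a) = Ex w n F * a.
Proof. by rewrite mulrC -ExZ; apply: eq_Ex => s _; rewrite mulrC. Qed.

Lemma ExD w n F G : Ex w n (fun s => F s + G s) = Ex w n F + Ex w n G.
Proof.
by have := Ex_lin w n 1 F G; rewrite mul1r => <-; apply: eq_Ex => s _; rewrite mul1r.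
Qed.

Lemma ExB w n F G : Ex w n (fun s => F s - G s) = Ex w n F - Ex w n G.
Proof.
have := Ex_lin w n (-1) G F; rewrite mulN1r addrC => <-.
by apply: eq_Ex => s _; rewrite mulN1r addrC.
Qed.

Lemma Ex_sum w n (I : Type) (r : seq I) (P : pred I) (F : I -> seq J -> R) :
  Ex w n (fun s => \sum_(i <- r | P i) F i s) = \sum_(i <- r | P i) Ex w n (F i).
Proof.
elim: r => [|i r IHr].
  by rewrite big_nil -[RHS](Ex0 w n); apply: eq_Ex => s _; rewrite big_nil.
rewrite big_cons -IHr; case: ifP => Pi; last first.
  by apply: eq_Ex => s _; rewrite big_cons Pi.
by rewrite -ExD; apply: eq_Ex => s _; rewrite big_cons Pi.
Qed.

Lemma Ex_rcons w n F :
  Ex w n.+1 F = Ex w n (fun s => \sum_x w x * F (rcons s x)).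
Proof.
elim: n F => [//|n IHn] F.
rewrite [LHS]/= [RHS]/=; apply: eq_bigr => x _; congr (_ * _).
exact: (IHn (fun s => F (x :: s))).
Qed.

Section Probability.
Context (w : J -> R) (w_ge0 : forall x, 0 <= w x) (w_sum1 : \sum_x w x = 1).

Lemma Ex_ge0 n F : (forall s, 0 <= F s) -> 0 <= Ex w n F.
Proof.
elim: n F => [|n IHn] F F0 /=; first exact: F0.
by apply: sumr_ge0 => x _; rewrite mulr_ge0 // IHn.
Qed.

Lemma Ex_le n F G : (forall s, size s = n -> F s <= G s) -> Ex w n F <= Ex w n G.
Proof.
elim: n F G => [|n IHn] F G FG /=; first exact: FG.
by apply: ler_sum => x _; rewrite ler_wpM2l // IHn // => s sn; rewrite FG //= sn.
Qed.

Lemma Ex_cst n (a : R) : Ex w n (fun=> a) = a.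
Proof. by elim: n => //= n ->; rewrite -mulr_suml w_sum1 mul1r. Qed.

Lemma Ex_norm n F : `|Ex w n F| <= Ex w n (fun s => `|F s|).
Proof.
rewrite ler_norml -mulN1r -ExZ; apply/andP; split; apply: Ex_le => s _.
  by rewrite mulN1r lerNl -normrN ler_norm.
exact: ler_norm.
Qed.

(** The expectation of a weighted arithmetic-geometric mean inequality. Bounds on
    the root mean squares instead of their exact values keep degenerate cases out. *)
Lemma Ex_CauchySchwarz n F G (a b : R) : 0 < a -> 0 < b ->
  Ex w n (fun s => F s ^+ 2) <= a ^+ 2 -> Ex w n (fun s => G s ^+ 2) <= b ^+ 2 ->
  Ex w n (fun s => `|F s| * `|G s|) <= a * b.
Proof.
move=> a0 b0 Fa Gb.
apply: le_trans (_ : Ex w n (fun s => b / (2 * a) * F s ^+ 2 + a / (2 * b) * G s ^+ 2) <= _).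
  apply: Ex_le => s _.
  rewrite -[F s ^+ 2]real_normK ?num_real // -[G s ^+ 2]real_normK ?num_real //.
  rewrite -subr_ge0.
  have -> : b / (2 * a) * `|F s| ^+ 2 + a / (2 * b) * `|G s| ^+ 2 - `|F s| * `|G s| =
      (2 * a * b)^-1 * (b * `|F s| - a * `|G s|) ^+ 2.
    by field; rewrite !gt_eqF.
  by rewrite mulr_ge0 ?sqr_ge0 // invr_ge0 !mulr_ge0 // ltW.
rewrite ExD !ExZ.
have -> : a * b = b / (2 * a) * a ^+ 2 + a / (2 * b) * b ^+ 2.
  by field; rewrite !gt_eqF.
by rewrite lerD // ler_wpM2l // divr_ge0 ?mulr_ge0 // ltW.
Qed.

Lemma Ex_abs_le n F (a : R) : 0 < a ->
  Ex w n (fun s => F s ^+ 2) <= a ^+ 2 -> Ex w n (fun s => `|F s|) <= a.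
Proof.
move=> a0 Fa.
have := @Ex_CauchySchwarz n F (fun=> 1) a 1 a0 ltr01 Fa.
rewrite expr1n Ex_cst => /(_ (lexx 1)); rewrite mulr1; apply: le_trans.
by apply: Ex_le => s _; rewrite normr1 mulr1.
Qed.

(** In the expansion of the square the off-diagonal covariances are nonpositive. *)
Lemma Ex_var_sum n (S : {pred J}) (Z : J -> seq J -> R) :
  (forall i j, i \in S -> j \in S -> i != j ->
     Ex w n (fun s => Z i s * Z j s) <= Ex w n (Z i) * Ex w n (Z j)) ->
  Ex w n (fun s => (\sum_(j in S) Z j s - Ex w n (fun s => \sum_(j in S) Z j s)) ^+ 2) <=
    \sum_(j in S) (Ex w n (fun s => Z j s ^+ 2) - Ex w n (Z j) ^+ 2).
Proof.
move=> negcor; set m := Ex _ _ (fun s => \sum_(j in S) _).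
rewrite (@eq_Ex _ _ _ (fun s => (\sum_(j in S) Z j s) ^+ 2 -
  (2 * m * (\sum_(j in S) Z j s) - m ^+ 2))); last by move=> s _; ring.
rewrite ExB ExB ExZ Ex_cst -/m.
have -> : Ex w n (fun s => (\sum_(j in S) Z j s) ^+ 2) =
    \sum_(i in S) \sum_(j in S) Ex w n (fun s => Z i s * Z j s).
  rewrite (eq_bigr (fun i => Ex w n (fun s => \sum_(j in S) (Z i s * Z j s)))); last first.
    by move=> i _; rewrite Ex_sum.
  rewrite -Ex_sum; apply: eq_Ex => s _.
  by rewrite expr2 mulr_suml; apply: eq_bigr => i _; rewrite mulr_sumr.
have -> : 2 * m * m - m ^+ 2 = \sum_(i in S) \sum_(j in S) Ex w n (Z i) * Ex w n (Z j).
  rewrite (_ : 2 * m * m - m ^+ 2 = m * m); last ring.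
  by rewrite /m Ex_sum mulr_suml; apply: eq_bigr => i _; rewrite mulr_sumr.
rewrite -sumrB; apply: ler_sum => i iS; rewrite -sumrB (bigD1 i) //=.
rewrite (@eq_Ex _ _ (fun s => Z i s * Z i s) (fun s => Z i s ^+ 2)); last first.
  by move=> s _; rewrite expr2.
rewrite expr2 gerDl; apply: sumr_le0 => j /andP[jS ji].
by rewrite subr_le0 negcor // eq_sym.
Qed.

(** [thin c k j] multiplies a factor [1 - c] for each of the first [k] balls that
    hits box [j]: the indicator that they all miss [j] when [c = 1], and
    [2 ^- M] with [M] their number in [j] when [c = 1 / 2]. *)
Definition thin (c : R) (k : nat) (j : J) s : R :=
  \prod_(x <- take k s) (1 - c * (x == j)%:R).

Lemma thin_empty k j s : thin 1 k j s = (j \notin take k s)%:R.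
Proof.
rewrite /thin; elim: (take k s) => [|x l IHl]; first by rewrite big_nil.
rewrite big_cons IHl in_cons negb_or eq_sym mul1r.
by case: eqP => _; rewrite ?subrr ?mul0r ?subr0 ?mul1r.
Qed.

Lemma thin_ge0 c k j s : c <= 1 -> 0 <= thin c k j s.
Proof.
move=> c1; apply: prodr_ge0 => x _.
by case: (x == j); rewrite ?mulr1 ?mulr0; lra.
Qed.

Lemma thin0 c j s : thin c 0 j s = 1. Proof. by rewrite /thin take0 big_nil. Qed.

Lemma thin_cons c k j x s :
  thin c k.+1 j (x :: s) = (1 - c * (x == j)%:R) * thin c k j s.
Proof. by rewrite /thin /= big_cons. Qed.

Lemma sum_hit j : \sum_x w x * (x == j)%:R = w j.
Proof.
rewrite (bigD1 j) //= eqxx mulr1 big1 ?addr0 // => x /negPf ->.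
by rewrite mulr0.
Qed.

Lemma sum_thin c j : \sum_x w x * (1 - c * (x == j)%:R) = 1 - c * w j.
Proof.
have -> : 1 - c * w j = \sum_x w x - c * \sum_x w x * (x == j)%:R.
  by rewrite w_sum1 sum_hit.
rewrite mulr_sumr -sumrB; by apply: eq_bigr => x _; ring.
Qed.

Lemma Ex_thin c n k j : (k <= n)%N -> Ex w n (thin c k j) = (1 - c * w j) ^+ k.
Proof.
elim: n k => [|n IHn] [|k] // kn.
- by rewrite /= thin0.
- by rewrite (@eq_Ex _ _ _ (fun=> 1)) ?Ex_cst // => s _; rewrite thin0.
- rewrite /= exprS -IHn // -(sum_thin c j) mulr_suml; apply: eq_bigr => x _.
  by rewrite -mulrA -[(_ - _) * Ex _ _ _]ExZ; congr (_ * _); apply: eq_Ex => s _; rewrite thin_cons.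
Qed.

(** One ball cannot hit two boxes, so a single ball contributes [1 - a - b] to the
    left and [(1 - a) * (1 - b)] to the right. *)
Lemma Ex_thin_negcor (c c' : R) n k l i j : 0 <= c <= 1 -> 0 <= c' <= 1 -> i != j ->
  (k <= n)%N -> (l <= n)%N ->
  Ex w n (fun s => thin c k i s * thin c' l j s) <=
    (1 - c * w i) ^+ k * (1 - c' * w j) ^+ l.
Proof.
move=> c01 c01' ij; have /andP[c0 c1] := c01; have /andP[c0' c1'] := c01'.
have w_le1 x : w x <= 1.
  by rewrite -w_sum1 (bigD1 x) //= lerDl sumr_ge0.
elim: n k l => [|n IHn] k l kn ln.
  by move: kn ln; rewrite !leqn0 => /eqP -> /eqP ->; rewrite /= !thin0 !mulr1.
case: k kn => [|k] kn.
  rewrite (@eq_Ex _ _ _ (thin c' l j)) ?Ex_thin ?mul1r // => s _.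
  by rewrite thin0 mul1r.
case: l ln => [|l] ln.
  rewrite (@eq_Ex _ _ _ (thin c k.+1 i)) ?Ex_thin ?mulr1 // => s _.
  by rewrite thin0 mulr1.
rewrite /= (eq_bigr (fun x => w x * (1 - c * (x == i)%:R - c' * (x == j)%:R) *
    Ex w n (fun s => thin c k i s * thin c' l j s))); last first.
  move=> x _; rewrite -mulrA -[(_ - _) * Ex _ _ _]ExZ; congr (_ * _); apply: eq_Ex => s _.
  rewrite !thin_cons; have [->|xi] := eqVneq x i; first by rewrite (negPf ij) /=; ring.
  by rewrite /=; ring.
rewrite -mulr_suml.
have -> : \sum_x w x * (1 - c * (x == i)%:R - c' * (x == j)%:R) = 1 - c * w i - c' * w j.
  have -> : 1 - c * w i - c' * w j = \sum_x w x -
      c * (\sum_x w x * (x == i)%:R) - c' * (\sum_x w x * (x == j)%:R).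
    by rewrite w_sum1 !sum_hit.
  rewrite !mulr_sumr -!sumrB; by apply: eq_bigr => x _; ring.
have E0 : 0 <= Ex w n (fun s => thin c k i s * thin c' l j s).
  by apply: Ex_ge0 => s; rewrite mulr_ge0 // thin_ge0.
have := IHn k l kn ln; set E := Ex _ _ _ in E0 * => EP.
rewrite !exprS mulrACA.
have a01 : 0 <= 1 - c * w i by have := w_le1 i; have := w_ge0 i; nra.
have b01 : 0 <= 1 - c' * w j by have := w_le1 j; have := w_ge0 j; nra.
apply: le_trans (_ : (1 - c * w i) * (1 - c' * w j) * E <= _).
  rewrite ler_wpM2r //.
  rewrite -subr_ge0 (_ : _ - _ = (c * w i) * (c' * w j)); last ring.
  by rewrite !mulr_ge0.
by rewrite ler_wpM2l // mulr_ge0.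
Qed.

End Probability.

End Sampling.

(** * The Stein identity for the number of occupied boxes *)

Section SteinKernel.
Context {R : realType} {J : finType} (w : J -> R).
Context (w_ge0 : forall x, 0 <= w x) (w_sum1 : \sum_x w x = 1).
Implicit Types (s : seq J) (f : nat -> R).

Definition occ s : nat := size (undup s).

Lemma occE s : occ s = (\sum_j (j \in s))%N.
Proof.
rewrite /occ -(card_uniqP (undup_uniq s)) -sum1_card big_mkcond /=.
by apply: eq_bigr => j _; rewrite mem_undup; case: (j \in s).
Qed.

Lemma occ_cons x s : occ (x :: s) = ((x \notin s) + occ s)%N.
Proof. by rewrite /occ /=; case: (x \in s). Qed.

Lemma occ_rcons x s : occ (rcons s x) = occ (x :: s).
Proof.
by rewrite !occE; apply: eq_bigr => j _; rewrite mem_rcons.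
Qed.

Lemma occ_le_size s : (occ s <= size s)%N. Proof. exact: size_undup. Qed.

(** The conditional probability that the next ball enters an empty box. *)
Definition unseen s : R := \sum_j w j * (j \notin s)%:R.

Definition discovery n s : R := \sum_j (j \notin s)%:R * (1 - (1 - w j) ^+ n.+1).

Definition history_of n j s : R :=
  \sum_(k < n.+1) w j * (1 - w j) ^+ (n - k) * thin 1 k j s.

Definition history n s : R := \sum_j history_of n j s.

(** Let [k] run over the number of balls required to miss box [j]. Beyond the factor
    [1 - w j], the step from [k] to [k + 1] changes the expectation by a multiple of
    [unseen s - (j \notin s)] ([miss_increment]), and the later steps multiply this
    by [(1 - w j) ^+ (n - k)]. Summed over [k] and [j], with the sign reversed
    because occupied instead of empty boxes are counted, the second term gives
    [discovery] and the first one [- unseen s * history n s]. *)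
Definition kernel n s : R := discovery n s - unseen s * history n s.

(** The quotients [a k / y ^+ k] telescope; the form without division also covers
    [y = 0]. *)
Lemma telescope_geo (a : nat -> R) (y : R) m :
  a m - y ^+ m * a 0%N = \sum_(k < m) y ^+ (m.-1 - k) * (a k.+1 - y * a k).
Proof.
elim: m => [|m IHm]; first by rewrite big_ord0 expr0 mul1r subrr.
rewrite big_ord_recr /= subnn expr0 mul1r.
rewrite (eq_bigr (fun i : 'I_m => y * (y ^+ (m.-1 - i) * (a i.+1 - y * a i)))).
  by rewrite -mulr_sumr -IHm exprS; ring.
move=> i _; rewrite mulrA -exprS; congr (_ ^+ _ * _).
by have := ltn_ord i; lia.
Qed.

Lemma thin_rcons c k j s x : (k <= size s)%N ->
  thin c k j (rcons s x) = thin c k j s :> R.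
Proof. by move=> ks; rewrite /thin -cats1 takel_cat. Qed.

(** The two expectations compared differ by one throw: the ball whose outcome is
    averaged is either among the [k + 1] balls required to miss [j] or is
    independent of that requirement. *)
Lemma miss_increment f n k j : (k <= n)%N ->
  Ex w n.+1 (fun s => thin 1 k.+1 j s * f (occ s)) -
    (1 - w j) * Ex w n.+1 (fun s => thin 1 k j s * f (occ s)) =
  Ex w n (fun s => thin 1 k j s *
    (w j * (unseen s - (j \notin s)%:R) * fdiff f (occ s))).
Proof.
move=> kn; rewrite [Ex w n.+1 (fun s => thin 1 k j s * _)]Ex_rcons.
rewrite [Ex w n.+1 _](_ : _ = Ex w n (fun s => \sum_x w x *
    (thin 1 k.+1 j (x :: s) * f (occ (x :: s))))); last first.
  by rewrite Ex_sum; apply: eq_bigr => x _; rewrite ExZ.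
rewrite -ExZ -ExB; apply: eq_Ex => s sn.
have fx x : f (occ (x :: s)) = f (occ s) + (x \notin s)%:R * fdiff f (occ s).
  by rewrite occ_cons /fdiff; case: (x \in s) => /=; rewrite ?add0n ?add1n; ring.
rewrite (eq_bigr (fun x => thin 1 k j s * (w x * (1 - 1 * (x == j)%:R) * f (occ (x :: s))))); last first.
  by move=> x _; rewrite thin_cons; ring.
rewrite (eq_bigr (fun x => thin 1 k j s * (w x * f (occ (x :: s))))
    (F1 := fun x => _ * (_ * f (occ (rcons s x))))); last first.
  by move=> x _; rewrite occ_rcons thin_rcons ?sn //; ring.
rewrite -!mulr_sumr mulrCA -mulrBr; congr (_ * _).
rewrite mulr_sumr -sumrB.
rewrite (eq_bigr (fun x => (w j * w x - w x * (x == j)%:R) * f (occ s) +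
  (w j * (w x * (x \notin s)%:R) - w x * (x == j)%:R * (x \notin s)%:R) *
    fdiff f (occ s))); last by move=> x _; rewrite fx; ring.
rewrite big_split /= -!mulr_suml !sumrB -!mulr_sumr w_sum1 sum_hit -/(unseen s).
have -> : \sum_x w x * (x == j)%:R * (x \notin s)%:R = w j * (j \notin s)%:R.
  rewrite (bigD1 j) //= eqxx mulr1 big1 ?addr0 // => x /negPf ->.
  by rewrite mulr0 mul0r.
by ring.
Qed.

Lemma occ_missing s : (occ s)%:R = #|J|%:R - \sum_j (j \notin s)%:R :> R.
Proof.
rewrite occE natr_sum -sum1_card natr_sum -sumrB; apply: eq_bigr => j _.
by case: (j \in s); rewrite ?subr0 ?subrr.
Qed.

(** The covariance of [f (occ s)] with the indicator that [j] is empty compares the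
    requirement that all balls miss [j] with no requirement. Telescoping over the
    number of balls required to miss [j] leaves increments that [miss_increment]
    expresses by the first difference of [f]. *)
Theorem kernel_identity n f :
  Ex w n.+1 (fun s => ((occ s)%:R - Ex w n.+1 (fun s => (occ s)%:R)) * f (occ s)) =
  Ex w n (fun s => kernel n s * fdiff f (occ s)).
Proof.
set Ef := Ex w n.+1 (fun s => f (occ s)).
pose a j k := Ex w n.+1 (fun s => thin 1 k j s * f (occ s)).
have thin_all m j s : size s = m -> thin 1 m j s = (j \notin s)%:R :> R.
  by move=> sm; rewrite thin_empty -sm take_size.
have Emiss j : Ex w n.+1 (fun s => (j \notin s)%:R) = (1 - w j) ^+ n.+1.
  rewrite -(@eq_Ex _ _ _ _ (thin 1 n.+1 j)) ?Ex_thin ?mul1r //.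
  by move=> s sn; rewrite thin_all.
have Eocc : Ex w n.+1 (fun s => (occ s)%:R) = #|J|%:R - \sum_j (1 - w j) ^+ n.+1.
  rewrite -(eq_bigr _ (fun j _ => Emiss j)) -Ex_sum -[#|J|%:R](Ex_cst w_sum1 n.+1) -ExB.
  by apply: eq_Ex => s _; rewrite occ_missing.
have -> : Ex w n.+1 (fun s => ((occ s)%:R - Ex w n.+1 (fun s => (occ s)%:R)) * f (occ s)) =
    - \sum_j (a j n.+1 - (1 - w j) ^+ n.+1 * a j 0%N).
  rewrite sumrB.
  have -> : \sum_j a j n.+1 = Ex w n.+1 (fun s => (\sum_j (j \notin s)%:R) * f (occ s)).
    rewrite /a -Ex_sum; apply: eq_Ex => s sn.
    by rewrite mulr_suml; apply: eq_bigr => j _; rewrite thin_all.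
  have -> : \sum_j (1 - w j) ^+ n.+1 * a j 0%N = Ex w n.+1 (fun s =>
     (\sum_j (1 - w j) ^+ n.+1) * f (occ s)).
    rewrite ExZ mulr_suml; apply: eq_bigr => j _; rewrite /a.
    by congr (_ * _); apply: eq_Ex => s _; rewrite thin0 mul1r.
  rewrite -ExB -[RHS]mulN1r -ExZ; apply: eq_Ex => s _.
  by rewrite Eocc occ_missing; ring.
rewrite -sumrN (eq_bigr (fun j => Ex w n (fun s =>
  ((j \notin s)%:R * (1 - (1 - w j) ^+ n.+1) - unseen s * history_of n j s) *
    fdiff f (occ s)))); last first.
  move=> j _; rewrite telescope_geo.
  rewrite (eq_bigr (fun k : 'I_n.+1 => Ex w n (fun s => (1 - w j) ^+ (n - k) *
     (thin 1 k j s * (w j * (unseen s - (j \notin s)%:R) * fdiff f (occ s)))))); last first.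
    by move=> k _; rewrite /a miss_increment ?ExZ // -ltnS.
  rewrite -Ex_sum -[LHS]mulN1r -ExZ; apply: eq_Ex => s sn.
  rewrite (eq_bigr (fun k : 'I_n.+1 => (unseen s * (w j * (1 - w j) ^+ (n - k) * thin 1 k j s)
     - (j \notin s)%:R * ((1 - (1 - w j)) * (1 - w j) ^+ (n - k))) * fdiff f (occ s))); last first.
    move=> k _; have : thin 1 k j s * (j \notin s)%:R = (j \notin s)%:R :> R.
      rewrite thin_empty; case: (boolP (j \in s)) => js; rewrite ?mulr0 ?mulr1 //.
      by rewrite (contra (@mem_take k _ s j)).
    by move=> e; rewrite -{2}e; ring.
  rewrite -mulr_suml sumrB -!mulr_sumr -/(history_of n j s).
  have -> : \sum_(k < n.+1) (1 - w j) ^+ (n - k) = \sum_(k < n.+1) (1 - w j) ^+ k.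
    rewrite (reindex_inj rev_ord_inj) /=; apply: eq_bigr => k _.
    by rewrite subSS subKn // -ltnS.
  have -> : (1 - (1 - w j)) * (\sum_(k < n.+1) (1 - w j) ^+ k) = 1 - (1 - w j) ^+ n.+1.
    by rewrite -[RHS]opprB (subrX1 (1 - w j)); ring.
  by ring.
rewrite -Ex_sum; apply: eq_Ex => s _.
by rewrite -mulr_suml sumrB -mulr_sumr.
Qed.

End SteinKernel.

(** * Size and fluctuations of the Stein kernel *)

Section GeometricBounds.
Context {R : realType}.
Implicit Types (p : R) (n : nat).

Lemma geo_sum p n : p * (\sum_(i < n) (1 - p) ^+ i) = 1 - (1 - p) ^+ n.
Proof. by rewrite -[RHS]opprB (subrX1 (1 - p)); ring. Qed.

Lemma sum_rev_geo (y : R) m : \sum_(k < m) y ^+ (rev_ord k) = \sum_(k < m) y ^+ k.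
Proof. by rewrite [RHS](reindex_inj rev_ord_inj). Qed.

Lemma hit_le p n : 0 <= p <= 1 -> 1 - (1 - p) ^+ n <= n%:R * p.
Proof.
move=> p01; rewrite -geo_sum mulrC ler_wpM2r //; first by lra.
rewrite -[n%:R]mul1r -[n in n%:R]card_ord mulr_natr -sumr_const.
by apply: ler_sum => i _; rewrite exprn_ile1 //; lra.
Qed.

Lemma single_hit_le_miss p n : 0 <= p <= 1 -> n%:R * p * (1 - p) ^+ n <= 1 - (1 - p) ^+ n.
Proof.
move=> p01; rewrite -geo_sum mulrAC mulrC ler_wpM2l //; first by lra.
rewrite mulr_natl -[X in _ *+ X](card_ord n) -sumr_const.
by apply: ler_sum => i _; rewrite ler_wiXn2l //; [lra|lra|exact: ltnW].
Qed.

Lemma single_hit_le1 p n : 0 <= p <= 1 -> n.+1%:R * p * (1 - p) ^+ n <= 1.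
Proof.
move=> p01; apply: le_trans (_ : 1 - (1 - p) ^+ n.+1 <= _); last first.
  by rewrite gerBl exprn_ge0 //; lra.
rewrite -geo_sum mulrAC mulrC ler_wpM2l //; first by lra.
rewrite mulr_natl -[X in _ *+ X](card_ord n.+1) -sumr_const.
by apply: ler_sum => i _; rewrite ler_wiXn2l //; [lra|lra|rewrite -ltnS].
Qed.

Lemma hitS_le p n : (0 < n)%N -> 0 <= p <= 1 ->
  1 - (1 - p) ^+ n.+1 <= 2 * (1 - (1 - p) ^+ n).
Proof.
move=> n0 p01.
have y01 : 0 <= 1 - p <= 1 by lra.
have h1 : (1 - p) ^+ n <= 1 - p.
  by rewrite -[leRHS]expr1 ler_wiXn2l //; lra.
have h2 : 0 <= (1 - p) ^+ n by rewrite exprn_ge0 //; lra.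
by rewrite exprS; nra.
Qed.

Lemma sq_sum_le (b : nat -> R) m : (forall k, 0 <= b k) ->
  (\sum_(k < m) b k) ^+ 2 <= 2 * \sum_(k < m) b k * (\sum_(l < k.+1) b l).
Proof.
move=> b0; elim: m => [|m IHm]; first by rewrite !big_ord0 mulr0 expr0n.
rewrite !(big_ord_recr m) /=.
have S0 : 0 <= \sum_(i < m) b i by apply: sumr_ge0.
by have := b0 m; nra.
Qed.

End GeometricBounds.

Section Moments.
Context {R : realType} {J : finType} (w : J -> R).
Context (w_ge0 : forall x, 0 <= w x) (w_sum1 : \sum_x w x = 1).
Context (n : nat) (n_gt0 : (0 < n)%N).
Implicit Types (s : seq J) (S : {set J}).

Local Notation E := (Ex w n).

Lemma weight01 j : 0 <= w j <= 1.
Proof. by rewrite w_ge0 -w_sum1 (bigD1 j) //= lerDl sumr_ge0. Qed.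

Lemma miss01 j m : 0 <= (1 - w j) ^+ m <= 1.
Proof.
have /andP[w0 w1] := weight01 j.
by rewrite exprn_ge0 ?exprn_ile1 ?subr_ge0 //; lra.
Qed.

(** The variance of the indicator that box [j] is empty. *)
Definition box_var j : R := (1 - w j) ^+ n * (1 - (1 - w j) ^+ n).

Definition total_var : R := \sum_j box_var j.

Definition unseen_mean : R := \sum_j w j * (1 - w j) ^+ n.

Lemma box_var_ge0 j : 0 <= box_var j.
Proof. by have := miss01 j n; rewrite /box_var; set y := _ ^+ n; nra. Qed.

Lemma box_var_le j : box_var j <= 4^-1.
Proof. by rewrite /box_var; set y := _ ^+ n; have := sqr_ge0 (y - 2^-1); lra. Qed.

Lemma box_var_le_miss j : box_var j <= (1 - w j) ^+ n.
Proof. by have := miss01 j n; rewrite /box_var; set y := _ ^+ n; nra. Qed.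

Lemma total_var_le : total_var <= n%:R.
Proof.
have -> : n%:R = \sum_j n%:R * w j :> R by rewrite -mulr_sumr w_sum1 mulr1.
apply: ler_sum => j _.
apply: le_trans (hit_le n (weight01 j)).
by have := miss01 j n; rewrite /box_var; set y := _ ^+ n; nra.
Qed.

Lemma unseen_mean01 : 0 <= unseen_mean <= 1.
Proof.
rewrite sumr_ge0 /=; last first.
  by move=> j _; rewrite mulr_ge0 //; have /andP[] := miss01 j n.
rewrite -w_sum1; apply: ler_sum => j _.
by rewrite -[leRHS]mulr1 ler_wpM2l //; have /andP[] := miss01 j n.
Qed.

Lemma miss_thin j s : size s = n -> (j \notin s)%:R = thin 1 n j s :> R.
Proof. by move=> sn; rewrite thin_empty -sn take_size. Qed.

Lemma Ex_miss j : E (fun s => (j \notin s)%:R) = (1 - w j) ^+ n.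
Proof.
by rewrite (@eq_Ex _ _ _ _ _ (thin 1 n j)) ?Ex_thin ?mul1r // => s /(miss_thin j).
Qed.

Lemma Ex_miss_negcor i j : i != j ->
  E (fun s => (i \notin s)%:R * (j \notin s)%:R) <= (1 - w i) ^+ n * (1 - w j) ^+ n.
Proof.
move=> ij; rewrite (@eq_Ex _ _ _ _ _ (fun s => thin 1 n i s * thin 1 n j s)).
  have := @Ex_thin_negcor _ _ w w_ge0 w_sum1 1 1 n n n i j.
  by rewrite !mul1r; apply=> //; lra.
by move=> s sn; rewrite !miss_thin.
Qed.

Lemma Ex_history_of j : E (history_of w n j) = n.+1%:R * w j * (1 - w j) ^+ n.
Proof.
rewrite Ex_sum (eq_bigr (fun=> w j * (1 - w j) ^+ n)).
  by rewrite sumr_const card_ord -mulrA mulr_natl.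
move=> k _; have kn : (k <= n)%N by rewrite -ltnS.
by rewrite ExZ Ex_thin // mul1r -mulrA -exprD subnK.
Qed.

Lemma history_of_ge0 j s : 0 <= history_of w n j s.
Proof.
apply: sumr_ge0 => k _; rewrite mulr_ge0 ?thin_ge0 // mulr_ge0 //.
by have /andP[] := miss01 j (n - k).
Qed.

Lemma Ex_history_negcor i j : i != j ->
  E (fun s => history_of w n i s * history_of w n j s) <=
    E (history_of w n i) * E (history_of w n j).
Proof.
move=> ij; rewrite /history_of 2!Ex_sum mulr_suml.
rewrite (@eq_Ex _ _ _ _ _ (fun s => \sum_(k < n.+1) \sum_(l < n.+1)
   w i * (1 - w i) ^+ (n - k) * (w j * (1 - w j) ^+ (n - l)) *
   (thin 1 k i s * thin 1 l j s))); last first.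
  move=> s _; rewrite mulr_suml; apply: eq_bigr => k _; rewrite mulr_sumr.
  by apply: eq_bigr => l _; ring.
rewrite Ex_sum; apply: ler_sum => k _; rewrite Ex_sum mulr_sumr.
apply: ler_sum => l _; rewrite !ExZ.
have kn : (k <= n)%N by rewrite -ltnS.
have ln : (l <= n)%N by rewrite -ltnS.
rewrite [leRHS]mulrACA ler_wpM2l //.
  by rewrite !mulr_ge0 //; [have /andP[] := miss01 i (n - k) |
    have /andP[] := miss01 j (n - l)].
rewrite !Ex_thin // ?mul1r.
have := @Ex_thin_negcor _ _ w w_ge0 w_sum1 1 1 n k l i j.
by rewrite !mul1r; apply=> //; lra.
Qed.

(** Among two throws [l <= k], the earlier one is summed first without its
    indicator, which leaves a geometric series. *)
Lemma Ex_history_sq j :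
  E (fun s => history_of w n j s ^+ 2) <= 2 * ((1 - w j) ^+ n * (1 - (1 - w j) ^+ n.+1)).
Proof.
set y : R := 1 - w j; have y01 m : 0 <= y ^+ m <= 1 := miss01 j m.
have /andP[w0 w1] := weight01 j.
apply: le_trans (_ : E (fun s => 2 * \sum_(k < n.+1)
   w j * y ^+ (n - k) * y ^+ (n - k) * thin 1 k j s) <= _).
  apply: Ex_le => // s _; rewrite /history_of -/y.
  pose b (k : nat) := w j * y ^+ (n - k) * thin 1 k j s.
  have th k : 0 <= (thin 1 k j s : R) <= 1.
    by rewrite thin_empty; case: (_ \notin _); rewrite /= ?ler01 ?lexx.
  have b0 k : 0 <= b k.
    rewrite /b mulr_ge0 //; last by have /andP[] := th k.
    by rewrite mulr_ge0 //; have /andP[] := y01 (n - k)%N.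
  apply: le_trans (sq_sum_le n.+1 b0) _.
  rewrite ler_pM2l //; apply: ler_sum => k _.
  rewrite (_ : _ * thin 1 k j s = b k * y ^+ (n - k)); last by rewrite /b; ring.
  rewrite ler_wpM2l //.
  apply: le_trans (_ : \sum_(l < k.+1) w j * y ^+ (n - l) <= _).
    apply: ler_sum => l _; rewrite /b -[leRHS]mulr1 ler_wpM2l //.
      by rewrite mulr_ge0 //; have /andP[] := y01 (n - l)%N.
    by have /andP[] := th l.
  rewrite -mulr_sumr (eq_bigr (fun l : 'I_k.+1 => y ^+ (n - k) * y ^+ (rev_ord l))); last first.
    move=> l _; rewrite -exprD /= subSS; congr (_ ^+ _).
    by have := ltn_ord l; have := ltn_ord k; lia.
  rewrite -mulr_sumr mulrCA -[leRHS]mulr1 ler_wpM2l //; first by have /andP[] := y01 (n - k)%N.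
  rewrite sum_rev_geo geo_sum.
  by have := y01 k.+1; rewrite /y; lra.
rewrite ExZ ler_pM2l // Ex_sum.
rewrite (eq_bigr (fun k : 'I_n.+1 => y ^+ n * (w j * y ^+ (rev_ord k)))); last first.
  move=> k _; have kn : (k <= n)%N by rewrite -ltnS.
  rewrite ExZ Ex_thin // mul1r -/y.
  by rewrite /= subSS -mulrA -exprD subnK // mulrC.
rewrite -mulr_sumr ler_wpM2l //; first by have /andP[] := y01 n.
by rewrite -mulr_sumr sum_rev_geo geo_sum.
Qed.

Lemma Ex_history_sq_le j : E (fun s => history_of w n j s ^+ 2) <= 4 * box_var j.
Proof.
apply: le_trans (Ex_history_sq j) _; have := hitS_le n_gt0 (weight01 j).
have := miss01 j n; rewrite /box_var; set y := (1 - w j) ^+ n.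
by set z := (1 - w j) ^+ n.+1; nra.
Qed.

(** The emptiness indicators of different boxes are negatively correlated. *)
Lemma var_miss (a : J -> R) S :
  (forall j, 0 <= a j) ->
  E (fun s => (\sum_(j in S) a j * (j \notin s)%:R -
       E (fun s => \sum_(j in S) a j * (j \notin s)%:R)) ^+ 2) <=
    \sum_(j in S) a j ^+ 2 * box_var j.
Proof.
move=> a0; apply: le_trans (@Ex_var_sum _ _ _ w_sum1 n (mem S)
  (fun j s => a j * (j \notin s)%:R) _) _.
  move=> i j _ _ ij.
  rewrite (@eq_Ex _ _ _ _ _ (fun s => a i * a j * ((i \notin s)%:R * (j \notin s)%:R))).
    by rewrite !ExZ mulrACA ler_wpM2l ?mulr_ge0 // !Ex_miss Ex_miss_negcor.
  by move=> s _; ring.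
apply: ler_sum => j _; rewrite ExZ Ex_miss.
rewrite (@eq_Ex _ _ _ _ _ (fun s => a j ^+ 2 * (j \notin s)%:R)).
  by rewrite ExZ Ex_miss /box_var; set y := _ ^+ n; lra.
by move=> s _; case: (j \notin s) => /=; ring.
Qed.

(** Histories of different boxes are positive combinations of indicators that
    initial segments of the throws miss the box, hence negatively correlated. *)
Lemma var_history S :
  E (fun s => (\sum_(j in S) history_of w n j s -
       E (fun s => \sum_(j in S) history_of w n j s)) ^+ 2) <=
    4 * \sum_(j in S) box_var j.
Proof.
apply: le_trans (@Ex_var_sum _ _ _ w_sum1 n (mem S) (history_of w n) _) _.
  by move=> i j _ _; exact: Ex_history_negcor.
rewrite mulr_sumr; apply: ler_sum => j _.
by apply: le_trans (Ex_history_sq_le j); rewrite gerBl sqr_ge0.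
Qed.

End Moments.

Section KernelFluctuations.
Context {R : realType} {J : finType} (w : J -> R).
Context (w_ge0 : forall x, 0 <= w x) (w_sum1 : \sum_x w x = 1).
Context (n : nat) (n_gt0 : (0 < n)%N).
Context (D : {set J}) (D_small : \sum_(j in D) w j <= 8^-1).
Implicit Types (s : seq J) (S : {set J}).

Local Notation E := (Ex w n).
Local Notation r := (unseen_mean w n).
Local Notation V := (total_var w n).
Local Notation h := (#|~: D|%:R : R).
Local Notation y j := ((1 - w j) ^+ n).

Let w01 := weight01 w_ge0 w_sum1.
Let y01 := miss01 w_ge0 w_sum1.

(** Expanding [unseen s * history n s] around the means [r] and [n.+1 * r] of its
    factors leaves terms that are sums over boxes, collected here, and the product
    [kernel_cross] of the two centred factors. *)
Definition kernel_lin j s : R :=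
  (j \notin s)%:R * (1 - (1 - w j) ^+ n.+1) - n.+1%:R * r * w j * (j \notin s)%:R -
  r * history_of w n j s.

Definition kernel_cross s : R := (unseen w s - r) * (history w n s - n.+1%:R * r).

(** By [kernel_identity] for the identity function, the variance of the number of
    boxes occupied by [n.+1] balls. *)
Definition kernel_mean : R := E (kernel w n).

Lemma kernel_split s :
  kernel w n s = \sum_j kernel_lin j s + n.+1%:R * r ^+ 2 - kernel_cross s.
Proof.
rewrite /kernel /kernel_cross /kernel_lin !sumrB -mulr_sumr -/(history w n s).
rewrite (eq_bigr (fun j => n.+1%:R * r * (w j * (j \notin s)%:R))
  (F1 := fun j => n.+1%:R * r * w j * _)); last by move=> j _; ring.
by rewrite -mulr_sumr -/(unseen w s) -/(discovery w n s); ring.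
Qed.

Lemma kernel_centered s : kernel w n s - kernel_mean =
  \sum_j (kernel_lin j s - E (kernel_lin j)) - (kernel_cross s - E kernel_cross).
Proof.
have -> : kernel_mean = \sum_j E (kernel_lin j) + n.+1%:R * r ^+ 2 - E kernel_cross.
  rewrite /kernel_mean (@eq_Ex _ _ _ _ _ _ (fun s _ => kernel_split s)).
  by rewrite ExB ExD Ex_cst // Ex_sum.
by rewrite kernel_split [in RHS]sumrB; ring.
Qed.

Lemma Ex_unseen : E (unseen w) = r.
Proof. by rewrite Ex_sum; apply: eq_bigr => j _; rewrite ExZ Ex_miss. Qed.

Lemma Ex_history : E (history w n) = n.+1%:R * r.
Proof.
rewrite Ex_sum mulr_sumr; apply: eq_bigr => j _.
by rewrite Ex_history_of // mulrA.
Qed.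

Lemma var_unseen S : E (fun s => (\sum_(j in S) w j * (j \notin s)%:R -
    E (fun s => \sum_(j in S) w j * (j \notin s)%:R)) ^+ 2) <= n.+1%:R^-1.
Proof.
apply: le_trans (var_miss w_ge0 w_sum1 n S w_ge0) _.
rewrite -[leRHS]mul1r ler_pdivlMr ?ltr0n // mulr_suml.
apply: le_trans (_ : \sum_(j in S) w j <= _); last first.
  by rewrite -w_sum1 [leRHS](bigID (mem S)) /= lerDl sumr_ge0.
apply: ler_sum => j _.
rewrite (_ : _ * n.+1%:R = w j * (n.+1%:R * w j * box_var w n j)); last by ring.
rewrite -[leRHS]mulr1 ler_wpM2l //.
apply: le_trans (single_hit_le1 n (w01 j)).
by rewrite ler_wpM2l ?mulr_ge0 // box_var_le_miss.
Qed.

Lemma var_unseen_total : E (fun s => (unseen w s - r) ^+ 2) <= n.+1%:R^-1.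
Proof.
have := var_unseen [set: J]%SET.
rewrite (@eq_Ex _ _ _ _ _ (fun s => (unseen w s - r) ^+ 2)) // => s _.
rewrite -Ex_unseen /unseen; congr ((_ - E _) ^+ 2).
  by apply: eq_bigl => j; rewrite inE.
by apply/funext => t; apply: eq_bigl => j; rewrite inE.
Qed.

Lemma var_history_total : E (fun s => (history w n s - n.+1%:R * r) ^+ 2) <= 4 * n.+1%:R.
Proof.
have /le_trans := var_history w_ge0 w_sum1 n_gt0 [set: J]%SET.
have -> : \sum_(j in [set: J]%SET) box_var w n j = V by apply: eq_bigl => j; rewrite inE.
rewrite (@eq_Ex _ _ _ _ _ (fun s => (history w n s - n.+1%:R * r) ^+ 2)).
  apply; rewrite ler_pM2l // (le_trans (total_var_le w_ge0 w_sum1 n)) //.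
  by rewrite ler_nat.
move=> s _; rewrite -Ex_history /history; congr ((_ - E _) ^+ 2).
  by apply: eq_bigl => j; rewrite inE.
by apply/funext => t; apply: eq_bigl => j; rewrite inE.
Qed.

(** The two factors have standard deviations of order [1 / sqrt n] and [sqrt n]. *)
Lemma Ex_kernel_cross_le : E (fun s => `|kernel_cross s|) <= 2.
Proof.
set t := Num.sqrt (n.+1%:R : R).
have t0 : 0 < t by rewrite sqrtr_gt0 ltr0n.
have t2 : t ^+ 2 = n.+1%:R by rewrite sqr_sqrtr ?ler0n.
rewrite (_ : 2 = t^-1 * (2 * t)); last by field; rewrite gt_eqF.
rewrite (@eq_Ex _ _ _ _ _ _ (fun s _ => normrM _ _)).
apply: (Ex_CauchySchwarz w_ge0); rewrite ?invr_gt0 ?mulr_gt0 //.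
  by rewrite exprVn t2 var_unseen_total.
by rewrite exprMn t2 (_ : 2 ^+ 2 = 4); [exact: var_history_total | ring].
Qed.

Lemma abs_Ex_kernel_cross_le : `|E kernel_cross| <= 2.
Proof. exact: le_trans (Ex_norm w_ge0 _ _) Ex_kernel_cross_le. Qed.

(** The balls that would hit a new box hit either one of the few boxes outside
    [D], which are rarely empty, or a box of [D]; the second contribution is at
    most half of the variance because [D] is light. *)
Lemma unseen_mean_sq_le : n.+1%:R * r ^+ 2 <= 4 * h + V / 2.
Proof.
have n2 : n.+1%:R <= 2 * n%:R :> R by rewrite -natrM ler_nat; lia.
have n0 : 0 <= n%:R :> R by [].
pose rh := \sum_(j in ~: D) w j * y j; pose rd := \sum_(j in D) w j * y j.
have rE : r = rd + rh.
  rewrite /unseen_mean (bigID (mem D)) /=; congr (_ + _).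
  by apply: eq_bigl => j; rewrite !inE.
have t0 j : 0 <= w j * y j by rewrite mulr_ge0 //; have /andP[] := y01 j n.
have rh0 : 0 <= rh by apply: sumr_ge0.
have rd0 : 0 <= rd by apply: sumr_ge0.
have /andP[r0 r1] := unseen_mean01 w_ge0 w_sum1 n.
have rhn : n%:R * rh <= h.
  rewrite /rh mulr_sumr -sum1_card natr_sum; apply: ler_sum => j _.
  rewrite mulrA; apply: le_trans (single_hit_le1 n (w01 j)).
  rewrite ler_wpM2r ?ler_wpM2r ?ler_nat //; by have /andP[] := y01 j n.
pose s2 := \sum_(j in D) w j * y j ^+ 2.
(* Cauchy-Schwarz with respect to the weights in D, whose total is at most 1/8 *)
have rd2 : 8 * rd ^+ 2 <= s2.
  have : 0 <= \sum_(j in D) w j * (y j - 8 * rd) ^+ 2.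
    by apply: sumr_ge0 => j _; rewrite mulr_ge0 ?sqr_ge0.
  rewrite (eq_bigr (fun j => w j * y j ^+ 2 - 16 * rd * (w j * y j) +
     64 * rd ^+ 2 * w j)); last by move=> j _; ring.
  rewrite big_split sumrB -!mulr_sumr -/rd -/s2 /=.
  have := ler_wpM2l (sqr_ge0 rd) D_small; set P := \sum_(j in D) w j.
  by lra.
have s2n : n%:R * s2 <= V.
  rewrite /s2 mulr_sumr; apply: le_trans (_ : \sum_(j in D) box_var w n j <= _).
    apply: ler_sum => j _; rewrite /box_var.
    rewrite (_ : n%:R * _ = y j * (n%:R * w j * y j)); last by ring.
    by rewrite ler_wpM2l ?single_hit_le_miss //; have /andP[] := y01 j n.
  rewrite /total_var [leRHS](bigID (mem D)) /= lerDl.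
  by apply: sumr_ge0 => j _; apply: box_var_ge0.
have rhr : rh <= 1 by rewrite (le_trans _ r1) // rE lerDr.
have a1 : n%:R * rh ^+ 2 <= h.
  apply: le_trans rhn; rewrite expr2 mulrA -[leRHS]mulr1 ler_wpM2l //.
  by rewrite mulr_ge0.
have a2 : n%:R * rd ^+ 2 <= V / 8.
  have := ler_wpM2l n0 rd2; lra.
apply: le_trans (_ : 2 * n%:R * (2 * (rd ^+ 2 + rh ^+ 2)) <= _); last by lra.
apply: ler_pM => //; first exact: sqr_ge0.
by rewrite rE; have := sqr_ge0 (rd - rh); lra.
Qed.

Lemma kernel_mean_eq :
  kernel_mean = \sum_j y j * (1 - (1 - w j) ^+ n.+1) - n.+1%:R * r ^+ 2 - E kernel_cross.
Proof.
rewrite /kernel_mean (@eq_Ex _ _ _ _ _ _ (fun s _ => kernel_split s)).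
rewrite ExB ExD Ex_cst // Ex_sum.
rewrite (eq_bigr (fun j => y j * (1 - (1 - w j) ^+ n.+1) -
   2 * n.+1%:R * r * (w j * y j))); last first.
  move=> j _; rewrite /kernel_lin !ExB !ExZ ExZr Ex_miss // Ex_history_of //; ring.
by rewrite sumrB -mulr_sumr -/r; ring.
Qed.

Lemma kernel_mean_le : kernel_mean <= 2 * V + 2.
Proof.
rewrite kernel_mean_eq.
have := abs_Ex_kernel_cross_le; rewrite ler_norml => /andP[c1 c2].
have : \sum_j y j * (1 - (1 - w j) ^+ n.+1) <= 2 * V.
  rewrite /total_var mulr_sumr; apply: ler_sum => j _; rewrite /box_var.
  by have := hitS_le n_gt0 (w01 j); have := y01 j n; nra.
have : 0 <= n.+1%:R * r ^+ 2 by rewrite mulr_ge0 ?sqr_ge0.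
lra.
Qed.

(** By [unseen_mean_sq_le] the negative term [n.+1 * r ^+ 2] of the variance takes
    away at most half of [V], apart from a multiple of [h]. *)
Lemma kernel_mean_ge : V / 2 - 4 * h - 2 <= kernel_mean.
Proof.
rewrite kernel_mean_eq.
have := abs_Ex_kernel_cross_le; rewrite ler_norml => /andP[c1 c2].
have : V <= \sum_j y j * (1 - (1 - w j) ^+ n.+1).
  apply: ler_sum => j _; rewrite /box_var ler_wpM2l //; first by have /andP[] := y01 j n.
  rewrite lerD2l lerN2 exprS -[leRHS]mul1r ler_wpM2r //; first by have /andP[] := y01 j n.
  by have := w01 j; lra.
by have := unseen_mean_sq_le; lra.
Qed.

Lemma var_kernel_lin S :
  E (fun s => (\sum_(j in S) kernel_lin j s - E (fun s => \sum_(j in S) kernel_lin j s)) ^+ 2)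
    <= 17 * V + 12 * h.
Proof.
have /andP[r0 r1] := unseen_mean01 w_ge0 w_sum1 n.
pose A s := \sum_(j in S) (1 - (1 - w j) ^+ n.+1) * (j \notin s)%:R.
pose Q s := \sum_(j in S) n.+1%:R * r * w j * (j \notin s)%:R.
pose B s := \sum_(j in S) history_of w n j s.
have LE s : \sum_(j in S) kernel_lin j s = A s - Q s - r * B s.
  rewrite /A /Q /B [r * \sum_(j in S) _]mulr_sumr -!sumrB; apply: eq_bigr => j _.
  by rewrite /kernel_lin; ring.
have -> : E (fun s => \sum_(j in S) kernel_lin j s) = E A - E Q - r * E B.
  by rewrite (@eq_Ex _ _ _ _ _ _ (fun s _ => LE s)) !ExB ExZ.
apply: le_trans (_ : E (fun s => 3 * ((A s - E A) ^+ 2 + (Q s - E Q) ^+ 2 +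
    (B s - E B) ^+ 2)) <= _).
  apply: Ex_le => // s _; rewrite LE.
  set a := A s - E A; set b := Q s - E Q; set c := B s - E B.
  rewrite (_ : _ - _ = a - b - r * c); last by rewrite /a /b /c; ring.
  have : (r * c) ^+ 2 <= c ^+ 2.
    by rewrite exprMn -[leRHS]mul1r ler_wpM2r ?sqr_ge0 // exprn_ile1.
  set d := r * c; have := sqr_ge0 (a + b); have := sqr_ge0 (a + d); have := sqr_ge0 (b - d).
  nra.
rewrite ExZ !ExD.
have VS : \sum_(j in S) box_var w n j <= V.
  rewrite /total_var [leRHS](bigID (mem S)) /= lerDl.
  by apply: sumr_ge0 => j _; apply: box_var_ge0.
have hA : E (fun s => (A s - E A) ^+ 2) <= V.
  apply: le_trans VS; apply: le_trans (var_miss w_ge0 w_sum1 n S _) _.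
    by move=> j; have := y01 j n.+1; lra.
  apply: ler_sum => j _; rewrite -[leRHS]mul1r ler_wpM2r ?box_var_ge0 //.
  by rewrite exprn_ile1 //; have := y01 j n.+1; lra.
have hB : E (fun s => (B s - E B) ^+ 2) <= 4 * V.
  apply: le_trans (var_history w_ge0 w_sum1 n_gt0 S) _.
  by rewrite ler_pM2l.
have hQ : E (fun s => (Q s - E Q) ^+ 2) <= n.+1%:R * r ^+ 2.
  apply: le_trans (var_miss w_ge0 w_sum1 n S _) _.
    by move=> j; rewrite !mulr_ge0.
  apply: le_trans (_ : \sum_(j in S) n.+1%:R * r ^+ 2 * w j <= _).
    apply: ler_sum => j _.
    rewrite (_ : _ ^+ 2 = n.+1%:R * r ^+ 2 * w j * (n.+1%:R * w j)); last by ring.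
    rewrite -mulrA -[leRHS]mulr1 ler_wpM2l //.
      by rewrite !mulr_ge0 ?exprn_ge0.
    apply: le_trans (single_hit_le1 n (w01 j)).
    by rewrite ler_wpM2l ?mulr_ge0 // box_var_le_miss.
  rewrite -mulr_sumr -[leRHS]mulr1 ler_wpM2l ?mulr_ge0 ?exprn_ge0 //.
  by rewrite -w_sum1 [leRHS](bigID (mem S)) /= lerDl sumr_ge0.
have := unseen_mean_sq_le; have : 0 <= V by apply: sumr_ge0 => j _; apply: box_var_ge0.
lra.
Qed.

Lemma Ex_kernel_lin_abs j :
  E (fun s => `|kernel_lin j s - E (kernel_lin j)|) <= 6.
Proof.
have /andP[r0 r1] := unseen_mean01 w_ge0 w_sum1 n.
have H : E (fun s => `|kernel_lin j s|) <= 3.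
  apply: le_trans (_ : E (fun s => 1 + n.+1%:R * r * w j * (j \notin s)%:R +
    r * history_of w n j s) <= _).
    apply: Ex_le => // s _; rewrite /kernel_lin.
    have h0 := history_of_ge0 w_ge0 w_sum1 n j s.
    have a0 : 0 <= n.+1%:R * r * w j * (j \notin s)%:R by rewrite !mulr_ge0.
    have b0 : 0 <= r * history_of w n j s by rewrite mulr_ge0.
    have := y01 j n.+1.
    by case: (j \notin s) a0 => /= a0 c0; rewrite ler_norml; apply/andP; split; lra.
  rewrite !ExD Ex_cst // !ExZ Ex_miss // Ex_history_of //.
  have := single_hit_le1 n (w01 j).
  have : 0 <= n.+1%:R * w j * y j by rewrite !mulr_ge0 //; have /andP[] := y01 j n.
  set z := n.+1%:R * w j * y j => z0 z1.
  rewrite (_ : n.+1%:R * r * w j * y j = r * z); last by rewrite /z; ring.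
  nra.
apply: le_trans (_ : E (fun s => `|kernel_lin j s| + 3) <= _).
  apply: Ex_le => // s _; apply: le_trans (ler_normB _ _) _.
  by rewrite lerD2l (le_trans (Ex_norm w_ge0 _ _)).
by rewrite ExD Ex_cst //; lra.
Qed.

End KernelFluctuations.

(** * Two-stage throws: marks and fair coins *)

Section Coins.
Context {R : realType} {J : finType} (w : J -> R).
Context (w_ge0 : forall x, 0 <= w x) (w_sum1 : \sum_x w x = 1).
Context (o : J) (D : {set J}) (oD : o \notin D).
Context (D_le : \sum_(j in D) w j <= w o).
Implicit Types (s : seq J) (t : seq (J * bool)) (K : {set J}).

(** A throw in two stages. The mark of a ball follows [mark_weight], which doubles
    the weight of each light box in [D] at the expense of the heavy box [o]. A fair
    coin then decides whether a ball marked with a light box goes to that box or to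
    [o], so that the original law is recovered ([place_law]). Given the marks,
    different light boxes depend on disjoint sets of coins. *)
Definition mark_weight y : R :=
  if y \in D then 2 * w y else if y == o then w o - \sum_(j in D) w j else w y.

Definition coin_law (y : J) (c : bool) : R := if y \in D then 2^-1 else c%:R.

Definition marked_weight (z : J * bool) : R := mark_weight z.1 * coin_law z.1 z.2.

Definition place (z : J * bool) : J := if (z.1 \in D) && ~~ z.2 then o else z.1.

Lemma mark_weight_ge0 y : 0 <= mark_weight y.
Proof.
rewrite /mark_weight; case: ifP => _; first by rewrite mulr_ge0.
by case: ifP => _ //; rewrite subr_ge0.
Qed.

Lemma sum_mark_weight (G : J -> R) :
  \sum_y mark_weight y * G y =
  \sum_y w y * G y + \sum_(y in D) w y * (G y - G o).
Proof.
rewrite [LHS](bigID (mem D)) [\sum_y w y * G y](bigID (mem D)) /=.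
rewrite (bigD1 (F := fun i => mark_weight i * G i) (P := fun i => i \notin D) o) //=.
rewrite (bigD1 (F := fun i => w i * G i) (P := fun i => i \notin D) o) //=.
rewrite (eq_bigr (fun y => 2 * (w y * G y))); last first.
  by move=> y yD; rewrite /mark_weight yD; ring.
rewrite (eq_bigr (fun y => w y * G y) (P := fun i => (i \notin D) && (i != o))); last first.
  by move=> y /andP[/negPf yD /negPf yo]; rewrite /mark_weight yD yo.
rewrite {1}/mark_weight (negPf oD) eqxx -mulr_sumr.
rewrite (eq_bigr (fun y => w y * G y - w y * G o) (F1 := fun y => w y * (_ - _))); last first.
  by move=> y _; ring.
rewrite sumrB -!mulr_suml; ring.
Qed.

Lemma mark_weight_sum1 : \sum_y mark_weight y = 1.
Proof.
have := sum_mark_weight (fun=> 1).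
rewrite [X in _ + X]big1 ?addr0; last by move=> y _; rewrite subrr mulr0.
rewrite -!mulr_suml !mulr1 => ->; exact: w_sum1.
Qed.

Lemma sum_coin_law y : \sum_c coin_law y c = 1.
Proof. by rewrite big_bool /coin_law; case: ifP => _ /=; [lra | rewrite addr0]. Qed.

Lemma coin_law_ge0 y c : 0 <= coin_law y c.
Proof. by rewrite /coin_law; case: ifP => _; [lra | exact: ler0n]. Qed.

Lemma marked_weight_ge0 z : 0 <= marked_weight z.
Proof. by rewrite mulr_ge0 ?mark_weight_ge0 ?coin_law_ge0. Qed.

Lemma sum_marked_weight (G : J * bool -> R) :
  \sum_z marked_weight z * G z =
  \sum_y mark_weight y * \sum_c coin_law y c * G (y, c).
Proof.
rewrite -(eq_bigr _ (fun y _ => esym (mulr_sumr _ _ _ _))).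
rewrite pair_bigA /=; apply: eq_bigr => -[y c] _ /=.
by rewrite /marked_weight /= mulrA.
Qed.

Lemma marked_weight_sum1 : \sum_z marked_weight z = 1.
Proof.
rewrite -mark_weight_sum1; transitivity (\sum_z marked_weight z * (fun=> 1) z).
  by apply: eq_bigr => z _; rewrite mulr1.
rewrite sum_marked_weight; apply: eq_bigr => y _.
rewrite (eq_bigr (coin_law y)) ?sum_coin_law ?mulr1 // => c _.
by rewrite mulr1.
Qed.

Lemma place_law (G : J -> R) :
  \sum_z marked_weight z * G (place z) = \sum_x w x * G x.
Proof.
rewrite (sum_marked_weight (G \o place)) /=.
rewrite (sum_mark_weight (fun y => \sum_c coin_law y c * G (place (y, c)))).
rewrite (bigID (mem D)) /= [RHS](bigID (mem D)) /= addrAC; congr (_ + _); last first.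
  apply: eq_bigr => y /negPf yD; congr (_ * _).
  by rewrite big_bool /coin_law /place yD /= mul1r mul0r addr0.
rewrite -big_split; apply: eq_bigr => y yD /=.
by rewrite !big_bool /coin_law /place /= yD (negPf oD) /=; field.
Qed.

Lemma Ex_place n (F : seq J -> R) :
  Ex marked_weight n (fun t => F (map place t)) = Ex w n F.
Proof.
elim: n F => [//|n IHn] F /=.
rewrite (eq_bigr (fun z => marked_weight z * Ex w n (fun s => F (place z :: s)))).
  exact: (place_law (fun x => Ex w n (fun s => F (x :: s)))).
by move=> z _; rewrite -IHn.
Qed.

(** Expectation over the coins when the marks [ys] are given. *)
Fixpoint Ecoin (ys : seq J) (F : seq (J * bool) -> R) : R :=
  if ys is y :: ys' then
    \sum_c coin_law y c * Ecoin ys' (fun t => F ((y, c) :: t))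
  else F [::].

Lemma Ex_coin n F : Ex marked_weight n F = Ex mark_weight n (fun ys => Ecoin ys F).
Proof.
elim: n F => [//|n IHn] F /=.
rewrite (sum_marked_weight (fun z => Ex marked_weight n (fun t => F (z :: t)))).
apply: eq_bigr => y _; rewrite Ex_sum; congr (_ * _); apply: eq_bigr => c _.
by rewrite IHn ExZ.
Qed.

Lemma eq_Ecoin ys F G : (forall t, map fst t = ys -> F t = G t) ->
  Ecoin ys F = Ecoin ys G.
Proof.
elim: ys F G => [|y ys IHys] F G FG /=; first exact: FG.
by apply: eq_bigr => c _; congr (_ * _); apply: IHys => t tE; rewrite FG //= tE.
Qed.

Lemma Ecoin_lin ys (a : R) F G :
  Ecoin ys (fun t => a * F t + G t) = a * Ecoin ys F + Ecoin ys G.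
Proof.
elim: ys F G => [//|y ys IHys] F G /=; rewrite mulr_sumr -big_split /=.
by apply: eq_bigr => c _; rewrite IHys; ring.
Qed.

Lemma Ecoin_le ys F G : (forall t, map fst t = ys -> F t <= G t) ->
  Ecoin ys F <= Ecoin ys G.
Proof.
elim: ys F G => [|y ys IHys] F G FG /=; first exact: FG.
apply: ler_sum => c _; rewrite ler_wpM2l ?coin_law_ge0 //.
by apply: IHys => t tE; rewrite FG //= tE.
Qed.

Lemma Ecoin0 ys : Ecoin ys (fun=> 0) = 0.
Proof. by elim: ys => //= y ys ->; rewrite big1 // => c _; rewrite mulr0. Qed.

Lemma EcoinZ ys (a : R) F : Ecoin ys (fun t => a * F t) = a * Ecoin ys F.
Proof.
have := Ecoin_lin ys a F (fun=> 0); rewrite Ecoin0 addr0 => <-.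
by apply: eq_Ecoin => t _; rewrite addr0.
Qed.

Lemma EcoinB ys F G : Ecoin ys (fun t => F t - G t) = Ecoin ys F - Ecoin ys G.
Proof.
have := Ecoin_lin ys (-1) G F; rewrite mulN1r addrC => <-.
by apply: eq_Ecoin => t _; rewrite mulN1r addrC.
Qed.

Lemma EcoinD ys F G : Ecoin ys (fun t => F t + G t) = Ecoin ys F + Ecoin ys G.
Proof.
have := Ecoin_lin ys 1 F G; rewrite mul1r => <-.
by apply: eq_Ecoin => t _; rewrite mul1r.
Qed.

Lemma Ecoin_norm ys F : `|Ecoin ys F| <= Ecoin ys (fun t => `|F t|).
Proof.
rewrite ler_norml -mulN1r -EcoinZ; apply/andP; split; apply: Ecoin_le => t _.
  by rewrite mulN1r lerNl -normrN ler_norm.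
exact: ler_norm.
Qed.

Definition forget (j : J) t := [seq if z.1 == j then (j, false) else z | z <- t].

Lemma forget_idem j t : forget j (forget j t) = forget j t.
Proof.
rewrite /forget -map_comp; apply: eq_map => z /=.
by case zj: (z.1 == j); rewrite /= ?eqxx ?zj.
Qed.

(** [blind j F]: the value of [F] does not depend on the coins of the balls
    marked [j]. *)
Definition blind {T : Type} j (F : seq (J * bool) -> T) := forall t, F (forget j t) = F t.

Lemma blind_cons {T : Type} j (F : seq (J * bool) -> T) z :
  blind j F -> blind j (fun t => F (z :: t)).
Proof.
move=> Fj t; rewrite -(Fj (z :: t)) -(Fj (z :: forget j t)) /=.
by rewrite -/(forget j (forget j t)) forget_idem.
Qed.

(** A light box stays empty when the coins of all balls with its mark fail. This
    has probability [2 ^- M] for [M] such balls, and [F] ignores these coins. *)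
Lemma Ecoin_miss j ys (F : seq (J * bool) -> R) : j \in D -> blind j F ->
  Ecoin ys (fun t => F t * ((j, true) \notin t)%:R) =
  thin 2^-1 (size ys) j ys * Ecoin ys F.
Proof.
move=> jD; elim: ys F => [|y ys IHys] F Fj.
  by rewrite /= thin0 mulr1 mul1r.
rewrite [size _]/= thin_cons /= !big_bool /=.
have IH c : Ecoin ys (fun t => F ((y, c) :: t) * ((j, true) \notin t)%:R) =
    thin 2^-1 (size ys) j ys * Ecoin ys (fun t => F ((y, c) :: t)).
  exact: IHys (blind_cons _ Fj).
have [yj|yj] := eqVneq y j; last first.
  rewrite (@eq_Ecoin ys _ (fun t => F ((y, true) :: t) * ((j, true) \notin t)%:R)); last first.
    by move=> t _; rewrite in_cons xpair_eqE eq_sym (negPf yj).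
  rewrite (@eq_Ecoin ys (fun t => F ((y, false) :: t) * _)
     (fun t => F ((y, false) :: t) * ((j, true) \notin t)%:R)); last first.
    by move=> t _; rewrite in_cons xpair_eqE eq_sym (negPf yj).
  by rewrite !IH /=; ring.
subst y.
rewrite (@eq_Ecoin ys (fun t => F ((j, true) :: t) * _) (fun=> 0)); last first.
  by move=> t _; rewrite in_cons eqxx /= mulr0.
rewrite (@eq_Ecoin ys (fun t => F ((j, false) :: t) * _)
   (fun t => F ((j, false) :: t) * ((j, true) \notin t)%:R)); last first.
  by move=> t _; rewrite in_cons xpair_eqE eqxx.
rewrite (@eq_Ecoin ys (fun t => F ((j, true) :: t)) (fun t => F ((j, false) :: t))); last first.
  by move=> t _; rewrite -[LHS]Fj -[RHS]Fj /= eqxx.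
by rewrite Ecoin0 IH /coin_law jD /=; field.
Qed.

Lemma Ecoin_mixop j ys (F : seq (J * bool) -> R) (g : nat -> R)
    (N : seq (J * bool) -> nat) : j \in D -> blind j F -> blind j N ->
  Ecoin ys (fun t => F t * g (N t + ((j, true) \in t))%N) =
  Ecoin ys (fun t => F t * mixop (thin 2^-1 (size ys) j ys) g (N t)).
Proof.
move=> jD Fj Nj; set q := thin _ _ _ _.
rewrite (@eq_Ecoin ys _ (fun t => (F t * g (N t) * ((j, true) \notin t)%:R -
   F t * g (N t).+1 * ((j, true) \notin t)%:R) + F t * g (N t).+1)); last first.
  by move=> t _; case: ((j, true) \in t); rewrite /= ?addn0 ?addn1; ring.
rewrite EcoinD EcoinB !Ecoin_miss //; first last.
- by move=> t; rewrite Fj Nj.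
- by move=> t; rewrite Fj Nj.
rewrite -!EcoinZ -EcoinB -EcoinD -/q; apply: eq_Ecoin => t _.
by rewrite /mixop; ring.
Qed.

(** Given the marks, the boxes [ks] are occupied independently, so they act on [g]
    through their Bernoulli operators. *)
Lemma Ecoin_mixops ks ys (F : seq (J * bool) -> R) (g : nat -> R)
    (N : seq (J * bool) -> nat) : uniq ks -> {subset ks <= D} ->
    (forall j, j \in ks -> blind j F) -> (forall j, j \in ks -> blind j N) ->
  Ecoin ys (fun t => F t * g (N t + \sum_(j <- ks) ((j, true) \in t))%N) =
  Ecoin ys (fun t => F t *
    mixops [seq thin 2^-1 (size ys) j ys | j <- ks] g (N t)).
Proof.
elim: ks g N => [|j ks IHks] g N /=.
  by move=> _ _ _ _; apply: eq_Ecoin => t _; rewrite big_nil addn0.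
move=> /andP[jks uks] ksD Fk Nk.
have kj i : i \in ks -> i != j by apply: contraTneq => ->.
rewrite (@eq_Ecoin ys _ (fun t => F t *
   g ((N t + \sum_(i <- ks) ((i, true) \in t)) + ((j, true) \in t))%N)); last first.
  by move=> t _; rewrite big_cons -addnA [X in (N t + X)%N]addnC.
rewrite (Ecoin_mixop ys g (N := fun t => (N t + \sum_(i <- ks) ((i, true) \in t))%N)); first last.
- move=> t; rewrite Nk ?mem_head //; congr addn.
  apply: eq_big_seq => i /kj ij; congr nat_of_bool; rewrite /forget.
  apply/mapP/idP => [[[y c] yt /=]|it].
    by case: (y =P j) => _ // [-> ->].
  by exists (i, true) => //=; rewrite (negPf ij).
- by apply: Fk; rewrite mem_head.
- by apply: ksD; rewrite mem_head.
apply: IHks => //.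
- by move=> i iks; apply: ksD; rewrite in_cons iks orbT.
- by move=> i iks; apply: Fk; rewrite in_cons iks orbT.
- by move=> i iks; apply: Nk; rewrite in_cons iks orbT.
Qed.

End Coins.

(** * Smoothness of the number of occupied boxes *)

Section Smoothness.
Context {R : realType} {J : finType} (w : J -> R).
Context (w_ge0 : forall x, 0 <= w x) (w_sum1 : \sum_x w x = 1).
Context (o : J) (D : {set J}) (oD : o \notin D).
Context (D_le : \sum_(j in D) w j <= w o) (D_small : \sum_(j in D) w j <= 8^-1).
Implicit Types (s ys : seq J) (t : seq (J * bool)) (K : {set J}).

Local Notation place := (place o D).
Local Notation mark_weight := (mark_weight w o D).
Local Notation marked_weight := (marked_weight w o D).

(** The heavy box receives the balls whose coins fail, so its occupation depends
    on all the coins. It is left out of the smoothed count. *)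
Definition occ_except s : nat := \sum_(x | x != o) (x \in s).

Lemma occ_exceptE s : occ s = (occ_except s + (o \in s))%N.
Proof. by rewrite occE (bigD1 o) //= addnC. Qed.

Lemma mem_place j t : j \in D -> (j \in map place t) = ((j, true) \in t).
Proof.
move=> jD; have oj : o != j by apply: contraNneq oD => ->.
apply/mapP/idP => [[[y c] yt]|jt]; last by exists (j, true); rewrite // /place andbF.
rewrite /place /=; case: ifP => [_ jo|]; first by rewrite jo eqxx in oj.
by move=> /negbT; rewrite negb_and negbK => yD jy; move: yD yt; rewrite -jy jD /= => ->.
Qed.

Lemma place_forget j x (z : J * bool) : x != j -> x != o ->
  (place (if z.1 == j then (j, false) else z) == x) = (place z == x).
Proof.
move=> xj xo; case: (z.1 =P j) => // zj; rewrite /place /= zj.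
have jx : (j == x) = false by rewrite eq_sym (negPf xj).
have ox : (o == x) = false by rewrite eq_sym (negPf xo).
by case: (j \in D); case: (z.2); rewrite /= ?jx ?ox.
Qed.

Lemma blind_thin c k j x : x != j -> x != o ->
  blind j (fun t => thin c k x (map place t) : R).
Proof.
move=> xj xo t; rewrite /thin -!map_take !big_map /=.
by apply: eq_bigr => z _; rewrite place_forget.
Qed.

Lemma blind_mem j x : x != j -> x != o -> blind j (fun t => x \in map place t).
Proof.
move=> xj xo t /=; elim: t => [//|z t IHt] /=.
by rewrite !in_cons IHt ![x == _]eq_sym place_forget.
Qed.

(** The total [coin_weight] of the boxes in [K] once the marks are given. Box [j]
    remains empty with probability [thin 2^-1 (size ys) j ys], which is 1 when no
    ball is marked [j]; the second term removes that case. *)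
Definition spread K ys : R :=
  \sum_(j in K) (thin 2^-1 (size ys) j ys - thin 1 (size ys) j ys).

Lemma thin_half_le j ys : j \in ys -> thin 2^-1 (size ys) j ys <= 2^-1 :> R.
Proof.
elim: ys => [//|y ys IHys]; rewrite in_cons [size _]/= thin_cons.
have := @thin_ge0 R J 2^-1 (size ys) j ys; set th := thin _ _ _ _ => th0.
have {}th0 : 0 <= th by apply: th0; lra.
have th1 : th <= 1.
  rewrite /th /thin; apply: prodr_ile1 => x _.
  by case: (x == j); rewrite ?mulr1 ?mulr0; apply/andP; split; lra.
rewrite [y == j]eq_sym; case: eqP => [_ _|_ /= jys].
  by rewrite mulr1; lra.
by rewrite mulr0 subr0 mul1r; exact: IHys.
Qed.

Lemma coin_weight_thin j ys : coin_weight (thin 2^-1 (size ys) j ys) =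
  thin 2^-1 (size ys) j ys - thin 1 (size ys) j ys :> R.
Proof.
rewrite thin_empty take_size; case: (boolP (j \in ys)) => jys /=.
  rewrite subr0 /coin_weight ifN //; apply/eqP => e.
  by have := thin_half_le jys; rewrite e; lra.
have -> : thin 2^-1 (size ys) j ys = 1 :> R.
  rewrite /thin take_size big1_seq // => x /andP[_ xys].
  by rewrite (_ : (x == j) = false) ?mulr0 ?subr0 //; apply: contraNF jys => /eqP <-.
by rewrite /coin_weight eqxx subrr.
Qed.

Lemma spread_ge0 K ys : 0 <= spread K ys.
Proof.
apply: sumr_ge0 => j _; rewrite -coin_weight_thin /coin_weight; case: ifP => // _.
by apply: thin_ge0; lra.
Qed.

(** The boxes of [K] are averaged first: [F] and the rest of the count are constant
    with respect to their coins. *)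
Lemma Ecoin_smooth K ys (F : seq (J * bool) -> R) (g : nat -> R) (bnd : R -> R) (c : R) :
  K \subset D -> (forall j, j \in K -> blind j F) -> 0 <= c ->
  (forall r z : R, 0 <= r <= 1 -> 1 <= z ->
     (1 - r) * bnd z + r * bnd (z + 1) <= bnd (z + r / 2)) ->
  (forall b k, `|fair b g k| <= c * bnd b.+1%:R) ->
  `|Ecoin D ys (fun t => F t * g (occ_except (map place t)))| <=
    Ecoin D ys (fun t => `|F t|) * (c * bnd (1 + spread K ys)).
Proof.
move=> KD KF c0 bndP gP; have KD' j : j \in K -> j \in D by exact: (fintype.subsetP KD).
pose N t := (\sum_(x | (x != o) && (x \notin K)) (x \in map place t))%N.
have NE t : occ_except (map place t) = (N t + \sum_(j <- enum K) ((j, true) \in t))%N.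
  rewrite /occ_except (bigID (mem K)) /= addnC; congr addn.
  rewrite big_enum; apply: eq_big => [x|x /andP[_ xK]]; last by rewrite mem_place ?KD'.
  by apply: andb_idl => /KD'; apply: contraTneq => ->.
rewrite (@eq_Ecoin _ _ _ _ _ (fun t => F t *
  g (N t + \sum_(j <- enum K) ((j, true) \in t))%N)); last by move=> t _; rewrite NE.
rewrite Ecoin_mixops ?enum_uniq //; first last.
- move=> j; rewrite mem_enum => jK t; apply: eq_bigr => x /andP[xo xK].
  by rewrite blind_mem //; apply: contraNneq xK => ->.
- by move=> j; rewrite mem_enum; exact: KF.
- by move=> j; rewrite mem_enum; exact: KD'.
apply: le_trans (Ecoin_norm _ _ _) _.
rewrite mulrC -EcoinZ; apply: Ecoin_le => t _.
rewrite normrM mulrC ler_wpM2r //.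
have -> : spread K ys =
    \sum_(q <- [seq thin 2^-1 (size ys) j ys | j <- enum K]) coin_weight q.
  by rewrite big_map big_enum; apply: eq_bigr => j _; rewrite coin_weight_thin.
apply: mixops_bound => //; apply/allP => q /mapP[j _ ->].
case: (boolP (j \in ys)) => jys.
  by rewrite thin_half_le // thin_ge0 ?orbT //; lra.
have := coin_weight_thin j ys; rewrite thin_empty take_size jys /= /coin_weight.
by case: ifP => [//|_ e]; exfalso; lra.
Qed.

Section Spread.
Context (n : nat) (K : {set J}) (KD : K \subset D).

Local Notation v := (\sum_(j in K) box_var w n j).
Local Notation EM := (Ex mark_weight n).

Let m_ge0 := mark_weight_ge0 w_ge0 D_le.
Let m_sum1 := mark_weight_sum1 w_sum1 oD.

Lemma weight_small j : j \in K -> 0 <= w j <= 8^-1.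
Proof.
move=> /(fintype.subsetP KD) jD; rewrite w_ge0 /=; apply: le_trans D_small.
by rewrite (bigD1 j) //= lerDl sumr_ge0.
Qed.

Lemma Ex_mark_thin c j : j \in K -> EM (thin c n j) = (1 - c * (2 * w j)) ^+ n.
Proof.
by move=> /(fintype.subsetP KD) jD; rewrite (Ex_thin m_sum1) // /mark_weight jD.
Qed.

Lemma miss_double_le j : j \in K ->
  (1 - 2 * w j) ^+ n <= (1 - w j) ^+ n * (1 - w j) ^+ n.
Proof.
move=> /weight_small /andP[w0 w8]; rewrite -exprMn lerXn2r ?nnegrE //; nra.
Qed.

Lemma hit_double_le j : j \in K ->
  1 - (1 - 2 * w j) ^+ n <= 2 * (1 - (1 - w j) ^+ n).
Proof.
move=> /weight_small /andP[w0 w8]; rewrite -!geo_sum -mulrA ler_pM2l //.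
rewrite ler_wpM2l //; apply: ler_sum => i _.
by rewrite lerXn2r ?nnegrE //; lra.
Qed.

Lemma spread_sized ys : size ys = n ->
  spread K ys = \sum_(j in K) thin 2^-1 n j ys - \sum_(j in K) thin 1 n j ys.
Proof. by move=> <-; rewrite /spread sumrB. Qed.

(** All coins of box [j] fail with probability [(1 - w j) ^+ n], as in the original
    scheme, and no ball has the mark [j] with at most the square of it, because the
    weight is doubled. *)
Lemma Ex_spread_ge : v <= EM (spread K).
Proof.
rewrite (eq_Ex _ (G := fun ys => \sum_(j in K) thin 2^-1 n j ys -
  \sum_(j in K) thin 1 n j ys)); last exact: spread_sized.
rewrite ExB !Ex_sum -sumrB; apply: ler_sum => j jK.
rewrite !Ex_mark_thin // mul1r (_ : 2^-1 * (2 * w j) = w j); last by field.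
by rewrite /box_var; have := miss_double_le jK; lra.
Qed.

Lemma var_thin_sum c : 0 <= c <= 1 ->
  EM (fun ys => (\sum_(j in K) thin c n j ys - EM (fun ys => \sum_(j in K) thin c n j ys)) ^+ 2)
  <= \sum_(j in K) (EM (fun ys => thin c n j ys ^+ 2) - EM (thin c n j) ^+ 2).
Proof.
move=> c01; apply: (Ex_var_sum m_sum1) => i j iK jK ij.
rewrite !Ex_mark_thin //; apply: le_trans (Ex_thin_negcor m_ge0 m_sum1 c01 c01 ij _ _) _ => //.
by rewrite /mark_weight !(fintype.subsetP KD _ iK) !(fintype.subsetP KD _ jK).
Qed.

Lemma thin_sq c j ys : thin c n j ys ^+ 2 = thin (2 * c - c ^+ 2) n j ys :> R.
Proof.
rewrite /thin -prodrXl; apply: eq_bigr => x _.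
by case: (x == j); rewrite ?mulr1 ?mulr0; ring.
Qed.

Lemma var_spread : EM (fun ys => (spread K ys - EM (spread K)) ^+ 2) <= 6 * v.
Proof.
pose U c ys := \sum_(j in K) thin c n j ys : R.
have UE ys : size ys = n -> spread K ys = U 2^-1 ys - U 1 ys := @spread_sized ys.
have EU : EM (spread K) = EM (U 2^-1) - EM (U 1) by rewrite -ExB; apply: eq_Ex.
apply: le_trans (_ : EM (fun ys => 2 * (U 2^-1 ys - EM (U 2^-1)) ^+ 2 +
    2 * (U 1 ys - EM (U 1)) ^+ 2) <= _).
  apply: (Ex_le m_ge0) => ys /UE ->; rewrite EU.
  set a := U _ ys; set b := U _ ys; set a' := EM _; set b' := EM _.
  by have := sqr_ge0 ((a - a') + (b - b')); lra.
rewrite ExD !ExZ.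
have h : EM (fun ys => (U 2^-1 ys - EM (U 2^-1)) ^+ 2) <= v.
  apply: le_trans (var_thin_sum _) _; first by lra.
  apply: ler_sum => j jK.
  rewrite (eq_Ex _ (G := thin (2 * 2^-1 - 2^-1 ^+ 2) n j)); last by move=> ys _; rewrite thin_sq.
  rewrite !Ex_mark_thin // (_ : 2^-1 * (2 * w j) = w j); last by field.
  rewrite (_ : (2 * 2^-1 - 2^-1 ^+ 2) * (2 * w j) = 3 / 2 * w j); last by field.
  have /andP[w0 w8] := weight_small jK.
  have : (1 - 3 / 2 * w j) ^+ n <= (1 - w j) ^+ n by rewrite lerXn2r ?nnegrE //; lra.
  by rewrite /box_var; lra.
have h1 : EM (fun ys => (U 1 ys - EM (U 1)) ^+ 2) <= 2 * v.
  apply: le_trans (var_thin_sum _) _; first by lra.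
  rewrite mulr_sumr; apply: ler_sum => j jK.
  rewrite (eq_Ex _ (G := thin (2 * 1 - 1 ^+ 2) n j)); last by move=> ys _; rewrite thin_sq.
  rewrite !Ex_mark_thin // !mul1r (_ : 2 * 1 - 1 ^+ 2 = 1); last by ring.
  rewrite mul1r; have := hit_double_le jK; have := miss_double_le jK.
  have /andP[w0 w8] := weight_small jK.
  have z0 : 0 <= (1 - 2 * w j) ^+ n by rewrite exprn_ge0 //; lra.
  have := miss01 w_ge0 w_sum1 j n.
  rewrite /box_var; move: z0; set z := _ ^+ n; set y := _ ^+ n => z0 y01 zy hz.
  by have zy' : z <= y; nra.
lra.
Qed.

(** Chebyshev's inequality in a pointwise form: with [m] the mean and [u] the
    spread, [1 / (1 + u) <= 2 / m + 4 * (u - m) ^+ 2 / m ^+ 2]. *)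
Lemma Ex_inv_spread : 0 < v -> EM (fun ys => (1 + spread K ys)^-1) <= 26 / v.
Proof.
move=> v0; have mv := Ex_spread_ge; set m := EM _ in mv.
have m0 : 0 < m by exact: lt_le_trans mv.
apply: le_trans (_ : EM (fun ys => 2 / m + 4 / m ^+ 2 * (spread K ys - m) ^+ 2) <= _).
  apply: (Ex_le m_ge0) => ys _; have := spread_ge0 K ys; set u := spread K ys => u0.
  have q0 : 0 <= 4 / m ^+ 2 * (u - m) ^+ 2.
    by rewrite mulr_ge0 ?sqr_ge0 // divr_ge0 ?sqr_ge0.
  have [um|um] := leP (m / 2) u.
    apply: le_trans (_ : 2 / m <= _); last by rewrite lerDl.
    rewrite (_ : 2 / m = (m / 2)^-1); last by field; rewrite gt_eqF.
    by rewrite lef_pV2 ?posrE; lra.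
  apply: le_trans (_ : 1 <= _); first by rewrite invf_le1; lra.
  apply: le_trans (_ : 4 / m ^+ 2 * (u - m) ^+ 2 <= _); last by rewrite lerDr divr_ge0 // ltW.
  rewrite mulrAC ler_pdivlMr ?exprn_gt0 // mul1r; nra.
rewrite ExD (Ex_cst m_sum1) ExZ.
have Vle := var_spread; rewrite -/m in Vle.
apply: le_trans (_ : 2 / v + 4 / v ^+ 2 * (6 * v) <= _); last first.
  by rewrite le_eqVlt; apply/orP; left; apply/eqP; field; rewrite gt_eqF.
rewrite lerD // ?ler_pM2l // ?lef_pV2 ?posrE // ler_pM //.
- by rewrite divr_ge0 ?sqr_ge0.
- by apply: (Ex_ge0 m_ge0) => ys; exact: sqr_ge0.
by rewrite ler_pM2l // lef_pV2 ?posrE ?exprn_gt0 // lerXn2r ?nnegrE // ltW.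
Qed.

End Spread.

Section Transfer.
Context (n : nat) (K : {set J}) (KD : K \subset D).
Local Notation v := (\sum_(j in K) box_var w n j).
Context (v_gt0 : 0 < v).
Implicit Types (F : seq J -> R).

Let m_ge0 := mark_weight_ge0 w_ge0 D_le.
Let m_sum1 := mark_weight_sum1 w_sum1 oD.
Let mw_ge0 := marked_weight_ge0 w_ge0 D_le.

Lemma Ex_marks (h : seq J -> R) :
  Ex marked_weight n (fun t => h (map fst t)) = Ex mark_weight n h.
Proof.
rewrite Ex_coin; apply: eq_Ex => ys _.
rewrite (@eq_Ecoin _ _ _ _ _ (fun=> h ys)); last by move=> t ->.
elim: ys (h ys) => [//|y ys IHys] a /=.
by rewrite IHys -mulr_suml sum_coin_law mul1r.
Qed.

Lemma Ex_smooth F (g : nat -> R) (bnd : R -> R) (c : R) :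
  (forall j, j \in K -> blind j (fun t => F (map place t))) -> 0 <= c ->
  (forall r z : R, 0 <= r <= 1 -> 1 <= z ->
     (1 - r) * bnd z + r * bnd (z + 1) <= bnd (z + r / 2)) ->
  (forall b k, `|fair b g k| <= c * bnd b.+1%:R) ->
  `|Ex w n (fun s => F s * g (occ_except s))| <=
    c * Ex marked_weight n (fun t => `|F (map place t)| * bnd (1 + spread K (map fst t))).
Proof.
move=> KF c0 bndP gP.
rewrite -(Ex_place w oD) Ex_coin.
apply: le_trans (Ex_norm m_ge0 _ _) _.
rewrite -ExZ Ex_coin; apply: (Ex_le m_ge0) => ys _.
apply: le_trans (Ecoin_smooth (K := K) (F := fun t => F (map place t)) ys KD KF c0 bndP gP) _.
rewrite (@eq_Ecoin _ _ _ ys (fun t => c * _) (fun t => c * bnd (1 + spread K ys) * `|F (map place t)|)).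
  by rewrite EcoinZ mulrC.
by move=> t ->; ring.
Qed.

Lemma Ex_occ_except_point F (a : R) m :
  (forall j, j \in K -> blind j (fun t => F (map place t))) -> 0 < a ->
  Ex w n (fun s => F s ^+ 2) <= a ^+ 2 ->
  Ex w n (fun s => `|F s| * (occ_except s == m)%:R) <= a * Num.sqrt (26 / v).
Proof.
move=> KF a0 Fa.
have KF' j : j \in K -> blind j (fun t => `|F (map place t)|) by move=> jK t; rewrite KF.
apply: le_trans (ler_norm _) _.
apply: le_trans (Ex_smooth (F := fun s => `|F s|) (g := fun k => (k == m)%:R)
   (bnd := fun z => (Num.sqrt z)^-1) KF' ler01 _ _) _.
- exact: mean_sqrt_inv.
- by move=> b k; rewrite mul1r; exact: fair_point.
rewrite mul1r.
rewrite (eq_Ex _ (G := fun t => `|F (map place t)| *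
    `|(Num.sqrt (1 + spread K (map fst t)))^-1|)); last first.
  by move=> t _; rewrite normr_id (@ger0_norm _ (Num.sqrt _)^-1) ?invr_ge0 ?sqrtr_ge0.
apply: (Ex_CauchySchwarz mw_ge0) => //.
- by rewrite sqrtr_gt0 divr_gt0.
- by rewrite (Ex_place w oD n (fun s => F s ^+ 2)).
rewrite sqr_sqrtr; last by rewrite divr_ge0 // ltW.
apply: le_trans (Ex_inv_spread KD v_gt0).
rewrite -Ex_marks; apply: (Ex_le mw_ge0) => t _.
by rewrite exprVn sqr_sqrtr // addr_ge0 // spread_ge0.
Qed.

(** The heavy box adds 0 or 1 to the count, so two values of [occ_except] are
    possible. *)
Lemma Ex_occ_point F (a : R) m :
  (forall j, j \in K -> blind j (fun t => F (map place t))) -> 0 < a ->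
  Ex w n (fun s => F s ^+ 2) <= a ^+ 2 ->
  Ex w n (fun s => `|F s| * (occ s == m)%:R) <= 2 * (a * Num.sqrt (26 / v)).
Proof.
move=> KF a0 Fa.
apply: le_trans (_ : Ex w n (fun s => `|F s| * (occ_except s == m)%:R +
   `|F s| * (occ_except s == m.-1)%:R) <= _).
  apply: (Ex_le w_ge0) => s _; rewrite -mulrDr ler_wpM2l // occ_exceptE.
  case: (o \in s); last by rewrite addn0 lerDl.
  rewrite addn1; case: m => [|m]; first by rewrite /= addr_ge0.
  by rewrite eqSS lerDr.
rewrite ExD (_ : 2 * _ = a * Num.sqrt (26 / v) + a * Num.sqrt (26 / v)); last by ring.
by rewrite lerD // Ex_occ_except_point.
Qed.

Lemma Ex_fdiff_bounded (g : nat -> R) (c : R) : (forall k, `|g k| <= c) ->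
  `|Ex w n (fun s => fdiff g (occ_except s))| <= 2 * c * Num.sqrt (26 / v).
Proof.
move=> gc; have c0 : 0 <= c := le_trans (normr_ge0 _) (gc 0%N).
have KF j : j \in K -> blind j (fun t => (fun=> 1) (map place t) : R) by [].
rewrite (eq_Ex _ (G := fun s => 1 * fdiff g (occ_except s))); last by move=> s _; rewrite mul1r.
apply: le_trans (Ex_smooth (F := fun=> 1) (g := fdiff g)
   (bnd := fun z => (Num.sqrt z)^-1) (c := 2 * c) KF _ _ _) _.
- by rewrite mulr_ge0.
- exact: mean_sqrt_inv.
- by move=> b k; exact: fair_fdiff_bounded.
rewrite ler_wpM2l ?mulr_ge0 // normr1.
rewrite (eq_Ex _ (G := fun t => `|(Num.sqrt (1 + spread K (map fst t)))^-1|)); last first.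
  by move=> t _; rewrite mul1r ger0_norm ?invr_ge0 ?sqrtr_ge0.
apply: (Ex_abs_le mw_ge0 (marked_weight_sum1 w_sum1 oD)).
  by rewrite sqrtr_gt0 divr_gt0.
rewrite sqr_sqrtr; last by rewrite divr_ge0 // ltW.
apply: le_trans (Ex_inv_spread KD v_gt0).
rewrite -Ex_marks; apply: (Ex_le mw_ge0) => t _.
by rewrite exprVn sqr_sqrtr // addr_ge0 // spread_ge0.
Qed.

Lemma Ex_fdiff_point m :
  `|Ex w n (fun s => fdiff (fun k => (k == m)%:R) (occ_except s))| <= 4 * (26 / v).
Proof.
have KF j : j \in K -> blind j (fun t => (fun=> 1) (map place t) : R) by [].
rewrite (eq_Ex _ (G := fun s => 1 * fdiff (fun k => (k == m)%:R) (occ_except s))); last first.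
  by move=> s _; rewrite mul1r.
apply: le_trans (Ex_smooth (F := fun=> 1) (g := fdiff (fun k => (k == m)%:R))
   (bnd := fun z => z^-1) (c := 4) KF _ _ _) _ => //.
- exact: mean_inv.
- by move=> b k; exact: fair_fdiff_point.
rewrite ler_pM2l // normr1.
rewrite (eq_Ex _ (G := fun t => (1 + spread K (map fst t))^-1)); last first.
  by move=> t _; rewrite mul1r.
by rewrite (Ex_marks (fun ys => (1 + spread K ys)^-1)) Ex_inv_spread.
Qed.

End Transfer.

End Smoothness.

(** * The Stein defect of the number of occupied boxes *)

(** Each term in turn is given to the lighter part, so that the difference of the
    two parts never exceeds the largest term. *)
Lemma balanced_split (R : realType) (J : finType) (D : {set J}) (f : J -> R) (c : R) :
  0 <= c -> (forall j, 0 <= f j <= c) ->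
  exists2 S : {set J}, S \subset D &
    (\sum_(j in D) f j - c) / 2 <= \sum_(j in S) f j /\
    (\sum_(j in D) f j - c) / 2 <= \sum_(j in D :\: S) f j.
Proof.
move=> c0 fc.
(* the invariant of the greedy division of a list *)
suff [P PP] : exists P : pred J, - c <= \sum_(j <- enum D | P j) f j -
    \sum_(j <- enum D | ~~ P j) f j <= c.
  have sP : \sum_(j <- enum D | P j) f j + \sum_(j <- enum D | ~~ P j) f j = \sum_(j in D) f j.
    by rewrite -big_enum [RHS](bigID P).
  exists [set j in D | P j]%SET.
    by apply/fintype.subsetP => j; rewrite inE => /andP[].
  have -> : \sum_(j in [set j in D | P j]%SET) f j = \sum_(j <- enum D | P j) f j.
    by rewrite big_enum_cond; apply: eq_bigl => j; rewrite inE.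
  have -> : \sum_(j in D :\: [set j in D | P j]%SET) f j = \sum_(j <- enum D | ~~ P j) f j.
    rewrite big_enum_cond; apply: eq_bigl => j; rewrite !inE.
    by case: (j \in D); rewrite ?andbF ?andbT.
  lra.
elim: (enum D) (enum_uniq D) => [_|x l IHl /= /andP[xl ul]].
  by exists xpredT; rewrite !big_nil; apply/andP; split; lra.
have [P PP] := IHl ul.
set d := _ - _ in PP; have fx := fc x.
exists (fun y => if y == x then d <= 0 else P y).
rewrite !big_cons eqxx.
have -> : \sum_(j <- l | if j == x then d <= 0 else P j) f j = \sum_(j <- l | P j) f j.
  rewrite big_seq_cond [RHS]big_seq_cond; apply: eq_bigl => j.
  by case: eqP => [->|//]; rewrite (negPf xl).
have -> : \sum_(j <- l | ~~ (if j == x then d <= 0 else P j)) f j = \sum_(j <- l | ~~ P j) f j.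
  rewrite big_seq_cond [RHS]big_seq_cond; apply: eq_bigl => j.
  by case: eqP => [->|//]; rewrite (negPf xl).
move: PP; rewrite /d; set a := \sum_(_ <- _ | _) _; set b := \sum_(_ <- _ | _) _.
by move=> PP; case: (leP (a - b) 0) => /= h; apply/andP; split; lra.
Qed.

Section OccupancyStein.
Context {R : realType} {J : finType} (w : J -> R).
Context (w_ge0 : forall x, 0 <= w x) (w_sum1 : \sum_x w x = 1).
Context (o : J) (D : {set J}) (oD : o \notin D).
Context (D_le : \sum_(j in D) w j <= w o) (D_small : \sum_(j in D) w j <= 8^-1).
Context (n : nat) (n_gt0 : (0 < n)%N) (delta : R) (delta_gt0 : 0 < delta).
Context (delta_le : delta <= w o).
Implicit Types (s ys : seq J) (t : seq (J * bool)) (f g : nat -> R).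

Local Notation E := (Ex w n).
Local Notation r := (unseen_mean w n).
Local Notation V := (total_var w n).
Local Notation h := (#|~: D|%:R : R).
Local Notation s2 := (kernel_mean w n).

Context (V_ge : h + 1 <= V).

Let h0 : 0 <= h. Proof. by []. Qed.
Let V1 : 1 <= V. Proof. by move: V_ge h0; lra. Qed.
Let Vn : V <= n%:R := total_var_le w_ge0 w_sum1 n.
Let r01 := unseen_mean01 w_ge0 w_sum1 n.

Lemma kernel_mean_le4 : s2 <= 4 * V.
Proof. by have := kernel_mean_le w_ge0 w_sum1 n_gt0; move: V1; lra. Qed.

Lemma light_var : V - h / 4 <= \sum_(j in D) box_var w n j.
Proof.
rewrite /total_var (bigID (mem D)) /= -addrA gerDl subr_le0.
have -> : h / 4 = \sum_(j in ~: D) 4^-1 by rewrite sumr_const mulr_natl.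
rewrite (eq_bigl (mem (~: D))) => [|j]; last by rewrite !inE.
by apply: ler_sum => j _; exact: box_var_le.
Qed.

Lemma sqrt_var_le (v : R) : V / 4 <= v -> Num.sqrt (26 / v) <= 11 / Num.sqrt V.
Proof.
move=> vV; have v0 : 0 < v by move: V1; lra.
have sV : 0 < Num.sqrt V by rewrite sqrtr_gt0; move: V1; lra.
have sV2 : Num.sqrt V ^+ 2 = V by rewrite sqr_sqrtr //; move: V1; lra.
have V0 : 0 < V by move: V1; lra.
have q0 : 0 <= 26 / v by rewrite divr_ge0 // ltW.
have p0 : 0 <= 11 / Num.sqrt V by rewrite divr_ge0 // ltW.
rewrite -(@ler_pXn2r _ 2) ?nnegrE ?sqrtr_ge0 //.
rewrite (sqr_sqrtr q0) expr_div_n sV2 ler_pdivrMr // mulrAC ler_pdivlMr //.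
by move: V1; lra.
Qed.

(** A sum of centred functionals of the boxes, given the count. The light boxes are
    divided in two halves of comparable variance; the coins of one half smooth the
    count while the sum over the other half, which they do not affect, keeps its
    standard deviation [a]. The [h] remaining boxes are bounded one by one. *)
Lemma split_point (z : J -> seq J -> R) (a e : R) (m : nat) : 0 < a ->
  (forall j x, x != j -> x != o -> blind j (fun t => z x (map (place o D) t))) ->
  (forall S : {set J}, E (fun s => (\sum_(j in S) z j s -
     E (fun s => \sum_(j in S) z j s)) ^+ 2) <= a ^+ 2) ->
  (forall j, E (fun s => `|z j s - E (z j)|) <= e) ->
  E (fun s => `|\sum_j (z j s - E (z j))| * (occ s == m)%:R) <=
    h * e + 44 * a / Num.sqrt V.
Proof.
move=> a0 zb za ze.
pose F (S : {set J}) s := \sum_(j in S) z j s - E (fun s => \sum_(j in S) z j s).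
have FE (S : {set J}) s : \sum_(j in S) (z j s - E (z j)) = F S s by rewrite sumrB /F Ex_sum.
have f01 j : 0 <= box_var w n j <= 4^-1.
  by rewrite box_var_ge0 // box_var_le.
have c4 : 0 <= 4^-1 :> R by [].
have [S SD [S1 S2]] := balanced_split D c4 f01.
set T := (D :\: S)%SET in S2.
have TD : T \subset D by apply: finset.subsetDl.
have lightV := light_var.
have vS : V / 4 <= \sum_(j in S) box_var w n j by move: V_ge h0; lra.
have vT : V / 4 <= \sum_(j in T) box_var w n j by move: V_ge h0; lra.
have half (A B : {set J}) : A \subset D -> B \subset D -> (forall j, j \in A -> j \notin B) ->
    V / 4 <= \sum_(j in B) box_var w n j ->
    E (fun s => `|F A s| * (occ s == m)%:R) <= 22 * a / Num.sqrt V.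
  move=> AD BD dAB vB; have vB0 : 0 < \sum_(j in B) box_var w n j by move: V1; lra.
  apply: le_trans (Ex_occ_point w_ge0 w_sum1 oD D_le D_small BD vB0 m _ a0 (za A)) _.
    move=> j jB t; congr (_ - _); apply: eq_bigr => x xA; apply: zb.
      by apply: contraTneq jB => <-; exact: dAB.
    by apply: contraTneq (fintype.subsetP AD _ xA) => ->.
  have := sqrt_var_le vB; set q := Num.sqrt (26 / _) => qV.
  rewrite (_ : 22 * a / _ = 2 * (a * (11 / Num.sqrt V))); last by ring.
  by rewrite ler_pM2l // ler_pM2l.
apply: le_trans (_ : E (fun s => \sum_(j in ~: D) `|z j s - E (z j)| +
    (`|F S s| * (occ s == m)%:R + `|F T s| * (occ s == m)%:R)) <= _).
  apply: (Ex_le w_ge0) => s _; rewrite -mulrDl.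
  have b1 : 0 <= ((occ s == m)%:R : R) <= 1 by case: (_ == _); rewrite /= ?lexx ?ler01.
  have -> : \sum_j (z j s - E (z j)) = \sum_(j in ~: D) (z j s - E (z j)) + (F S s + F T s).
    rewrite -!FE (bigID (mem D)) /= addrC; congr (_ + _).
      by apply: eq_bigl => j; rewrite !inE.
    rewrite (bigID (mem S)) /=; congr (_ + _); apply: eq_bigl => j.
      by apply: andb_idl; exact: (fintype.subsetP SD).
    by rewrite !inE andbC.
  apply: le_trans (ler_wpM2r _ (ler_normD _ _)) _; first by case/andP: b1.
  rewrite [leLHS]mulrDl; apply: lerD.
    apply: le_trans (ler_wpM2r _ (ler_norm_sum _ _ _)) _; first by case/andP: b1.
    by rewrite -[leRHS]mulr1 ler_wpM2l ?sumr_ge0 //; case/andP: b1.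
  by apply: ler_wpM2r (ler_normD _ _); case/andP: b1.
rewrite !ExD Ex_sum.
have -> : 44 * a / Num.sqrt V = 22 * a / Num.sqrt V + 22 * a / Num.sqrt V by ring.
apply: lerD.
  rewrite mulr_natl -sumr_const; apply: ler_sum => j _; exact: ze.
apply: lerD; first by apply: half vT => // j jS; rewrite inE jS.
by apply: half vS => // j; rewrite inE => /andP[].
Qed.

Lemma kernel_lin_blind j x : x != j -> x != o ->
  blind j (fun t => kernel_lin w n x (map (place o D) t)).
Proof.
move=> xj xo t; rewrite /kernel_lin /history_of (blind_mem D xj xo t).
congr (_ - _ * _); apply: eq_bigr => k _; congr (_ * _).
exact: (blind_thin D 1 k xj xo t).
Qed.

(** The deviation of the kernel is of order [sqrt V] and a single value of the count
    has probability of order [1 / sqrt V]. *)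
Lemma kernel_point (m : nat) :
  E (fun s => `|kernel w n s - s2| * (occ s == m)%:R) <= 6 * h + 300.
Proof.
have sV : 0 < Num.sqrt V by rewrite sqrtr_gt0; move: V1; lra.
have sV2 : Num.sqrt V ^+ 2 = V by rewrite sqr_sqrtr //; move: V1; lra.
have H := split_point (a := 6 * Num.sqrt V) (e := 6) m _ kernel_lin_blind _
   (Ex_kernel_lin_abs w_ge0 w_sum1 n).
apply: le_trans (_ : E (fun s => `|\sum_j (kernel_lin w n j s - E (kernel_lin w n j))| *
  (occ s == m)%:R + (`|kernel_cross w n s| + 2)) <= _).
  apply: (Ex_le w_ge0) => s _; rewrite kernel_centered //.
  have b1 : 0 <= ((occ s == m)%:R : R) <= 1 by case: (_ == _); rewrite /= ?lexx ?ler01.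
  apply: le_trans (ler_wpM2r _ (ler_normB _ _)) _; first by case/andP: b1.
  rewrite mulrDl lerD2l -[leRHS]mulr1; apply: ler_pM => //; last by case/andP: b1.
  apply: le_trans (ler_normB _ _) _; rewrite lerD2l.
  exact: abs_Ex_kernel_cross_le.
rewrite !ExD (Ex_cst w_sum1).
have := Ex_kernel_cross_le w_ge0 w_sum1 n_gt0.
have -> : 6 * h + 300 = h * 6 + 264 + 36 by ring.
suff : E (fun s => `|\sum_j (kernel_lin w n j s - E (kernel_lin w n j))| *
  (occ s == m)%:R) <= h * 6 + 264 by lra.
rewrite (_ : 264 = 44 * (6 * Num.sqrt V) / Num.sqrt V); last by field; rewrite gt_eqF.
apply: H; first by rewrite mulr_gt0.
move=> S; apply: le_trans (var_kernel_lin w_ge0 w_sum1 n_gt0 D_small S) _.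
by rewrite exprMn sV2; move: V_ge V1; lra.
Qed.

Lemma kernel_abs : E (fun s => `|kernel w n s - s2|) <= 6 * Num.sqrt V + 4.
Proof.
have sV : 0 < Num.sqrt V by rewrite sqrtr_gt0; move: V1; lra.
have sV2 : Num.sqrt V ^+ 2 = V by rewrite sqr_sqrtr //; move: V1; lra.
apply: le_trans (_ : E (fun s => `|\sum_j (kernel_lin w n j s - E (kernel_lin w n j))| +
    (`|kernel_cross w n s| + 2)) <= _).
  apply: (Ex_le w_ge0) => s _; rewrite kernel_centered //.
  apply: le_trans (ler_normB _ _) _; rewrite lerD2l.
  apply: le_trans (ler_normB _ _) _; rewrite lerD2l.
  exact: abs_Ex_kernel_cross_le.
rewrite !ExD (Ex_cst w_sum1).
have := Ex_kernel_cross_le w_ge0 w_sum1 n_gt0.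
suff : E (fun s => `|\sum_j (kernel_lin w n j s - E (kernel_lin w n j))|) <= 6 * Num.sqrt V.
  by lra.
apply: (Ex_abs_le w_ge0 w_sum1); first by rewrite mulr_gt0.
have := var_kernel_lin w_ge0 w_sum1 n_gt0 D_small [set: J]%SET.
rewrite (eq_Ex _ (G := fun s => (\sum_j (kernel_lin w n j s - E (kernel_lin w n j))) ^+ 2)).
  by move/le_trans; apply; rewrite exprMn sV2; move: V_ge V1; lra.
move=> s _; congr (_ ^+ 2); rewrite Ex_sum -sumrB.
by apply: eq_bigl => j; rewrite inE.
Qed.

Lemma unseen_point (m : nat) :
  E (fun s => `|unseen w s - r| * (occ s == m)%:R) <=
    2 * h / n.+1%:R + 44 / (Num.sqrt n.+1%:R * Num.sqrt V).
Proof.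
have n0 : 0 < n.+1%:R :> R by rewrite ltr0n.
have sn : 0 < Num.sqrt (n.+1%:R : R) by rewrite sqrtr_gt0.
have sn2 : Num.sqrt (n.+1%:R : R) ^+ 2 = n.+1%:R by rewrite sqr_sqrtr ?ler0n.
have w01 := weight01 w_ge0 w_sum1.
have := split_point (z := fun j s => w j * (j \notin s)%:R)
  (a := (Num.sqrt n.+1%:R)^-1) (e := 2 / n.+1%:R) m.
rewrite (eq_Ex _ (F := fun s => `|_| * _) (G := fun s => `|unseen w s - r| * (occ s == m)%:R)); last first.
  move=> s _; rewrite -(Ex_unseen w_sum1 n) Ex_sum -sumrB //.
move=> H; apply: le_trans (H _ _ _ _) _.
- by rewrite invr_gt0.
- by move=> j x xj xo t; rewrite (blind_mem D xj xo t).
- by move=> S; rewrite exprVn sn2; exact: var_unseen.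
- move=> j; apply: le_trans (_ : E (fun s => w j * (j \notin s)%:R + w j * (1 - w j) ^+ n) <= _).
    apply: (Ex_le w_ge0) => s _; rewrite ExZ Ex_miss //.
    apply: le_trans (ler_normB _ _) _; rewrite !ger0_norm //.
      by rewrite mulr_ge0 // exprn_ge0 // subr_ge0; case/andP: (w01 j).
    by rewrite mulr_ge0.
  rewrite ExD ExZ Ex_miss // (Ex_cst w_sum1) ler_pdivlMr //.
  by have := single_hit_le1 n (w01 j); lra.
by rewrite le_eqVlt; apply/orP; left; apply/eqP; rewrite invfM; ring.
Qed.

Lemma unseen_abs : E (fun s => `|unseen w s - r|) <= (Num.sqrt n.+1%:R)^-1.
Proof.
have sn : 0 < Num.sqrt (n.+1%:R : R) by rewrite sqrtr_gt0 ltr0n.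
apply: (Ex_abs_le w_ge0 w_sum1); first by rewrite invr_gt0.
by rewrite exprVn sqr_sqrtr ?ler0n // var_unseen_total.
Qed.

Lemma Ex_point_sum (phi : seq J -> R) g (A G : R) : 0 <= A ->
  (forall s, 0 <= phi s) ->
  (forall m, E (fun s => phi s * (occ s == m)%:R) <= A) ->
  (forall M, \sum_(k < M) `|g k| <= G) ->
  E (fun s => phi s * `|g (occ s)|) <= A * G.
Proof.
move=> A0 phi0 phiA gG.
rewrite (eq_Ex _ (G := fun s => \sum_(m < n.+1) `|g m| * (phi s * (occ s == m)%:R))); last first.
  move=> s sn; have os : (occ s < n.+1)%N by rewrite ltnS -sn occ_le_size.
  rewrite -(sum_indicator (fun m => `|g m|) os) mulr_sumr.
  by apply: eq_bigr => m _; rewrite mulrCA.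
rewrite Ex_sum; apply: le_trans (_ : \sum_(m < n.+1) `|g m| * A <= _).
  by apply: ler_sum => m _; rewrite ExZ ler_wpM2l.
by rewrite -mulr_suml mulrC ler_wpM2l.
Qed.

Definition stein_defect f : R :=
  Ex w n.+1 (fun s => s2 * fdiff f (occ s) -
    ((occ s)%:R - Ex w n.+1 (fun s => (occ s)%:R)) * f (occ s)).

Lemma Ex_next f : Ex w n.+1 (fun s => f (occ s)) =
  E (fun s => f (occ s)) + E (fun s => unseen w s * fdiff f (occ s)).
Proof.
transitivity (E (fun s => \sum_x w x * f (occ (x :: s)))).
  by rewrite Ex_sum; apply: eq_bigr => x _; rewrite -ExZ.
rewrite -ExD; apply: eq_Ex => s _.
rewrite (eq_bigr (fun x => w x * f (occ s) + w x * (x \notin s)%:R * fdiff f (occ s))).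
  by rewrite big_split -!mulr_suml w_sum1 mul1r.
move=> x _; rewrite occ_cons /fdiff.
by case: (x \in s); rewrite /= ?add0n ?add1n; ring.
Qed.

(** [kernel_identity] evaluates [fdiff f] with one ball fewer. Adding that ball
    ([Ex_next]) costs a second difference of [f], weighted by [unseen]. *)
Lemma stein_defectE f : stein_defect f =
  s2 * E (fun s => unseen w s * fdiff (fdiff f) (occ s)) -
  E (fun s => (kernel w n s - s2) * fdiff f (occ s)).
Proof.
rewrite /stein_defect ExB ExZ kernel_identity // (Ex_next (fdiff f)).
have -> : E (fun s => kernel w n s * fdiff f (occ s)) =
    E (fun s => (kernel w n s - s2) * fdiff f (occ s)) + s2 * E (fun s => fdiff f (occ s)).
  by rewrite -ExZ -ExD; apply: eq_Ex => s _; ring.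
by ring.
Qed.

(** Dropping the heavy box [o] changes the count only when it is empty, which has
    probability of order [1 / n]. *)
Lemma except_shift g (c : R) : (forall k, `|g k| <= c) ->
  `|E (fun s => g (occ s)) - E (fun s => g (occ_except o s).+1)| <=
    2 * c / (n.+1%:R * delta).
Proof.
move=> gc; have c0 : 0 <= c := le_trans (normr_ge0 _) (gc 0%N).
have n0 : 0 < n.+1%:R :> R by rewrite ltr0n.
have w01 := weight01 w_ge0 w_sum1 o.
rewrite -ExB; apply: le_trans (Ex_norm w_ge0 _ _) _.
apply: le_trans (_ : E (fun s => 2 * c * (o \notin s)%:R) <= _).
  apply: (Ex_le w_ge0) => s _; rewrite (occ_exceptE o).
  case: (o \in s) => /=; first by rewrite addn1 subrr normr0 mulr0.
  by rewrite mulr1 (le_trans (ler_normB _ _)) // mulr2n mulrDl mul1r lerD.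
rewrite ExZ Ex_miss // ler_wpM2l ?mulr_ge0 //.
rewrite -[leRHS]mul1r ler_pdivlMr ?mulr_gt0 // mulrC.
apply: le_trans (single_hit_le1 n w01); rewrite ler_wpM2r ?ler_pM2l //.
by have /andP[] := miss01 w_ge0 w_sum1 o n.
Qed.

Let DV : V / 4 <= \sum_(j in D) box_var w n j.
Proof. by have := light_var; move: V_ge h0; lra. Qed.

Let DV0 : 0 < \sum_(j in D) box_var w n j.
Proof. by move: DV V1; lra. Qed.

Let sV : 0 < Num.sqrt V. Proof. by rewrite sqrtr_gt0; move: V1; lra. Qed.
Let sV2 : Num.sqrt V ^+ 2 = V. Proof. by rewrite sqr_sqrtr //; move: V1; lra. Qed.
Let sV1 : 1 <= Num.sqrt V.
Proof. by rewrite -sqrtr1 ler_wsqrtr // V1. Qed.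
Let sn : 0 < Num.sqrt (n.+1%:R : R). Proof. by rewrite sqrtr_gt0 ltr0n. Qed.
Let sVn : Num.sqrt V <= Num.sqrt (n.+1%:R : R).
Proof. by rewrite ler_wsqrtr // (le_trans Vn) // ler_nat. Qed.
Lemma unseen_split f : E (fun s => unseen w s * fdiff f (occ s)) =
  r * E (fun s => fdiff f (occ s)) + E (fun s => (unseen w s - r) * fdiff f (occ s)).
Proof. by rewrite -ExZ -ExD; apply: eq_Ex => s _; ring. Qed.

(** Three contributions, with [c] bounding the increments: the deviation of the
    kernel, of order [sqrt V]; [s2] times the mean of a second difference, which
    smoothness reduces to [c / sqrt V]; and [s2] times the deviation of [unseen], of
    order [1 / sqrt n <= 1 / sqrt V]. *)
Lemma stein_defect_smooth f (c : R) : 0 <= s2 -> (forall k, `|fdiff f k| <= c) ->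
  `|stein_defect f| <= (16 / delta + 110) * c * Num.sqrt V.
Proof.
move=> s20 fc; have c0 : 0 <= c := le_trans (normr_ge0 _) (fc 0%N).
have /andP[r0 r1] := r01.
have s24 := kernel_mean_le4.
have n0 : 0 < n.+1%:R :> R by rewrite ltr0n.
have Vn1 : V <= n.+1%:R by rewrite (le_trans Vn) // ler_nat.
have ffc k : `|fdiff (fdiff f) k| <= 2 * c.
  by rewrite (le_trans (ler_normB _ _)) // mulr2n mulrDl mul1r lerD.
have A : `|E (fun s => (kernel w n s - s2) * fdiff f (occ s))| <= c * (6 * Num.sqrt V + 4).
  apply: le_trans (Ex_norm w_ge0 _ _) _.
  apply: le_trans (_ : E (fun s => c * `|kernel w n s - s2|) <= _).
    by apply: (Ex_le w_ge0) => s _; rewrite normrM mulrC ler_wpM2r.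
  by rewrite ExZ ler_wpM2l // kernel_abs.
have B : `|E (fun s => (unseen w s - r) * fdiff (fdiff f) (occ s))| <=
    2 * c / Num.sqrt n.+1%:R.
  apply: le_trans (Ex_norm w_ge0 _ _) _.
  apply: le_trans (_ : E (fun s => 2 * c * `|unseen w s - r|) <= _).
    by apply: (Ex_le w_ge0) => s _; rewrite normrM mulrC ler_wpM2r.
  by rewrite ExZ ler_wpM2l ?mulr_ge0 // unseen_abs.
have C1 := except_shift ffc.
have C2 : `|E (fun s => fdiff (fdiff f) (occ_except o s).+1)| <= 22 * c / Num.sqrt V.
  have fc' k : `|fdiff f k.+1| <= c := fc k.+1.
  have := Ex_fdiff_bounded w_ge0 w_sum1 oD D_le D_small (fintype.subxx _) DV0 fc'.
  move/le_trans; apply; have := sqrt_var_le DV; set q := Num.sqrt (26 / _) => qV.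
  rewrite (_ : 22 * c / _ = 2 * c * (11 / Num.sqrt V)); last by ring.
  by rewrite ler_wpM2l ?mulr_ge0.
rewrite stein_defectE unseen_split.
set a := E _ in A *; set b := E _ in B *.
set d := E (fun s => fdiff (fdiff f) (occ s)) in C1 *; set d' := E _ in C1 C2.
have dle : `|d| <= 4 * c / (n.+1%:R * delta) + 22 * c / Num.sqrt V.
  rewrite (_ : d = (d - d') + d'); last by ring.
  rewrite (le_trans (ler_normD _ _)) // lerD // (le_trans C1) //.
  by rewrite le_eqVlt; apply/orP; left; apply/eqP; ring.
have H1 : s2 * (r * `|d| + `|b|) <= 4 * V *
    (4 * c / (n.+1%:R * delta) + 22 * c / Num.sqrt V + 2 * c / Num.sqrt n.+1%:R).
  apply: ler_pM => //; first by rewrite addr_ge0 // mulr_ge0.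
  apply: lerD => //; apply: le_trans dle.
  by rewrite -[leRHS]mul1r ler_wpM2r.
have e1 : V / n.+1%:R <= 1 by rewrite ler_pdivrMr // mul1r.
have e2 : V / Num.sqrt V = Num.sqrt V by rewrite -{1}sV2; field; rewrite gt_eqF.
have e3 : V / Num.sqrt n.+1%:R <= Num.sqrt V.
  by rewrite ler_pdivrMr // -{1}sV2 expr2 ler_pM2l.
have H2 : 4 * V *
    (4 * c / (n.+1%:R * delta) + 22 * c / Num.sqrt V + 2 * c / Num.sqrt n.+1%:R) <=
    16 * c / delta + 96 * c * Num.sqrt V.
  rewrite (_ : _ * _ = 16 * c / delta * (V / n.+1%:R) + 88 * c * (V / Num.sqrt V) +
     8 * c * (V / Num.sqrt n.+1%:R)); last by rewrite invfM; ring.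
  rewrite e2 -addrA; apply: lerD.
    by rewrite -[leRHS]mulr1 ler_wpM2l // divr_ge0 ?mulr_ge0 // ltW.
  have := ler_wpM2l (_ : 0 <= 8 * c) e3; rewrite mulr_ge0 // => /(_ isT); lra.
apply: le_trans (_ : s2 * (r * `|d| + `|b|) + `|a| <= _).
  apply: le_trans (ler_normB _ _) _; rewrite lerD2r normrM ger0_norm // ler_wpM2l //.
  by apply: le_trans (ler_normD _ _) _; rewrite lerD2r normrM ger0_norm.
apply: le_trans (lerD (le_trans H1 H2) A) _.
have cd : 0 <= c / delta by rewrite divr_ge0 // ltW.
have X : c / delta <= c / delta * Num.sqrt V by rewrite -[leLHS]mulr1 ler_wpM2l.
have Y : c <= c * Num.sqrt V by rewrite -[leLHS]mulr1 ler_wpM2l.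
rewrite (_ : 16 * c / delta = 16 * (c / delta)); last by ring.
rewrite (_ : (16 / delta + 110) * c * Num.sqrt V =
  16 * (c / delta * Num.sqrt V) + 110 * (c * Num.sqrt V)); last by ring.
lra.
Qed.

(** The same three contributions, each expanded over the values of the count. Every
    value then gains a factor [1 / sqrt V] from smoothness, and the increments are
    summed instead of bounded one by one. *)
Lemma stein_defect_local f (G : R) : 0 <= s2 ->
  (forall M, \sum_(k < M) `|fdiff f k| <= G) ->
  `|stein_defect f| <= (16 / delta + 22 * h + 3000) * G.
Proof.
move=> s20 fG; have G0 : 0 <= G by have := fG 0%N; rewrite big_ord0.
have /andP[r0 r1] := r01.
have s24 := kernel_mean_le4.
have n0 : 0 < n.+1%:R :> R by rewrite ltr0n.
have Vn1 : V <= n.+1%:R by rewrite (le_trans Vn) // ler_nat.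
have V0 : 0 < V by move: V1; lra.
have fG' M : \sum_(k < M) `|fdiff f k.+1| <= G.
  by apply: le_trans (fG M.+1); rewrite big_ord_recl lerDr.
have fc k : `|fdiff f k| <= G.
  by apply: le_trans (fG k.+1); rewrite big_ord_recr lerDr sumr_ge0.
have ffc k : `|fdiff (fdiff f) k| <= 2 * G.
  by rewrite (le_trans (ler_normB _ _)) // mulr2n mulrDl mul1r lerD.
have A : `|E (fun s => (kernel w n s - s2) * fdiff f (occ s))| <= (6 * h + 300) * G.
  apply: le_trans (Ex_norm w_ge0 _ _) _.
  rewrite (eq_Ex _ (G := fun s => `|kernel w n s - s2| * `|fdiff f (occ s)|)); last first.
    by move=> s _; rewrite normrM.
  apply: Ex_point_sum; [|by []|exact: kernel_point|exact: fG].
  by apply: addr_ge0 (ler0n _ _); rewrite mulr_ge0.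
set eta := 2 * h / n.+1%:R + 44 / (Num.sqrt n.+1%:R * Num.sqrt V).
have eta0 : 0 <= eta.
  by rewrite addr_ge0 ?divr_ge0 ?mulr_ge0 // ltW.
have B : `|E (fun s => (unseen w s - r) * fdiff (fdiff f) (occ s))| <= 2 * eta * G.
  apply: le_trans (Ex_norm w_ge0 _ _) _.
  apply: le_trans (_ : E (fun s => `|unseen w s - r| * `|fdiff f (occ s).+1| +
      `|unseen w s - r| * `|fdiff f (occ s)|) <= _).
    by apply: (Ex_le w_ge0) => s _; rewrite normrM -mulrDr ler_wpM2l // ler_normB.
  rewrite ExD (_ : 2 * eta * G = eta * G + eta * G); last by ring.
  apply: lerD.
    by apply: (Ex_point_sum (g := fun k => fdiff f k.+1)) => //; exact: unseen_point.
  by apply: Ex_point_sum => //; exact: unseen_point.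
have C1 := except_shift ffc.
have C2 : `|E (fun s => fdiff (fdiff f) (occ_except o s).+1)| <= 416 * G / V.
  pose g k := fdiff f k.+1.
  rewrite (eq_Ex _ (G := fun s => \sum_(m < n.+2) g m *
     fdiff (fun k => (k == m)%:R) (occ_except o s))); last first.
    move=> s ss; have os : (occ_except o s <= n)%N.
      by rewrite -ss -(leq_add2r (o \in s)) -occ_exceptE (leq_trans (occ_le_size s)) // leq_addr.
    rewrite /fdiff -/(g _) -/(g _).
    have gE k : (k < n.+2)%N -> g k = \sum_(m < n.+2) g m * (k == m)%:R.
      by move=> kn; rewrite sum_indicator.
    rewrite (_ : _ - _ = g (occ_except o s).+1 - g (occ_except o s)) //.
    rewrite gE // [X in _ - X]gE; last by rewrite ltnS leqW.
    by rewrite -sumrB; apply: eq_bigr => m _; ring.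
  rewrite Ex_sum; apply: le_trans (ler_norm_sum _ _ _) _.
  apply: le_trans (_ : \sum_(m < n.+2) `|g m| * (416 / V) <= _); last first.
    rewrite -mulr_suml (_ : 416 * G / V = G * (416 / V)); last by ring.
    exact: ler_wpM2r (divr_ge0 (ler0n _ _) (ltW V0)) _ _ (fG' _).
  apply: ler_sum => m _; rewrite ExZ normrM ler_wpM2l //.
  have := Ex_fdiff_point w_ge0 w_sum1 oD D_le D_small (fintype.subxx _) DV0 m.
  move/le_trans; apply.
  rewrite (_ : 416 / V = 4 * (26 / (V / 4))); last by field; rewrite gt_eqF.
  by rewrite !ler_pM2l // lef_pV2 ?posrE // divr_gt0.
rewrite stein_defectE unseen_split.
set a := E _ in A *; set b := E _ in B *.
set d := E (fun s => fdiff (fdiff f) (occ s)) in C1 *; set d' := E _ in C1 C2.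
have dle : `|d| <= 4 * G / (n.+1%:R * delta) + 416 * G / V.
  rewrite (_ : d = (d - d') + d'); last by ring.
  rewrite (le_trans (ler_normD _ _)) // lerD // (le_trans C1) //.
  by rewrite le_eqVlt; apply/orP; left; apply/eqP; ring.
have H1 : s2 * (r * `|d| + `|b|) <= 4 * V *
    (4 * G / (n.+1%:R * delta) + 416 * G / V + 2 * eta * G).
  apply: ler_pM => //; first by rewrite addr_ge0 // mulr_ge0.
  apply: lerD => //; apply: le_trans dle.
  by rewrite -[leRHS]mul1r ler_wpM2r.
have e1 : V / n.+1%:R <= 1 by rewrite ler_pdivrMr // mul1r.
have e3 : Num.sqrt V / Num.sqrt n.+1%:R <= 1 by rewrite ler_pdivrMr // mul1r.
have e4 : V / (Num.sqrt n.+1%:R * Num.sqrt V) = Num.sqrt V / Num.sqrt n.+1%:R.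
  by rewrite -{1}sV2; field; rewrite !gt_eqF.
have Veta : V * eta <= 2 * h + 44.
  rewrite /eta mulrDr (_ : V * (2 * h / n.+1%:R) = 2 * h * (V / n.+1%:R)); last by ring.
  rewrite (_ : V * (44 / _) = 44 * (V / (Num.sqrt n.+1%:R * Num.sqrt V))); last by ring.
  rewrite e4 lerD //; first by rewrite -[leRHS]mulr1 ler_wpM2l ?mulr_ge0.
  by rewrite -[leRHS]mulr1 ler_wpM2l.
have H2 : 4 * V *
    (4 * G / (n.+1%:R * delta) + 416 * G / V + 2 * eta * G) <=
    16 * G / delta + 1664 * G + 8 * (2 * h + 44) * G.
  rewrite (_ : _ * _ = 16 * G / delta * (V / n.+1%:R) + 1664 * G * (V / V) +
     8 * G * (V * eta)); last by rewrite invfM; ring.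
  rewrite divff ?gt_eqF // mulr1 lerD //.
    by rewrite lerD2r -[leRHS]mulr1 ler_wpM2l // divr_ge0 ?mulr_ge0 // ltW.
  by rewrite [leRHS]mulrAC ler_wpM2l ?mulr_ge0.
apply: le_trans (_ : s2 * (r * `|d| + `|b|) + `|a| <= _).
  apply: le_trans (ler_normB _ _) _; rewrite lerD2r normrM ger0_norm // ler_wpM2l //.
  by apply: le_trans (ler_normD _ _) _; rewrite lerD2r normrM ger0_norm.
apply: le_trans (lerD (le_trans H1 H2) A) _.
rewrite -subr_ge0 (_ : _ - _ = 684 * G); last by ring.
exact: mulr_ge0 (ler0n _ _) G0.
Qed.

End OccupancyStein.

(** When the variance is large, it is comparable with [V], which can then be
    eliminated from the bounds. *)
Theorem occupancy_stein_bound (R : realType) (N0 : nat) (delta : R) : 0 < delta ->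
  exists2 C : R, 0 < C & forall (J : finType) (w : J -> R) (o : J) (D : {set J}) (n : nat),
    (forall x, 0 <= w x) -> \sum_x w x = 1 -> o \notin D ->
    \sum_(j in D) w j <= w o -> \sum_(j in D) w j <= 8^-1 ->
    delta <= w o -> (#|~: D| <= N0)%N -> (0 < n)%N ->
    C <= kernel_mean w n -> forall f : nat -> R,
    (forall c, (forall k, `|fdiff f k| <= c) ->
       `|stein_defect w n f| <= C * c * Num.sqrt (kernel_mean w n)) /\
    (forall G, (forall M, \sum_(k < M) `|fdiff f k| <= G) ->
       `|stein_defect w n f| <= C * G).
Proof.
move=> d0; pose N : R := N0%:R; have N_ge0 : 0 <= N by [].
have id0 : 0 < delta^-1 by rewrite invr_gt0.
pose b := 16 / delta + 110.
pose C := 2 * (N + 3) * b + 22 * N + 3000 + 2 * N.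
have b0 : 0 <= b by rewrite /b; lra.
have C0 : 0 < C by rewrite /C; nra.
exists C => // J w o D n w0 w1 oD Dle D8 do_ DN n0 Cs f.
set h := (#|~: D|%:R : R); set s2 := kernel_mean w n in Cs *; set V := total_var w n.
have hN : h <= N by rewrite ler_nat.
have h0 : 0 <= h by [].
have bN : 0 <= (N + 3) * b by rewrite mulr_ge0 //; lra.
have s21 : 1 <= s2 by move: Cs; rewrite /C; lra.
have sV : s2 <= 2 * V + 2 := kernel_mean_le w0 w1 n0.
have Vs : V / 2 - 4 * h - 2 <= s2 := kernel_mean_ge w0 w1 n0 D8.
have hV : h + 1 <= V by move: Cs; rewrite /C; lra.
have s20 : 0 <= s2 by lra.
have sq0 : 0 < Num.sqrt s2 by rewrite sqrtr_gt0; lra.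
have sq1 : 1 <= Num.sqrt s2 by rewrite -sqrtr1 ler_wsqrtr.
split=> [c fc|G fG].
  have c0 : 0 <= c := le_trans (normr_ge0 _) (fc 0%N).
  apply: le_trans (stein_defect_smooth w0 w1 oD Dle D8 n0 d0 do_ hV s20 fc) _.
  have VC : Num.sqrt V <= 2 * (N + 3) * Num.sqrt s2.
    rewrite -(@ler_pXn2r _ 2) ?nnegrE ?sqrtr_ge0 //; last by rewrite mulr_ge0 ?sqrtr_ge0 //; lra.
    rewrite exprMn !sqr_sqrtr //; last by lra.
    have NN : 0 <= N * N by rewrite mulr_ge0.
    have : V <= 2 * (1 + (4 * N + 2)) * s2.
      have : N <= N * s2 by rewrite -[leLHS]mulr1 ler_wpM2l.
      by lra.
    move/le_trans; apply; rewrite ler_wpM2r //.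
    rewrite expr2; lra.
  apply: le_trans (_ : b * c * (2 * (N + 3) * Num.sqrt s2) <= _).
    by rewrite ler_wpM2l // mulr_ge0.
  rewrite (_ : b * c * _ = 2 * (N + 3) * b * c * Num.sqrt s2); last by ring.
  by rewrite ler_pM2r // ler_wpM2r // /C; lra.
have G0 : 0 <= G by have := fG 0%N; rewrite big_ord0.
apply: le_trans (stein_defect_local w0 w1 oD Dle D8 n0 d0 do_ hV s20 fG) _.
rewrite ler_wpM2r // -/h /C.
have : b <= (N + 3) * b by rewrite -[leLHS]mul1r ler_wpM2r //; lra.
rewrite {1}/b; lra.
Qed.

(** * Solutions of the Stein equation of the Poisson law *)

Section PoissonStein.
Context {R : realType} (lam : R) (lam_gt0 : 0 < lam).
Implicit Types (i j k w N M : nat).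

Local Notation pm := (poisson_pmf lam).

Lemma poisson_pmf_gt0 k : 0 < pm k.
Proof.
by rewrite /poisson_pmf lam_gt0 mulr_gt0 ?expR_gt0 // mulr_gt0 ?exprn_gt0.
Qed.

Lemma poisson_pmfS k : pm k.+1 * k.+1%:R = lam * pm k.
Proof.
have k1 : k.+1%:R != 0 :> R by rewrite pnatr_eq0.
rewrite /poisson_pmf lam_gt0 factS natrM exprS invfM.
rewrite (_ : _ * k.+1%:R = lam * (lam ^+ k * k`!%:R^-1 * expR (- lam)) *
  (k.+1%:R^-1 * k.+1%:R)); last by ring.
by rewrite mulVf // mulr1.
Qed.

Lemma poisson_log_concave i j : (i <= j)%N -> pm i * pm j.+1 <= pm i.+1 * pm j.
Proof.
move=> ij.
have i0 : 0 < i.+1%:R :> R by rewrite ltr0n.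
have j0 : 0 < j.+1%:R :> R by rewrite ltr0n.
have -> : pm i.+1 = lam * pm i / i.+1%:R by rewrite -poisson_pmfS mulfK ?gt_eqF.
have -> : pm j.+1 = lam * pm j / j.+1%:R by rewrite -poisson_pmfS mulfK ?gt_eqF.
rewrite (_ : pm i * (lam * pm j / j.+1%:R) = lam * pm i * pm j * j.+1%:R^-1); last by ring.
rewrite (_ : lam * pm i / i.+1%:R * pm j = lam * pm i * pm j * i.+1%:R^-1); last by ring.
rewrite ler_pM2l ?mulr_gt0 ?poisson_pmf_gt0 //.
by rewrite lef_pV2 ?posrE // ler_nat ltnS.
Qed.

Definition poisson_cdf N : R := \sum_(i < N) pm i.

Local Notation S := poisson_cdf.

Lemma poisson_cdfS N : S N.+1 = S N + pm N.
Proof. by rewrite /poisson_cdf big_ord_recr. Qed.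

Lemma poisson_cdf_ge0 N : 0 <= S N.
Proof. by apply: sumr_ge0 => i _; exact/ltW/poisson_pmf_gt0. Qed.

Lemma poisson_cdf_cvg : S @ \oo --> (1 : R).
Proof.
have -> : (1 : R) = expR (- lam) * expR lam by rewrite -expRD addNr expR0.
have -> : S = (fun N => expR (- lam) * series (exp_coeff lam) N).
  apply/funext => N; rewrite /series /= /poisson_cdf big_mkord mulr_sumr.
  by apply: eq_bigr => i _; rewrite /poisson_pmf lam_gt0 /exp_coeff /=; ring.
by apply: cvgM; [exact: cvg_cst | exact: is_cvg_series_exp_coeff].
Qed.

Lemma poisson_cdf_le1 N : S N <= 1.
Proof.
have nd : nondecreasing_seq S.
  apply/nondecreasing_seqP => k; rewrite poisson_cdfS lerDl.
  exact/ltW/poisson_pmf_gt0.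
rewrite -(cvg_lim (@Rhausdorff R) poisson_cdf_cvg).
apply: nondecreasing_cvgn_le => //.
by apply/cvg_ex; exists 1; exact: poisson_cdf_cvg.
Qed.

Lemma poisson_cdf_ratio w : S w.+1 * pm w.+1 <= S w.+2 * pm w.
Proof.
have -> : S w.+2 = pm 0%N + \sum_(i < w.+1) pm i.+1 by rewrite /poisson_cdf big_ord_recl.
rewrite mulrDl (le_trans (_ : _ <= (\sum_(i < w.+1) pm i.+1) * pm w)) //.
  rewrite /poisson_cdf !mulr_suml; apply: ler_sum => i _.
  by apply: poisson_log_concave; rewrite -ltnS.
by rewrite lerDr mulr_ge0 // ltW // poisson_pmf_gt0.
Qed.

(** For partial sums this is log-concavity term by term. The tail is reached in the
    limit. *)
Lemma poisson_tail_ratio w : (1 - S w.+2) * pm w <= (1 - S w.+1) * pm w.+1.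
Proof.
have fin N : (w <= N)%N -> (S N.+2 - S w.+2) * pm w <= (S N.+1 - S w.+1) * pm w.+1.
  elim: N => [|N IHN]; first by rewrite leqn0 => /eqP ->; rewrite !subrr !mul0r.
  rewrite leq_eqVlt => /orP[/eqP ->|]; first by rewrite !subrr !mul0r.
  rewrite ltnS => wN; have := IHN wN; have := poisson_log_concave (leqW wN).
  by rewrite (poisson_cdfS N.+2) (poisson_cdfS N.+1); lra.
have p0 := poisson_pmf_gt0 w; have p1 := poisson_pmf_gt0 w.+1.
rewrite -ler_pdivlMr // lerBlDr.
apply: (cvgr_to_le poisson_cdf_cvg); exists w.+2 => // -[//|[//|N]] /= wN.
rewrite -lerBlDr ler_pdivlMr //; apply: le_trans (fin _ _) _ => //.
by rewrite ler_pM2r // lerD2r poisson_cdf_le1.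
Qed.

(** The solution of the Stein equation of the Poisson law for the point mass
    at [k]. *)
Definition point_sol k w : R :=
  if w is v.+1 then ((k <= v)%N%:R - S v.+1) * pm k / (lam * pm v) else 0.

Lemma point_solP k w :
  lam * point_sol k w.+1 - w%:R * point_sol k w = (w == k)%:R - pm k.
Proof.
have pk := poisson_pmf_gt0 k; have pw := poisson_pmf_gt0 w.
case: w pw => [|w] pw; rewrite /point_sol.
  rewrite mul0r subr0 /poisson_cdf big_ord_recl big_ord0 addr0 leqn0 eq_sym.
  have [->|k0] := eqVneq k 0%N; first by field; rewrite !gt_eqF.
  by rewrite /=; field; rewrite !gt_eqF.
have pv := poisson_pmf_gt0 w.
have -> : w.+1%:R * (((k <= w)%N%:R - S w.+1) * pm k / (lam * pm w)) =
    ((k <= w)%N%:R - S w.+1) * pm k / pm w.+1.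
  have -> : w.+1%:R = lam * pm w / pm w.+1 :> R by rewrite -poisson_pmfS mulrAC mulfV ?mul1r ?gt_eqF.
  by field; rewrite !gt_eqF.
rewrite (poisson_cdfS w.+1) [(k <= w.+1)%N]leq_eqVlt ltnS [k == _]eq_sym.
have [e|wk] := eqVneq w.+1 k.
  by rewrite -e ltnn /=; field; rewrite !gt_eqF.
by rewrite /=; field; rewrite !gt_eqF.
Qed.

Lemma point_sol_le0 k w : (w <= k)%N -> point_sol k w <= 0.
Proof.
case: w => [//|w] wk; rewrite /point_sol leqNgt wk /= sub0r mulNr mulNr oppr_le0.
by rewrite divr_ge0 ?mulr_ge0 ?poisson_cdf_ge0 ?(ltW (poisson_pmf_gt0 _)) ?(ltW lam_gt0).
Qed.

Lemma point_sol_ge0 k w : (k < w)%N -> 0 <= point_sol k w.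
Proof.
case: w => [//|w]; rewrite ltnS => kw; rewrite /point_sol kw.
by rewrite divr_ge0 ?mulr_ge0 ?subr_ge0 ?poisson_cdf_le1 ?(ltW (poisson_pmf_gt0 _))
  ?(ltW lam_gt0).
Qed.

Lemma cdf_ratio_le w : S w.+1 / pm w <= S w.+2 / pm w.+1.
Proof.
rewrite ler_pdivrMr ?poisson_pmf_gt0 // mulrAC ler_pdivlMr ?poisson_pmf_gt0 //.
exact: poisson_cdf_ratio.
Qed.

(** Away from [k] the solution is proportional to [- S / pm] on the left and to
    [(1 - S) / pm] on the right, and both decrease by log-concavity. *)
Lemma point_sol_decr k w : w != k -> fdiff (point_sol k) w <= 0.
Proof.
have pk := poisson_pmf_gt0 k.
have q0 : 0 <= pm k / lam by rewrite divr_ge0 ?(ltW pk) ?(ltW lam_gt0).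
rewrite neq_ltn => /orP[wk|kw]; rewrite /fdiff.
  case: w wk => [|w] wk; first by rewrite subr0 point_sol_le0.
  rewrite /point_sol (leqNgt k w.+1) wk (leqNgt k w) (ltnW wk) /= !sub0r !invfM.
  by have := ler_wpM2l q0 (cdf_ratio_le w); lra.
case: w kw => [//|w] kw; rewrite /point_sol (ltnW kw) -ltnS kw /= !invfM.
have H : (1 - S w.+2) / pm w.+1 <= (1 - S w.+1) / pm w.
  rewrite ler_pdivrMr ?poisson_pmf_gt0 // mulrAC ler_pdivlMr ?poisson_pmf_gt0 //.
  exact: poisson_tail_ratio.
by have := ler_wpM2l q0 H; lra.
Qed.

Lemma point_sol_jump k : 0 <= fdiff (point_sol k) k <= lam^-1.
Proof.
have pk := poisson_pmf_gt0 k.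
rewrite /fdiff subr_ge0 (le_trans (point_sol_le0 (leqnn k))) ?point_sol_ge0 // andTb.
have -> : point_sol k k.+1 = (1 - S k.+1) / lam.
  by rewrite /point_sol leqnn /=; field; rewrite !gt_eqF.
case: k pk => [|k] pk.
  rewrite subr0 -[leRHS]mul1r ler_pM2r ?invr_gt0 // gerBl poisson_cdf_ge0 //.
have pv := poisson_pmf_gt0 k.
rewrite /point_sol ltnn sub0r.
have -> : - S k.+1 * pm k.+1 / (lam * pm k) = - (S k.+1 * pm k.+1 / pm k / lam).
  by field; rewrite !gt_eqF.
rewrite opprK -mulrDl -[leRHS]mul1r ler_pM2r ?invr_gt0 //.
have : S k.+1 * pm k.+1 / pm k <= S k.+2 by rewrite ler_pdivrMr // poisson_cdf_ratio.
lra.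
Qed.

(** Only the increment at [k] is positive, so the variation is twice this increment
    minus the final value of the solution, which is nonnegative. *)
Lemma point_sol_variation k M : \sum_(w < M) `|fdiff (point_sol k) w| <= 2 / lam.
Proof.
have /andP[j0 j1] := point_sol_jump k.
apply: le_trans (_ : \sum_(w < maxn M k.+1) `|fdiff (point_sol k) w| <= _).
  rewrite -!(big_mkord xpredT (fun w => `|fdiff (point_sol k) w|)).
  by rewrite (big_cat_nat (leq0n M) (leq_maxl M k.+1)) /= lerDl sumr_ge0.
set m := maxn M k.+1; have km : (k < m)%N by rewrite leq_maxr.
have -> : \sum_(w < m) `|fdiff (point_sol k) w| =
    2 * fdiff (point_sol k) k - \sum_(w < m) fdiff (point_sol k) w.
  rewrite (bigD1 (Ordinal km)) //= [\sum_(w < m) fdiff _ _](bigD1 (Ordinal km)) //=.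
  rewrite ger0_norm // (eq_bigr (fun w : 'I_m => - fdiff (point_sol k) w)).
    by rewrite sumrN; ring.
  by move=> w wk; rewrite ler0_norm // point_sol_decr // -[k]/(val (Ordinal km)) val_eqE.
have -> : \sum_(w < m) fdiff (point_sol k) w = point_sol k m.
  by rewrite -(big_mkord xpredT) telescope_sumr // subr0.
have : 0 <= point_sol k m by apply: point_sol_ge0.
lra.
Qed.

Definition set_sol (A : pred nat) N w : R := \sum_(k < N | A k) point_sol k w.

Lemma set_solP A N w : lam * set_sol A N w.+1 - w%:R * set_sol A N w =
  \sum_(k < N | A k) (w == k)%:R - \sum_(k < N | A k) pm k.
Proof.
rewrite /set_sol !mulr_sumr -!sumrB; apply: eq_bigr => k _.
exact: point_solP.
Qed.

(** Summed over all points below [N], the solution at [w] is [(1 - S N) / lam] times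
    the increasing ratio [S w / pm (w - 1)]. *)
Lemma full_sol_fdiff N w : (w < N)%N -> 0 <= \sum_(k < N) fdiff (point_sol k) w.
Proof.
move=> wN; rewrite sumrB.
have full v : (v < N)%N -> \sum_(k < N) point_sol k v.+1 =
    (1 - S N) / lam * (S v.+1 / pm v).
  move=> vN; have pv := poisson_pmf_gt0 v.
  have -> : \sum_(k < N) point_sol k v.+1 =
      (\sum_(k < N) (k <= v)%N%:R * pm k - S v.+1 * \sum_(k < N) pm k) / (lam * pm v).
    by rewrite mulr_sumr -sumrB mulr_suml; apply: eq_bigr => k _; rewrite /point_sol; ring.
  have -> : \sum_(k < N) (k <= v)%N%:R * pm k = S v.+1.
    rewrite /poisson_cdf (big_ord_widen _ (fun k => pm k) vN) [RHS]big_mkcond /=.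
    by apply: eq_bigr => k _; rewrite ltnS; case: leqP; rewrite ?mul1r ?mul0r.
  by rewrite -/(S N); field; rewrite !gt_eqF.
have q0 : 0 <= (1 - S N) / lam by rewrite divr_ge0 ?subr_ge0 ?poisson_cdf_le1 // ltW.
rewrite full //; case: w wN => [|w] wN.
  rewrite big1 ?subr0 // mulr_ge0 // divr_ge0 ?poisson_cdf_ge0 //.
  exact/ltW/poisson_pmf_gt0.
by rewrite full ?(ltnW wN) // -mulrBr mulr_ge0 // subr_ge0 cdf_ratio_le.
Qed.

(** At each place at most one of the point solutions increases, and the sum over
    all points is nondecreasing. *)
Lemma set_sol_fdiff A N w : `|fdiff (set_sol A N) w| <= lam^-1.
Proof.
have /andP[j0 j1] := point_sol_jump w.
have -> : fdiff (set_sol A N) w = \sum_(k < N | A k) fdiff (point_sol k) w.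
  by rewrite /fdiff /set_sol -sumrB.
set M := maxn N w.+1; have NM : (N <= M)%N by rewrite leq_maxl.
have wM : (w < M)%N by rewrite leq_maxr.
rewrite (big_ord_widen_cond M A (fun k => fdiff (point_sol k) w) NM).
have decr (k : 'I_M) : k != Ordinal wM -> fdiff (point_sol k) w <= 0.
  by move=> kw; apply: point_sol_decr; rewrite eq_sym -[w]/(val (Ordinal wM)) val_eqE.
rewrite ler_norml; apply/andP; split.
  have := full_sol_fdiff wM; rewrite (bigD1 (Ordinal wM)) //= => full.
  apply: le_trans (_ : \sum_(k < M | k != Ordinal wM) fdiff (point_sol k) w <= _); first by lra.
  rewrite [leLHS](bigID (fun k : 'I_M => A k && (k < N)%N)) /=.
  rewrite [leRHS](bigID (fun k : 'I_M => k != Ordinal wM)) /= addrC [leRHS]addrC.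
  apply: lerD.
    apply: le_trans (_ : 0 <= _).
      by apply: sumr_le0 => k /andP[kw _]; apply: decr.
    apply: sumr_ge0 => k /andP[_]; rewrite negbK => /eqP ->; exact: j0.
  by rewrite le_eqVlt; apply/orP; left; apply/eqP; apply: eq_bigl => k; rewrite andbC.
rewrite (bigID (fun k : 'I_M => k == Ordinal wM)) /= -[leRHS]addr0.
apply: lerD; last by apply: sumr_le0 => k /andP[_ kw]; apply: decr.
have [aw|aw] := boolP (A w && (w < N)%N).
  rewrite (big_pred1 (Ordinal wM)) //= => k /=.
  by case: eqP => [->|_]; rewrite ?aw ?andbF.
rewrite big_pred0 ?invr_ge0 ?ltW // => k.
by case: eqP => [->|_]; rewrite ?(negPf aw) ?andbF.
Qed.

End PoissonStein.

(** * Comparison of a law with a translated Poisson law *)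

Section TranslatedComparison.
Context {R : realType}.
Implicit Types (f F h : nat -> R) (a : int) (k v w : nat).

(** Extension by 0 is harmless for the solutions of the Stein equation, which
    vanish at 0, so that differences commute with the translation. *)
Definition translate a f w : R := if w%:Z - a is Posz v then f v else 0.

Lemma translate_cases a w :
  (exists v, [/\ w%:Z - a = v%:Z, w.+1%:Z - a = v.+1%:Z, w%:Z = a + v%:Z &
     (w%:Z < a) = false]) \/
  ([/\ w%:Z - a = Negz 0, w.+1%:Z - a = 0%N%:Z & (w%:Z < a) = true]) \/
  (exists m, [/\ w%:Z - a = Negz m.+1, w.+1%:Z - a = Negz m & (w%:Z < a) = true]).
Proof.
have e : w.+1%:Z - a = (w%:Z - a) + 1 by lia.
case d : (w%:Z - a) => [v|[|m]].
- by left; exists v; split; lia.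
- by right; left; split; rewrite ?e ?d //; lia.
- by right; right; exists m; split; rewrite ?e ?d //; lia.
Qed.

Lemma fdiff_translate a f w : f 0%N = 0 ->
  fdiff (translate a f) w = translate a (fdiff f) w.
Proof.
move=> f0; rewrite /fdiff /translate.
case: (translate_cases a w) => [[v [-> -> _ _]]//|[[-> -> _]|[m [-> -> _]]]].
  by rewrite f0 subrr.
by rewrite subrr.
Qed.

Lemma translate_bounded a f (c : R) : 0 <= c -> (forall v, `|f v| <= c) ->
  forall w, `|translate a f w| <= c.
Proof. by move=> c0 fc w; rewrite /translate; case: (_ - _) => // m; rewrite normr0. Qed.

Lemma translate_sum a f (G : R) : (forall M, \sum_(v < M) `|f v| <= G) ->
  forall M, \sum_(w < M) `|translate a f w| <= G.
Proof.
move=> fG M; have G0 : 0 <= G by have := fG 0%N; rewrite big_ord0.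
case: a => [b|b].
  apply: le_trans (fG (M - b)%N).
  elim: M => [|M IHM]; first by rewrite big_ord0 sumr_ge0.
  rewrite big_ord_recr /=; have [Mb|bM] := ltnP M b.
    rewrite /translate (_ : M%:Z - b%:Z = Negz (b - M.+1)); last by lia.
    rewrite normr0 addr0 (le_trans IHM) // (_ : (M.+1 - b = 0)%N); last by lia.
    by rewrite (_ : (M - b = 0)%N) //; lia.
  rewrite subSn // big_ord_recr /= lerD //.
  by rewrite /translate (_ : M%:Z - b%:Z = (M - b)%:Z) //; lia.
apply: le_trans (fG (M + b.+1)%N).
elim: M => [|M IHM]; first by rewrite big_ord0 sumr_ge0.
by rewrite addSn !big_ord_recr /= lerD.
Qed.

Section Law.
Context (n : nat) (pi : nat -> R) (mu s2 lam : R) (a : int).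
Context (pi_ge0 : forall k, 0 <= pi k) (pi_sum : \sum_(k < n.+1) pi k = 1).
Context (pi_var : \sum_(k < n.+1) pi k * (k%:R - mu) ^+ 2 = s2).
Context (s2_gt0 : 0 < s2) (lam_mu : a%:~R + lam = mu) (s2_le : s2 <= lam) (le_s2 : lam < s2 + 1).

Definition law_defect F : R :=
  \sum_(k < n.+1) pi k * (s2 * fdiff F k - (k%:R - mu) * F k).

Let lam_gt0 : 0 < lam. Proof. exact: lt_le_trans s2_le. Qed.

Definition below k : bool := k%:Z < a.

(** Chebyshev's inequality: the translated Poisson law starts at [a], which lies
    [lam >= s2] below the mean. *)
Lemma below_prob : \sum_(k < n.+1 | below k) pi k <= lam^-1.
Proof.
rewrite -[leRHS]mul1r ler_pdivlMr //.
rewrite -(@ler_pM2r _ lam) // mul1r.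
apply: le_trans s2_le; rewrite -[leRHS]pi_var.
rewrite -mulrA mulr_suml big_mkcond /=; apply: ler_sum => k _.
case: ifP => [ka|_]; last by rewrite mulr_ge0 ?sqr_ge0.
rewrite ler_wpM2l // -expr2.
have : (k%:Z)%:~R <= a%:~R :> R by rewrite ler_int ltW.
rewrite -pmulrn => kaR.
rewrite (_ : (k%:R - mu) ^+ 2 = (mu - k%:R) ^+ 2); last by ring.
have lk : lam <= mu - k%:R by rewrite -lam_mu addrAC lerDr subr_ge0.
by rewrite lerXn2r ?nnegrE // ?(ltW lam_gt0) // (le_trans _ lk) // ltW.
Qed.

(** At [k >= a] the Stein equation at [k - a] turns the defect into
    [translate a h - H]; at [k < a] both sides vanish but for the constant [H]. *)
Lemma stein_compare f h (H B : R) : f 0%N = 0 ->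
  (forall v, lam * f v.+1 - v%:R * f v = h v - H) -> 0 <= H <= 1 ->
  (forall v, `|fdiff f v| <= lam^-1) ->
  `|law_defect (translate a f)| <= B ->
  `|\sum_(k < n.+1) pi k * translate a h k - H| <= B + 2 / lam.
Proof.
move=> f0 fh /andP[H0 H1] fl FB.
have l0 : 0 <= lam^-1 by rewrite invr_ge0 ltW.
set p := \sum_(k < n.+1 | below k) pi k.
have pl : p <= lam^-1 := below_prob.
have p0 : 0 <= p by apply: sumr_ge0.
have key : law_defect (translate a f) + (lam - s2) * \sum_(k < n.+1) pi k * fdiff (translate a f) k =
    \sum_(k < n.+1) pi k * translate a h k - H * (1 - p).
  have -> : 1 - p = \sum_(k < n.+1 | ~~ below k) pi k.
    by rewrite -pi_sum (bigID (fun k : 'I_n.+1 => below k)) /= -/p addrAC subrr add0r.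
  rewrite /law_defect mulr_sumr -big_split /= mulr_sumr.
  rewrite [X in _ = _ - X]big_mkcond -sumrB /=; apply: eq_bigr => k _.
  rewrite fdiff_translate // /translate /below.
  case: (translate_cases a k) => [[v [e _ ka ->]]|[[e _ ->]|[m [e _ ->]]]]; rewrite e.
  - have kmu : k%:R - mu = v%:R - lam.
      have : (k%:Z)%:~R = (a + v%:Z)%:~R :> R by rewrite ka.
      by rewrite intrD -!pmulrn => ->; rewrite -lam_mu; ring.
    by rewrite /= kmu /fdiff (mulrC H) -mulrBr -fh; ring.
  - by rewrite /=; ring.
  - by rewrite /=; ring.
have dl : `|\sum_(k < n.+1) pi k * fdiff (translate a f) k| <= lam^-1.
  rewrite -[leRHS]mul1r -pi_sum mulr_suml; apply: le_trans (ler_norm_sum _ _ _) _.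
  apply: ler_sum => k _; rewrite normrM ger0_norm // ler_wpM2l //.
  by rewrite fdiff_translate // translate_bounded.
have d1 : `|lam - s2| <= 1 by rewrite ger0_norm ?subr_ge0 // lerBlDl ltW.
have -> : \sum_(k < n.+1) pi k * translate a h k - H =
    law_defect (translate a f) + (lam - s2) * \sum_(k < n.+1) pi k * fdiff (translate a f) k - H * p.
  by rewrite key; ring.
rewrite (_ : B + 2 / lam = B + lam^-1 + lam^-1); last by ring.
apply: le_trans (ler_normB _ _) _; apply: lerD.
  apply: le_trans (ler_normD _ _) _; apply: lerD => //.
  by rewrite normrM -[leRHS]mul1r ler_pM.
by rewrite ger0_norm ?mulr_ge0 // -[leRHS]mul1r ler_pM.
Qed.

Context (C : R) (C_ge0 : 0 <= C).
Context (smooth : forall F c, (forall k, `|fdiff F k| <= c) ->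
  `|law_defect F| <= C * c * Num.sqrt s2).
Context (local : forall F G, (forall M, \sum_(k < M) `|fdiff F k| <= G) ->
  `|law_defect F| <= C * G).

Let l_le : lam^-1 <= s2^-1. Proof. by rewrite lef_pV2 ?posrE. Qed.

(** One inequality suffices for the total variation distance, since it also applies
    to the complement of [A]. The window of [N] points above [a] covers the range of
    the law. *)
Lemma law_le_translated (A : pred int) N :
  (forall k, (k <= n)%N -> k%:Z - a < N%:Z) ->
  \sum_(k < n.+1 | A k%:Z) pi k - \sum_(z < N | A (a + z%:Z)) poisson_pmf lam z <=
    C / Num.sqrt s2 + 3 / s2.
Proof.
move=> kN; pose B (z : nat) := A (a + z%:Z).
have sq : 0 < Num.sqrt s2 by rewrite sqrtr_gt0.
have sq2 : Num.sqrt s2 ^+ 2 = s2 by rewrite sqr_sqrtr // ltW.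
set H := \sum_(z < N | _) _.
have H01 : 0 <= H <= 1.
  apply/andP; split; first by apply: sumr_ge0 => z _; exact/ltW/poisson_pmf_gt0.
  apply: le_trans (poisson_cdf_le1 lam_gt0 N).
  rewrite /H /poisson_cdf [leRHS](bigID (fun z : 'I_N => A (a + z%:Z))) /= lerDl.
  by apply: sumr_ge0 => z _; exact/ltW/poisson_pmf_gt0.
have defect : `|law_defect (translate a (set_sol lam B N))| <= C / Num.sqrt s2.
  apply: le_trans (smooth (c := lam^-1) _) _.
    move=> k; rewrite fdiff_translate; last by rewrite /set_sol big1.
    apply: translate_bounded; first by rewrite invr_ge0 ltW.
    by move=> v; exact: set_sol_fdiff.
  apply: le_trans (_ : C * s2^-1 * Num.sqrt s2 <= _).
    by rewrite ler_wpM2r ?sqrtr_ge0 // ler_wpM2l.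
  by rewrite -{1}sq2 le_eqVlt; apply/orP; left; apply/eqP; field; rewrite gt_eqF.
have main : \sum_(k < n.+1) pi k *
    translate a (fun v => \sum_(k < N | B k) (v == k)%:R) k - H <= C / Num.sqrt s2 + 2 / lam.
  apply: le_trans (ler_norm _) _.
  apply: (stein_compare (f := set_sol lam B N)) => //.
  - by rewrite /set_sol big1.
  - by move=> v; exact: set_solP.
  - by move=> v; exact: set_sol_fdiff.
have split_below : \sum_(k < n.+1 | A k%:Z) pi k <=
    \sum_(k < n.+1) pi k * translate a (fun v => \sum_(k < N | B k) (v == k)%:R) k +
    \sum_(k < n.+1 | below k) pi k.
  rewrite [leLHS]big_mkcond [X in _ <= _ + X]big_mkcond -big_split /=.
  apply: ler_sum => k _; rewrite /translate /below.
  case: (translate_cases a k) => [[v [e _ ka ->]]|[[e _ ->]|[m [e _ ->]]]]; rewrite e.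
  - have vN : (v < N)%N by have := kN k (ltnSE (ltn_ord k)); rewrite e ltz_nat.
    rewrite addr0; case: ifP => Ak; last by rewrite mulr_ge0 // sumr_ge0.
    rewrite (bigD1 (Ordinal vN)) /= ?eqxx; last by rewrite /B /= -ka.
    by rewrite -[leLHS]mulr1 ler_wpM2l // lerDl sumr_ge0.
  - by rewrite mulr0 add0r; case: ifP.
  - by rewrite mulr0 add0r; case: ifP.
have := below_prob; clear lam_mu; move: main split_below l_le; rewrite -/H.
set x := \sum_(k < n.+1 | A _) _; set y := \sum_(k < n.+1) _; set p := \sum_(k < n.+1 | below k) _.
lra.
Qed.

Lemma law_point_below k : (k <= n)%N -> k%:Z < a -> pi k <= s2^-1.
Proof.
rewrite -ltnS => kn ka; apply: le_trans l_le; apply: le_trans below_prob.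
by rewrite (bigD1 (Ordinal kn)) /= ?lerDl ?sumr_ge0 // /below ltz_nat.
Qed.

(** The point solution has increments at most [1 / lam] with total at most
    [2 / lam]. *)
Lemma law_point_above v :
  `|\sum_(k < n.+1 | k%:Z == a + v%:Z) pi k - poisson_pmf lam v| <= (2 * C + 2) / s2.
Proof.
have H01 : 0 <= poisson_pmf lam v <= 1.
  rewrite (ltW (poisson_pmf_gt0 lam_gt0 v)) /=.
  apply: le_trans (poisson_cdf_le1 lam_gt0 v.+1).
  by rewrite poisson_cdfS lerDr poisson_cdf_ge0.
have <- : \sum_(k < n.+1) pi k * translate a (fun w => (w == v)%:R) k =
    \sum_(k < n.+1 | k%:Z == a + v%:Z) pi k.
  rewrite [RHS]big_mkcond; apply: eq_bigr => k _; rewrite /translate.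
  case d : (k%:Z - a) => [w|m]; last by rewrite mulr0; case: eqP => // e; lia.
  have -> : (k%:Z == a + v%:Z) = (w == v) by apply/eqP/eqP; lia.
  by case: eqP; rewrite ?mulr1 ?mulr0.
have e : (2 * C + 2) / s2 = C * (2 / s2) + 2 / s2 by ring.
rewrite e; apply: le_trans (_ : C * (2 / s2) + 2 / lam <= _); last by rewrite lerD2l ler_pM2l.
apply: (stein_compare (f := point_sol lam v)) => //.
- by move=> w; exact: point_solP.
- move=> w; have /andP[j0 j1] := point_sol_jump lam_gt0 w.
  have := set_sol_fdiff lam_gt0 (pred1 v) v.+1 w.
  congr (_ <= _); congr `|_|; rewrite /fdiff /set_sol.
  by rewrite !(big_pred1 (Ordinal (ltnSn v))).
- apply: local => M; rewrite (eq_bigr (fun k : 'I_M => `|translate a (fdiff (point_sol lam v)) k|)).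
    apply: translate_sum => M'; apply: le_trans (point_sol_variation lam_gt0 v M') _.
    by rewrite ler_pM2l.
  by move=> k _; rewrite fdiff_translate.
Qed.

End Law.

End TranslatedComparison.

(** * The law of the number of occupied boxes and its truncations *)

Section DiscreteLaws.
Context d (T : measurableType d) (R : realType) (P : probability T R).

Lemma measure_fibres (S : finType) (Y : T -> S) (A : pred S) :
  (forall s, measurable (Y @^-1` [set s])) ->
  P (Y @^-1` [set s | A s]) = (\sum_(s | A s) P (Y @^-1` [set s]))%E.
Proof.
move=> mY.
have -> : Y @^-1` [set s | A s] = \bigcup_(s in [set s | A s]) (Y @^-1` [set s]).
  by apply/seteqP; split=> [t At|t [s As /= e]]; [by exists (Y t) | by rewrite /= e].
have finA : finite_set [set s | A s] by exact: finite_finset.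
rewrite measure_fin_bigcup //; last by move=> s1 s2 _ _ [t [/= e1 e2]]; rewrite -e1 -e2.
rewrite fsbig_finite // (perm_big (enum A)) /=; first by rewrite big_enum.
apply: uniq_perm; [exact: finmap.fset_uniq | exact: enum_uniq | move=> s].
by rewrite in_fset_set // mem_enum; apply/idP/idP => [/set_mem|/mem_set].
Qed.

Lemma integral_finite_valued (Y : T -> nat) n (g : nat -> R) :
  (forall t, (Y t <= n)%N) -> (forall k, measurable (Y @^-1` [set k])) ->
  (forall k, 0 <= g k) ->
  (\int[P]_t (g (Y t))%:E = \sum_(k < n.+1) (g k)%:E * P (Y @^-1` [set (k : nat)]))%E.
Proof.
move=> Yn mY g0.
transitivity (\int[P]_t (\sum_(k < n.+1) (g k)%:E * (\1_(Y @^-1` [set (k : nat)]) t)%:E)%E)%E.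
  apply: eq_integral => t _; have tn : (Y t < n.+1)%N by rewrite ltnS.
  rewrite (bigD1 (Ordinal tn)) //= indicE mem_set //= mule1 big1 ?adde0 // => k kt.
  rewrite indicE memNset ?mule0 //= => e; move/eqP: kt; apply.
  by apply/val_inj; rewrite /= e.
have mi (k : nat) : measurable_fun setT (EFin \o (\1_(Y @^-1` [set k]) : T -> R)).
  by apply/measurable_EFinP; exact: measurable_indic.
rewrite ge0_integral_sum //; first last.
- by move=> k t _; rewrite mule_ge0 // lee_fin // indicE.
- by move=> k; apply: emeasurable_funM; [exact: measurable_cst | exact: mi].
apply: eq_bigr => k _; rewrite ge0_integralZl // ?integral_indic ?setIT ?lee_fin //.
exact: mi.
Qed.

End DiscreteLaws.

Section TupleExpectation.
Context {R : realType} {J : finType} (w : J -> R).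

Lemma Ex_tuple n (F : seq J -> R) :
  Ex w n F = \sum_(s : n.-tuple J) (\prod_(i < n) w (tnth s i)) * F s.
Proof.
elim: n F => [|n IHn] F.
  rewrite /= (big_pred1 [tuple]) => [|s]; last by apply/esym/eqP; exact: tuple0.
  by rewrite big_ord0 mul1r.
rewrite /= (reindex (fun u : J * n.-tuple J => [tuple of u.1 :: u.2])) /=; last first.
  exists (fun s : n.+1.-tuple J => (thead s, [tuple of behead s])) => [[x s]|s] _ /=.
    by rewrite theadE; congr (_, _); apply/val_inj.
  by rewrite -tuple_eta.
rewrite -(pair_big xpredT xpredT (fun x (s : n.-tuple J) =>
  (\prod_(i < n.+1) w (tnth [tuple of x :: s] i)) * F (x :: s))) /=.
apply: eq_bigr => x _; rewrite IHn mulr_sumr; apply: eq_bigr => s _.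
rewrite big_ord_recl mulrA; congr (_ * _ * _).
by apply: eq_bigr => i _; rewrite tnthS.
Qed.

End TupleExpectation.

Lemma size_undup_map (T1 T2 : eqType) (f : T1 -> T2) (s : seq T1) :
  {in s &, injective f} -> size (undup [seq f x | x <- s]) = size (undup s).
Proof.
move=> fi; rewrite -(size_map f (undup s)); apply/perm_size/uniq_perm.
- exact: undup_uniq.
- by rewrite map_inj_in_uniq ?undup_uniq // => x y; rewrite !mem_undup; exact: fi.
by move=> y; rewrite mem_undup; apply/mapP/mapP => -[x xs ->]; exists x; rewrite ?mem_undup // -mem_undup.
Qed.

Section OccupancyLaw.
Context d (T : measurableType d) (R : realType) (P : probability T R).
Context (p : nat -> R) (n : nat) (X : 'I_n -> {RV P >-> nat}).
Context (schemeX : occupancy_scheme p X).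

Lemma measurable_ball i (B : set nat) : measurable (X i @^-1` B).
Proof. by rewrite -[_ @^-1` _]setTI; exact: measurable_funPT. Qed.

Definition balls t : seq nat := [seq X i t | i <- enum 'I_n].

Lemma occupied_undup t : occupied X t = size (undup [seq x <- balls t | (0 < x)%N]).
Proof.
rewrite -card_fseq /occupied.
have -> : [set j | (1 <= j)%N /\ (1 <= box_count X j t)%N] =
    [set` [fset x in [seq x <- balls t | (0 < x)%N]]%fset].
  apply/seteqP; split=> j /=.
    move=> [j1 /card_gt0P[i]]; rewrite !inE => /eqP Xj.
    by rewrite mem_filter j1 /=; apply/mapP; exists i; rewrite ?mem_enum.
  rewrite !inE mem_filter => /andP[j1 /mapP[i _ ji]]; split=> //.
  by apply/card_gt0P; exists i; rewrite inE ji.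
by rewrite set_fsetK.
Qed.

Lemma occupied_le t : (occupied X t <= n)%N.
Proof.
rewrite occupied_undup (leq_trans (size_undup _)) // size_filter.
by rewrite (leq_trans (count_size _ _)) // size_map size_enum_ord.
Qed.

Lemma measurable_occupied k : measurable (occupied X @^-1` [set k]).
Proof.
rewrite (_ : _ @^-1` _ = occupied_int X @^-1` [set k%:Z]).
  by rewrite -[_ @^-1` _]setTI; exact: measurable_occupied_int.
by apply/seteqP; split=> t; rewrite /occupied_int /=; [move=> -> | case].
Qed.

Definition occ_law k : R := fine (P (occupied X @^-1` [set k])).

Lemma occ_lawE k : P (occupied X @^-1` [set k]) = (occ_law k)%:E.
Proof. by rewrite /occ_law fineK // fin_num_measure //; exact: measurable_occupied. Qed.

Lemma occ_law_ge0 k : 0 <= occ_law k.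
Proof. by rewrite fine_ge0. Qed.

Lemma occupied_law_sum (A : set int) :
  occupied_law X A = (\sum_(k < n.+1 | `[< A k%:Z >]) occ_law k)%:E.
Proof.
pose Y t : 'I_n.+1 := inord (occupied X t).
have YE t : Y t = occupied X t :> nat by rewrite inordK // ltnS occupied_le.
have fibE (k : 'I_n.+1) : Y @^-1` [set k] = occupied X @^-1` [set (k : nat)].
  by apply/seteqP; split=> t /= => [<-|e]; [rewrite YE | apply/val_inj; rewrite /= YE].
rewrite -[LHS]/(P (occupied_int X @^-1` A)).
rewrite (_ : occupied_int X @^-1` A = Y @^-1` [set k | `[< A (k : nat)%:Z >]]); last first.
  apply/seteqP; split=> t /=; rewrite YE => At; first exact/asboolP.
  by move/asboolP: At.
rewrite measure_fibres => [|k]; last by rewrite fibE; exact: measurable_occupied.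
by rewrite -sumEFin; apply: eq_bigr => k _; rewrite fibE occ_lawE.
Qed.

Lemma occ_law_sum1 : \sum_(k < n.+1) occ_law k = 1.
Proof.
apply: EFin_inj; have := occupied_law_sum setT.
rewrite probability_setT => ->; congr EFin; apply: eq_bigl => k.
by symmetry; apply/asboolP.
Qed.

Lemma Ex_occupied (g : nat -> R) : (forall k, 0 <= g k) ->
  (\int[P]_t (g (occupied X t))%:E = (\sum_(k < n.+1) occ_law k * g k)%:E)%E.
Proof.
move=> g0; rewrite (integral_finite_valued P occupied_le measurable_occupied g0).
by rewrite -sumEFin; apply: eq_bigr => k _; rewrite occ_lawE EFinM muleC.
Qed.

Lemma occupied_meanE : occupied_mean X = \sum_(k < n.+1) occ_law k * k%:R.
Proof. by rewrite /occupied_mean unlock (Ex_occupied (g := fun k => k%:R)). Qed.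

Lemma occupied_varE : occupied_var X =
  \sum_(k < n.+1) occ_law k * (k%:R - occupied_mean X) ^+ 2.
Proof.
rewrite /occupied_var /variance covariance.unlock -/(occupied_mean X) expectation.unlock.
have := Ex_occupied (g := fun k => (k%:R - occupied_mean X) ^+ 2) (fun k => sqr_ge0 _).
by move=> /(congr1 fine) /= <-.
Qed.

Section Truncation.
Context (m : nat).

(** Box 0 of the truncated scheme collects every box beyond the [m]-th, and the
    number 0, which no box carries. *)
Definition trunc (j : nat) : 'I_m.+1 := if (0 < j <= m)%N then inord j else ord0.

Definition trunc_weight (x : 'I_m.+1) : R :=
  if x == ord0 then 1 - \sum_(j < m) p j.+1 else p x.

Lemma truncK j : trunc j != ord0 -> trunc j = j :> nat.
Proof.
by rewrite /trunc; case: ifP => [/andP[_ jm] _|_]; rewrite ?eqxx // inordK.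
Qed.

Lemma trunc_eq (x : 'I_m.+1) : x != ord0 -> trunc @^-1` [set x] = [set (x : nat)].
Proof.
move=> x0; apply/seteqP; split=> j /= e.
  by rewrite -e truncK // e.
have xm : (x <= m)%N by rewrite -ltnS.
by rewrite e /trunc lt0n -(inj_eq val_inj) /= in x0 *; rewrite x0 xm; apply/val_inj; rewrite /= inordK.
Qed.

Lemma trunc_weight_law i (x : 'I_m.+1) :
  P (X i @^-1` (trunc @^-1` [set x])) = (trunc_weight x)%:E.
Proof.
have [_ marg] := schemeX.
have nz (y : 'I_m.+1) : y != ord0 -> P (X i @^-1` (trunc @^-1` [set y])) = (p y)%:E.
  by move=> y0; rewrite trunc_eq // marg // lt0n.
rewrite /trunc_weight; case: eqVneq => [->|]; last exact: nz.
have := @measure_fibres _ _ _ P 'I_m.+1 (trunc \o X i) xpredT.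
rewrite (_ : _ @^-1` _ = setT); last by apply/seteqP; split.
rewrite probability_setT big_ord_recl => /(_ (fun s => measurable_ball i (trunc @^-1` [set s]))).
rewrite (eq_bigr (fun j : 'I_m => (p j.+1)%:E)) => [|j _]; last exact: nz.
rewrite sumEFin EFinB => e.
by rewrite e addeK.
Qed.

Lemma trunc_weight_ge0 (n_gt0 : (0 < n)%N) x : 0 <= trunc_weight x.
Proof. by rewrite -lee_fin -(trunc_weight_law (Ordinal n_gt0)). Qed.

Lemma trunc_weight_sum1 : \sum_x trunc_weight x = 1.
Proof.
rewrite big_ord_recl {1}/trunc_weight eqxx.
by rewrite (eq_bigr (fun j : 'I_m => p j.+1)) ?subrK // => j _; rewrite /trunc_weight.
Qed.

Definition trunc_balls t : n.-tuple 'I_m.+1 := [tuple trunc (X i t) | i < n].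

Lemma trunc_ballsE t : trunc_balls t = [seq trunc x | x <- balls t] :> seq _.
Proof. by rewrite /balls -map_comp. Qed.

Lemma trunc_balls_fibre (s : n.-tuple 'I_m.+1) :
  trunc_balls @^-1` [set s] =
  \bigcap_(i in [set: 'I_n]) (X i @^-1` (trunc @^-1` [set tnth s i])).
Proof.
apply/seteqP; split=> t /= e.
  by move=> i _ /=; rewrite -e tnth_mktuple.
by apply: eq_from_tnth => i; rewrite tnth_mktuple; exact: (e i I).
Qed.

Lemma measurable_trunc_balls s : measurable (trunc_balls @^-1` [set s]).
Proof.
rewrite trunc_balls_fibre; apply: fin_bigcap_measurable => [|i _].
  exact: finite_finset.
exact: measurable_ball.
Qed.

Lemma trunc_balls_law s :
  P (trunc_balls @^-1` [set s]) = (\prod_(i < n) trunc_weight (tnth s i))%:E.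
Proof.
have [indep _] := schemeX.
rewrite trunc_balls_fibre (indep (fun i => trunc @^-1` [set tnth s i])) //.
by rewrite -prodEFin; apply: eq_bigr => i _; rewrite trunc_weight_law.
Qed.

Lemma trunc_event (A : pred (seq 'I_m.+1)) :
  P (trunc_balls @^-1` [set s | A s]) = (Ex trunc_weight n (fun s => (A s)%:R))%:E.
Proof.
rewrite (measure_fibres P (fun s : n.-tuple 'I_m.+1 => A s) measurable_trunc_balls).
rewrite (eq_bigr _ (fun s _ => trunc_balls_law s)) sumEFin; congr EFin.
rewrite Ex_tuple big_mkcond /=; apply: eq_bigr => s _.
by case: ifP; rewrite ?mulr1 ?mulr0.
Qed.

Lemma measurable_trunc_event (A : pred (seq 'I_m.+1)) :
  measurable (trunc_balls @^-1` [set s | A s]).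
Proof.
rewrite (_ : _ @^-1` _ = \bigcup_(s in [set s : n.-tuple 'I_m.+1 | A s]) (trunc_balls @^-1` [set s])).
  by apply: fin_bigcup_measurable => [|s _]; [exact: finite_finset | exact: measurable_trunc_balls].
by apply/seteqP; split=> [t At|t [s As e]]; [exists (trunc_balls t) | move: As; rewrite -e].
Qed.

Definition trunc_law k : R := Ex trunc_weight n (fun s => (occ s == k)%:R).

Lemma occupied_trunc t : (forall i, trunc (X i t) != ord0) ->
  occ (trunc_balls t) = occupied X t.
Proof.
move=> nz; rewrite occupied_undup trunc_ballsE /occ.
have bnz x : x \in balls t -> trunc x != ord0 by move=> /mapP[i _ ->].
have -> : [seq x <- balls t | (0 < x)%N] = balls t.
  apply/all_filterP/allP => x /bnz tx; rewrite -(truncK tx).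
  by rewrite lt0n -[0%N]/(val (@ord0 m)) (inj_eq val_inj).
apply: size_undup_map => x y /bnz tx /bnz ty e.
by rewrite -(truncK tx) -(truncK ty) e.
Qed.

Lemma lost_ballsP t : ord0 \notin trunc_balls t -> occ (trunc_balls t) = occupied X t.
Proof.
move=> nl; apply: occupied_trunc => i; apply: contraNneq nl => e.
by apply/tnthP; exists i; rewrite tnth_mktuple e.
Qed.

(** Only a ball that falls outside the boxes [1 .. m] distinguishes the truncated
    scheme from the original one. *)
Lemma trunc_law_close (n_gt0 : (0 < n)%N) k :
  `|occ_law k - trunc_law k| <= n%:R * trunc_weight ord0.
Proof.
pose A := occupied X @^-1` [set k].
pose B := trunc_balls @^-1` [set s : n.-tuple 'I_m.+1 | occ s == k].
pose L := trunc_balls @^-1` [set s : n.-tuple 'I_m.+1 | ord0 \in (s : seq _)].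
have w_ge0 := trunc_weight_ge0 n_gt0.
have mA : measurable A := measurable_occupied k.
have mB : measurable B := measurable_trunc_event (fun s => occ s == k).
have mL : measurable L := measurable_trunc_event (fun s => ord0 \in s).
have PL : (P L <= (n%:R * trunc_weight ord0)%:E)%E.
  rewrite (trunc_event (fun s => ord0 \in s)) lee_fin.
  rewrite (eq_Ex _ (G := fun s => 1 - (ord0 \notin s)%:R)); last first.
    by move=> s _; case: (ord0 \in s); rewrite /= ?subr0 ?subrr.
  rewrite ExB (Ex_cst trunc_weight_sum1) (Ex_miss trunc_weight_sum1).
  exact/hit_le/(weight01 w_ge0 trunc_weight_sum1).
have PA : P A = (occ_law k)%:E := occ_lawE k.
have PB : P B = (trunc_law k)%:E := trunc_event (fun s => occ s == k).
have AB : A `<=` B `|` L.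
  move=> t At; case: (boolP (ord0 \in (trunc_balls t : seq _))) => lt; [by right | left].
  by apply/eqP; rewrite lost_ballsP.
have BA : B `<=` A `|` L.
  move=> t /eqP Bt; case: (boolP (ord0 \in (trunc_balls t : seq _))) => lt; [by right | left].
  by rewrite /A /= -lost_ballsP.
have sub (C D : set T) : measurable C -> measurable D -> C `<=` D `|` L ->
    (P C <= P D + P L)%E.
  move=> mC mD CD; apply: le_trans (measureU2 P mD mL).
  by apply: le_measure CD; apply/mem_set => //; exact: measurableU.
rewrite ler_distlC; apply/andP; split.
  rewrite lerBlDr -lee_fin EFinD -PA -PB.
  by apply: le_trans (sub _ _ mA mB AB) _; rewrite leeD2l.
rewrite -lee_fin EFinD -PA -PB.
by apply: le_trans (sub _ _ mB mA BA) _; rewrite leeD2l.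
Qed.

Lemma occ_law_ge (s : n.-tuple 'I_m.+1) : ord0 \notin (s : seq _) ->
  \prod_(i < n) trunc_weight (tnth s i) <= occ_law (occ s).
Proof.
move=> s0; rewrite -lee_fin -trunc_balls_law -occ_lawE.
apply: le_measure; [apply/mem_set; exact: measurable_trunc_balls |
  apply/mem_set; exact: measurable_occupied |].
by move=> t /= e; rewrite -lost_ballsP e.
Qed.

End Truncation.

End OccupancyLaw.

(** * Values of the translated Poisson law *)

Section TranslatedPoissonValues.
Context {R : realType} (mu s2 : R).
Local Notation a := (tp_shift mu s2).
Local Notation lam := (tp_mean mu s2).
Context (lam_gt0 : 0 < lam).

Lemma TPE (A : set int) : TP mu s2 A =
  (\esum_(z in shift_int a @^-1` A) (poisson_pmf lam z)%:E)%E.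
Proof.
by rewrite -[LHS]/(poisson_prob lam 0 (shift_int a @^-1` A)) /poisson_prob lam_gt0.
Qed.

Lemma TP_ge (A : set int) N :
  ((\sum_(z < N | `[< A (a + z%:Z) >]) poisson_pmf lam z)%:E <= TP mu s2 A)%E.
Proof.
rewrite TPE.
have -> : shift_int a @^-1` A = [set z | `[< A (a + z%:Z) >]].
  by apply/seteqP; split=> z /=; [move/asboolP | move/asboolP].
rewrite -nneseries_esum; last by move=> z _; rewrite lee_fin poisson_pmf_ge0.
rewrite -sumEFin -(big_mkord (fun z => `[< A (a + z%:Z) >]) (fun z => (poisson_pmf lam z)%:E)).
by apply: nneseries_lim_ge => z _ _; rewrite lee_fin poisson_pmf_ge0.
Qed.

Lemma TP_point v : TP mu s2 [set a + v%:Z] = (poisson_pmf lam v)%:E.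
Proof.
rewrite TPE (_ : _ @^-1` _ = [set v]) ?esum_set1 ?lee_fin ?poisson_pmf_ge0 //.
by apply/seteqP; split=> z /=; rewrite /shift_int; [lia | move=> ->].
Qed.

Lemma TP_point_below (j : int) : j < a -> TP mu s2 [set j] = 0%E.
Proof.
move=> ja; rewrite TPE (_ : _ @^-1` _ = set0) ?esum_set0 //.
by apply/seteqP; split=> z //=; rewrite /shift_int; lia.
Qed.

End TranslatedPoissonValues.

(** * Infinitely many boxes *)

Section TruncationLimit.
Context {R : realType} (p : nat -> R).
Context (p_gt0 : forall j, (1 <= j)%N -> 0 < p j).
Context (p_sum1 : (\sum_(1 <= j <oo) (p j)%:E = 1)%E).

Lemma box_sum_cvg : (fun m => \sum_(j < m) p j.+1) @ \oo --> (1 : R).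
Proof.
have p0 k : (1 <= k)%N -> true -> (0 <= (p k)%:E)%E.
  by move=> k1 _; rewrite lee_fin ltW // p_gt0.
have cv : (fun m => (\sum_(1 <= j < m) (p j)%:E)%E) @ \oo --> (1%:E : \bar R).
  by rewrite -p_sum1; exact: (is_cvg_nneseries p0).
have [_] := (fine_cvgP _ _).1 cv; rewrite -cvg_shiftS.
have <- // : (fun m => fine (\sum_(1 <= j < m.+1) (p j)%:E)%E) = (fun m => \sum_(j < m) p j.+1).
by apply/funext => m; rewrite sumEFin /= big_add1 big_mkord.
Qed.

Lemma cvg_fsum n (u : nat -> nat -> R) (l : nat -> R) :
  (forall k, (fun m => u m k) @ \oo --> l k) ->
  (fun m => \sum_(k < n) u m k) @ \oo --> \sum_(k < n) l k.
Proof.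
move=> ul; elim: n => [|n IHn].
  rewrite big_ord0 (_ : (fun m => _) = fun=> 0); first exact: cvg_cst.
  by apply/funext => m; rewrite big_ord0.
rewrite big_ord_recr (_ : (fun m => _) = (fun m => \sum_(k < n) u m k + u m n)).
  exact: cvgD.
by apply/funext => m; rewrite big_ord_recr.
Qed.

Lemma sum_head_boxes L m (f : nat -> R) : (L <= m)%N ->
  \sum_(x in ~: [set x : 'I_m.+1 | (x == ord0) || (L < x)%N]%SET) f x =
    \sum_(j < L) f j.+1.
Proof.
move=> Lm; rewrite big_mkcond big_ord_recl !inE eqxx /= add0r.
rewrite (big_ord_widen m (fun j => f j.+1) Lm) [RHS]big_mkcond /=.
by apply: eq_bigr => j _; rewrite !inE /= -leqNgt.
Qed.

Section Fixed.
Context (L : nat) (L_gt0 : (0 < L)%N) (L_tail : 1 - \sum_(j < L) p j.+1 <= Num.min 8^-1 (p 1%N)).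

(** The light boxes of the truncated schemes are those beyond the [L]-th, with the
    lumped box 0 among them, and the heavy box is the first one. With the number of
    balls fixed, every quantity is a finite sum of probabilities of the truncated
    law, hence converges. *)
Lemma law_defect_bound : exists2 C : R, 0 < C &
  forall (N : nat) d (T : measurableType d) (P : probability T R)
    (X : 'I_N.+1 -> {RV P >-> nat}), (0 < N)%N -> occupancy_scheme p X ->
  let mu := occupied_mean X in let s2 := occupied_var X in
  C < s2 -> forall F : nat -> R,
  (forall c, (forall k, `|fdiff F k| <= c) ->
     `|law_defect N.+1 (occ_law X) mu s2 F| <= C * c * Num.sqrt s2) /\
  (forall G, (forall M, \sum_(k < M) `|fdiff F k| <= G) ->
     `|law_defect N.+1 (occ_law X) mu s2 F| <= C * G).
Proof.
have [C C0 bound] := occupancy_stein_bound L (p_gt0 (leqnn 1)).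
exists C => // N d T P X N0 sch mu s2 Cs F.
pose w m := @trunc_weight R p m.
pose pim m := trunc_law p N.+1 m.
pose mum m := \sum_(k < N.+2) pim m k * k%:R.
pose s2m m := \sum_(k < N.+2) pim m k * (k%:R - mum m) ^+ 2.
have w0 m x : 0 <= w m x := trunc_weight_ge0 sch (ltn0Sn N) x.
have w1 m : \sum_x w m x = 1 := trunc_weight_sum1 p m.
have lost0 : (fun m => w m ord0) @ \oo --> (0 : R).
  have -> : (0 : R) = 1 - 1 by rewrite subrr.
  have -> : (fun m => w m ord0) = (fun m => 1 - \sum_(j < m) p j.+1).
    by apply/funext => m; rewrite /w /trunc_weight eqxx.
  by apply: cvgB; [exact: cvg_cst | exact: box_sum_cvg].
have pi_cvg k : (fun m => pim m k) @ \oo --> occ_law X k.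
  apply/cvgrPdist_le => e e0.
  have e1 : 0 < e / N.+1%:R by rewrite divr_gt0.
  have [M _ MP] := (cvgrPdist_le _ _).1 lost0 _ e1.
  exists M => // m Mm; apply: le_trans (trunc_law_close sch m (ltn0Sn N) k) _.
  have := MP m Mm; rewrite /= sub0r normrN ger0_norm ?w0 // => wm.
  by rewrite mulrC -ler_pdivlMr.
have Ex_law m (g : nat -> R) : Ex (w m) N.+1 (fun s => g (occ s)) =
    \sum_(k < N.+2) pim m k * g k.
  rewrite (eq_Ex _ (G := fun s => \sum_(k < N.+2) g k * (occ s == k)%:R)).
    by rewrite Ex_sum; apply: eq_bigr => k _; rewrite ExZ mulrC.
  by move=> s sn; rewrite sum_indicator // ltnS -sn occ_le_size.
have mumE m : Ex (w m) N.+1 (fun s => (occ s)%:R) = mum m := Ex_law m (fun k => k%:R).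
have s2mE m : kernel_mean (w m) N = s2m m.
  have := kernel_identity (w1 m) N (fun k => k%:R); rewrite mumE.
  have -> : Ex (w m) N (fun s => kernel (w m) N s * fdiff (fun k => k%:R) (occ s)) =
      kernel_mean (w m) N.
    by apply: eq_Ex => s _; rewrite /fdiff -natr1 addrAC subrr add0r mulr1.
  move=> <-.
  rewrite /s2m -(Ex_law m (fun k => (k%:R - mum m) ^+ 2)).
  rewrite (eq_Ex _ (G := fun s => ((occ s)%:R - mum m) ^+ 2 +
     mum m * ((occ s)%:R - mum m))); last by move=> s _; ring.
  by rewrite ExD ExZ ExB mumE (Ex_cst (w1 m)) subrr mulr0 addr0.
have defE m : stein_defect (w m) N F = law_defect N.+1 (pim m) (mum m) (s2m m) F.
  by rewrite /stein_defect mumE s2mE (Ex_law m (fun k => s2m m * fdiff F k - (k%:R - mum m) * F k)).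
have mum_cvg : mum @ \oo --> mu.
  rewrite /mu occupied_meanE //.
  apply: (cvg_fsum (u := fun m k => pim m k * k%:R) (l := fun k => occ_law X k * k%:R)) => k.
  by apply: cvgM; [exact: pi_cvg | exact: cvg_cst].
have s2m_cvg : s2m @ \oo --> s2.
  rewrite /s2 occupied_varE //; apply: (cvg_fsum (u := fun m k => pim m k * (k%:R - mum m) ^+ 2)
    (l := fun k => occ_law X k * (k%:R - mu) ^+ 2)) => k.
  apply: cvgM; first exact: pi_cvg.
  by apply: (@cvg_comp _ _ _ (fun m => k%:R - mum m) (fun x => x ^+ 2)); last exact: exprn_continuous;
    apply: cvgB; [exact: cvg_cst | exact: mum_cvg].
have def_cvg : (fun m => law_defect N.+1 (pim m) (mum m) (s2m m) F) @ \oo -->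
    law_defect N.+1 (occ_law X) mu s2 F.
  apply: (cvg_fsum (u := fun m k => pim m k * (s2m m * fdiff F k - (k%:R - mum m) * F k))
    (l := fun k => occ_law X k * (s2 * fdiff F k - (k%:R - mu) * F k))) => k.
  apply: cvgM; first exact: pi_cvg.
  apply: cvgB; first by apply: cvgM; [exact: s2m_cvg | exact: cvg_cst].
  apply: cvgM; last exact: cvg_cst.
  by apply: cvgB; [exact: cvg_cst | exact: mum_cvg].
have fin : \forall m \near \oo,
    (forall c, (forall k, `|fdiff F k| <= c) ->
      `|law_defect N.+1 (pim m) (mum m) (s2m m) F| <= C * c * Num.sqrt (s2m m)) /\
    (forall G, (forall M, \sum_(k < M) `|fdiff F k| <= G) ->
      `|law_defect N.+1 (pim m) (mum m) (s2m m) F| <= C * G).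
  have /cvgr_ge/(_ _ Cs)[M _ MP] := s2m_cvg.
  exists (maxn M L) => // m; rewrite /= geq_max => /andP[Mm Lm].
  rewrite -defE -s2mE.
  pose o : 'I_m.+1 := inord 1.
  have m1 : (1 < m.+1)%N by rewrite ltnS (leq_trans L_gt0).
  have o1 : o = 1%N :> nat by rewrite inordK.
  have on0 : o != ord0 by apply/eqP => /(congr1 val); rewrite /= o1.
  pose D := [set x : 'I_m.+1 | (x == ord0) || (L < x)%N]%SET.
  have wo : w m o = p 1%N by rewrite /w /trunc_weight (negPf on0) o1.
  have wD : \sum_(x in D) w m x = 1 - \sum_(j < L) p j.+1.
    have <- : \sum_(x in ~: D) w m x = \sum_(j < L) p j.+1.
      rewrite -(sum_head_boxes p Lm); apply: eq_bigr => x.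
      by rewrite !inE /w /trunc_weight => /norP[/negPf -> _].
    have e : \sum_(x in D) w m x + \sum_(x in ~: D) w m x = 1.
      rewrite -(w1 m) [RHS](bigID (mem D)) /=; congr (_ + _).
      by apply: eq_bigl => x; rewrite inE.
    by rewrite -e addrK.
  have DN : (#|~: D| <= L)%N.
    rewrite -(ler_nat R) -sum1_card natr_sum (sum_head_boxes (fun=> 1) Lm).
    by rewrite sumr_const card_ord.
  move: L_tail; rewrite le_min -wD => /andP[D8 Dp].
  apply: (bound _ (w m) o D N) => //.
  - by rewrite !inE (negPf on0) o1 -leqNgt.
  - by rewrite wo.
  - by rewrite wo.
  by rewrite s2mE; exact: MP.
(* both bounds are closed conditions on the limit *)
split=> [c Fc|G FG].
  have sq_cvg : (fun m => C * c * Num.sqrt (s2m m)) @ \oo --> C * c * Num.sqrt s2.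
    apply: cvgM; first exact: cvg_cst.
    by apply: (@cvg_comp _ _ _ s2m Num.sqrt); [exact: s2m_cvg | exact: sqrt_continuous].
  apply: (ler_cvg_to (cvg_norm def_cvg) sq_cvg).
  by apply: filterS fin => m [smooth _]; exact: smooth.
apply: (cvgr_to_le (cvg_norm def_cvg)).
by apply: filterS fin => m [_ local]; exact: local.
Qed.

End Fixed.

(** As soon as there are two balls, both 1 and 2 are possible numbers of occupied
    boxes. *)
Lemma variance_gt0 (N : nat) d (T : measurableType d) (P : probability T R)
    (X : 'I_N.+1 -> {RV P >-> nat}) : (0 < N)%N -> occupancy_scheme p X ->
  0 < occupied_var X.
Proof.
move=> N0 sch; set mu := occupied_mean X.
pose b1 : 'I_3 := inord 1; pose b2 : 'I_3 := inord 2.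
have e1 : b1 = 1%N :> nat by rewrite inordK.
have e2 : b2 = 2%N :> nat by rewrite inordK.
have nz1 : b1 != ord0 by apply/eqP => /(congr1 val); rewrite /= e1.
have nz2 : b2 != ord0 by apply/eqP => /(congr1 val); rewrite /= e2.
have b12 : b1 != b2 by apply/eqP => /(congr1 val); rewrite /= e1 e2.
have pos (s : N.+1.-tuple 'I_3) : all (fun x => x != ord0) s -> 0 < occ_law X (occ s).
  move=> /allP s0; apply: lt_le_trans (occ_law_ge sch (m := 2) (s := s) _); last first.
    by apply/negP => /s0; rewrite eqxx.
  apply: prodr_gt0 => i _; have /s0 x0 := mem_tnth i s.
  rewrite /trunc_weight (negPf x0); apply: p_gt0.
  by rewrite lt0n -[0%N]/(val (@ord0 2)) (inj_eq val_inj).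
have occ1 k : (0 < k)%N -> occ (nseq k b1) = 1%N.
  by case: k => [//|k] _; rewrite /occ; elim: k => //= k IHk; rewrite inE eqxx /= -[RHS]IHk.
(* 1 and 2 boxes are occupied when all balls, or all but one, fall into box 1 and
   the exceptional one into box 2 *)
have P1 : 0 < occ_law X 1.
  rewrite -(occ1 N.+1 (ltn0Sn N)); apply: (pos [tuple of nseq N.+1 b1]).
  by rewrite /= nz1 all_nseq nz1 orbT.
have P2 : 0 < occ_law X 2.
  have <- : occ (b2 :: nseq N b1) = 2%N.
    by rewrite occ_cons occ1 // mem_nseq N0 eq_sym (negPf b12).
  by apply: (pos [tuple of b2 :: nseq N b1]); rewrite /= nz2 all_nseq nz1 orbT.
rewrite occupied_varE // -/mu.
have k1 : (1 < N.+2)%N by []. have k2 : (2 < N.+2)%N by [].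
rewrite (bigD1 (Ordinal k1)) //= (bigD1 (Ordinal k2)) //=.
set rest := \sum_(_ < _ | _) _.
have rest0 : 0 <= rest by apply: sumr_ge0 => k _; rewrite mulr_ge0 ?sqr_ge0 // occ_law_ge0.
have q1 : 0 <= occ_law X 1 * (1 - mu) ^+ 2 by rewrite mulr_ge0 ?sqr_ge0 // ltW.
have q2 : 0 <= occ_law X 2 * (2 - mu) ^+ 2 by rewrite mulr_ge0 ?sqr_ge0 // ltW.
have [m1|m1] := eqVneq mu 1; last first.
  have : 0 < occ_law X 1 * (1 - mu) ^+ 2.
    by rewrite mulr_gt0 // lt_def sqr_ge0 sqrf_eq0 subr_eq0 eq_sym m1.
  lra.
have : 0 < occ_law X 2 * (2 - mu) ^+ 2 by rewrite m1 mulr_gt0 //; lra.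
lra.
Qed.

Lemma tail_small (e : R) : 0 < e -> exists2 L : nat, (0 < L)%N & 1 - \sum_(j < L) p j.+1 <= e.
Proof.
move=> e0; have [M _ MP] := (cvgrPdist_le _ _).1 box_sum_cvg _ e0.
exists M.+1 => //; apply: le_trans (MP M.+1 (leqnSn M)).
exact: ler_norm.
Qed.

End TruncationLimit.

Lemma bounded_translate (a : int) (n : nat) :
  exists M : nat, forall k, (k <= n)%N -> k%:Z - a < M%:Z.
Proof. by exists (`|n%:Z - a|.+1)%N => k kn; lia. Qed.

Theorem theorem1p1 (R : realType) (p : nat -> R) (j0 n0 : nat)
  (p_gt0 : forall j, (1 <= j)%N -> 0 < p j)
  (p_noninc : forall j, (1 <= j)%N -> p j.+1 <= p j)
  (p_sum1 : (\sum_(1 <= j <oo) (p j)%:E = 1)%E)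
  (hj0 : is_j0 p j0)
  (hn0 : is_n0 p j0 n0) :
  exists C : R,
    forall n : nat, (n0 <= n)%N ->
    forall (d : measure_display) (T : measurableType d) (P : probability T R)
           (X : 'I_n -> {RV P >-> nat}),
      occupancy_scheme p X ->
      let mu := occupied_mean X in
      let sigma := Num.sqrt (occupied_var X) in
      (dTV (occupied_law X) (TP mu (sigma ^+ 2)) <= (C * sigma^-1)%:E)%E /\
      (dloc (occupied_law X) (TP mu (sigma ^+ 2)) <= (C * sigma ^- 2)%:E)%E.
Proof.
have e0 : 0 < Num.min 8^-1 (p 1%N) by rewrite lt_min invr_gt0 ltr0n p_gt0.
have [L L0 Lt] := tail_small p_gt0 p_sum1 e0.
have [C C0 bound] := law_defect_bound p_gt0 p_sum1 L0 Lt.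
exists (2 * C + 3) => n n0n d T P X sch.
have [n03 _ _] := hn0.
case: n n0n X sch => [|N] n0n X sch mu sigma.
  by have := leq_trans n03 n0n.
have N0 : (0 < N)%N by have := leq_trans n03 n0n; case: (N).
set s2 := occupied_var X in sigma *.
have s20 : 0 < s2 := variance_gt0 p_gt0 N0 sch.
have sigma0 : 0 < sigma by rewrite sqrtr_gt0.
have sigma2 : sigma ^+ 2 = s2 by rewrite sqr_sqrtr // ltW.
rewrite sigma2.
set Q := TP mu s2; set K := occupied_law X.
have fK B : K B \is a fin_num by apply: fin_num_measure.
have fQ B : Q B \is a fin_num by apply: fin_num_measure.
have PQ (A : set int) : (`|K A - Q A| <= 1)%E.
  have K1 : fine (K A) <= 1 by rewrite -lee_fin fineK //; apply: probability_le1.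
  have Q1 : fine (Q A) <= 1 by rewrite -lee_fin fineK //; apply: probability_le1.
  have K0 : 0 <= fine (K A) by apply: fine_ge0.
  have Q0 : 0 <= fine (Q A) by apply: fine_ge0.
  rewrite -(fineK (fK A)) -(fineK (fQ A)) -EFinB abse_EFin lee_fin ler_norml; lra.
(* the distances are at most 1, and so are covered by the constant when the
   variance is bounded *)
have [small|large] := leP s2 (C + 1).
  have s1 : 1 <= (2 * C + 3) * sigma ^- 2.
    by rewrite sigma2 ler_pdivlMr //; lra.
  have s1' : 1 <= (2 * C + 3) * sigma^-1.
    rewrite ler_pdivlMr // mul1r.
    have : sigma ^+ 2 <= (C + 1) ^+ 2 by rewrite sigma2; nra.
    rewrite ler_pXn2r ?nnegrE //; [lra | exact: ltW | lra].
  split; apply: ge_ereal_sup => _ [A _ <-]; apply: le_trans (PQ _) _.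
    by rewrite -[1%E]/(1%:E) lee_fin.
  by rewrite -[1%E]/(1%:E) lee_fin -sigma2.
have s21 : 1 <= s2 by lra.
have sigma1 : 1 <= sigma by rewrite -sqrtr1 ler_wsqrtr.
have Cs : C < s2 by lra.
have defect := bound N d T P X N0 sch Cs; rewrite -/mu -/s2 in defect.
pose a := tp_shift mu s2; pose lam := tp_mean mu s2.
have [lam_mu /andP[s2lam lams2]] := (tp_shift_meanP mu s2 a lam).2 (conj erefl erefl).
have lam0 : 0 < lam := lt_le_trans s20 s2lam.
have pi0 := occ_law_ge0 X. have pi1 := occ_law_sum1 X.
have piv : \sum_(k < N.+2) occ_law X k * (k%:R - mu) ^+ 2 = s2 by rewrite -occupied_varE.
have smooth F c Fc := (defect F).1 c Fc.
have local F G FG := (defect F).2 G FG.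
have upper (A : set int) : (K A <= Q A + ((2 * C + 3) * sigma^-1)%:E)%E.
  have [M MP] := bounded_translate a N.+1.
  have H := law_le_translated pi0 pi1 piv s20 lam_mu s2lam lams2 (ltW C0) smooth
    (fun z => `[< A z >]) MP.
  rewrite /K occupied_law_sum.
  apply: le_trans (leeD2r _ (TP_ge lam0 A M)).
  rewrite -EFinD lee_fin addrC -lerBlDr; apply: le_trans H _.
  have : 3 / s2 <= 3 / sigma.
    by rewrite ler_pM2l // lef_pV2 ?posrE // -sigma2 expr2 -[leLHS]mul1r ler_pM2r.
  have : 0 <= C / sigma by rewrite divr_ge0 // ltW.
  rewrite -/sigma; lra.
split; apply: ge_ereal_sup => _ [A _ <-].
  have uA := upper A; have uC := upper (~` A).
  rewrite !probability_setC // in uC.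
  move: uA uC; rewrite -(fineK (fK A)) -(fineK (fQ A)).
  rewrite -!EFinB -!EFinD abse_EFin !lee_fin => uA uC.
  by rewrite ler_norml; lra.
have is0 : 0 < s2^-1 by rewrite invr_gt0.
have pointE (j : int) : K [set j] = (\sum_(k < N.+2 | k%:Z == j) occ_law X k)%:E.
  rewrite /K occupied_law_sum; congr EFin; apply: eq_bigl => k.
  by apply/asboolP/eqP.
rewrite pointE; have [Aa|aA] := ltP A a.
  rewrite /Q TP_point_below // sube0 abse_EFin lee_fin ger0_norm ?sumr_ge0 //.
  have s2C : s2^-1 <= (2 * C + 3) * s2^-1 by rewrite -[leLHS]mul1r ler_wpM2r ?(ltW is0) //; lra.
  apply: le_trans s2C.
  have [/existsP[k /eqP kA]|none] := boolP [exists k : 'I_N.+2, (k : nat)%:Z == A].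
    rewrite (big_pred1 k) => [|i].
      apply: (law_point_below pi0 piv s20 lam_mu s2lam); last by rewrite kA.
      by rewrite -ltnS.
    by rewrite /= -kA; apply/eqP/eqP => [[/val_inj]|->].
  rewrite big_pred0 ?(ltW is0) // => i.
  by apply: contraNF none => iA; apply/existsP; exists i.
have [v Av] : exists v : nat, A = a + v%:Z by exists `|A - a|%N; rewrite gez0_abs ?subr_ge0 // addrCA subrr addr0.
rewrite Av /Q TP_point // -EFinB abse_EFin lee_fin.
apply: le_trans (law_point_above pi0 pi1 piv s20 lam_mu s2lam lams2 (ltW C0) local v) _.
by rewrite ler_wpM2r ?(ltW is0) //; lra.
Qed.
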